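(* Let $n\geqslant2$ and let $\pi=\mathrm{ind}_{\mathrm{Z}_n\mathrm{K}_n}^{\mathrm{G}_n}(\omega_\pi\tau)$ be a depth zero cuspidal $\mathrm{R}$-representation of $\mathrm{G}_n$, with $\tau$ a cuspidal $\mathrm{R}$-representation of $\mathrm{GL}_n(k_\mathrm{F})$ realized on $W(\tau,\overline{\psi})$. Then: (1) $c(\pi)=n$, $\dim_\mathrm{R}\pi^{\mathrm{K}_n(n)}=1$, and every $f\in\pi^{\mathrm{K}_n(n)}$ has support contained in $\mathrm{Z}_n\mathrm{K}_n\Sigma_n\mathrm{K}_n(n)$. (2) For every integer $m>n$, $\dim_\mathrm{R}\pi^{\mathrm{K}_n(m)}=\binom{m-1}{n-1}$. (3) There is a unique $f_{\mathrm{new}}\in\pi^{\mathrm{K}_n(n)}$ with $$f_{\mathrm{new}}(\Sigma_n)=\sum_{b\in\mathrm{B}^{\mathrm{op}}_{n-1}(k_\mathrm{F})}b\cdot B_{\tau,\overline{\psi}},$$ and it is non-zero. Moreover, there exists a unique $\mathrm{R}$-valued Haar measure $dk$ on $\mathrm{K}_n(n)$ such that for all $g\in\mathrm{G}_n$, $$f_{\mathrm{new}}(g)=\int_{\mathrm{K}_n(n)}\mathcal{B}_{\widetilde{\tau}}(gk\Sigma_n^{-1})\,dk .$$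
   Context: $\mathrm{F}$ is a non-archimedean local field with ring of integers $\mathfrak{o}_\mathrm{F}$, maximal ideal $\mathfrak{p}_\mathrm{F}=\varpi_\mathrm{F}\mathfrak{o}_\mathrm{F}$, residue field $k_\mathrm{F}$ with $q$ elements ($q$ a power of the prime $p$). $\mathrm{R}$ is an algebraically closed field of characteristic $\ell\neq p$; representations are smooth on $\mathrm{R}$-vector spaces. $\mathrm{G}_n=\mathrm{GL}_n(\mathrm{F})$, $\mathrm{K}_n=\mathrm{GL}_n(\mathfrak{o}_\mathrm{F})$, $\mathrm{Z}_n$ the centre of $\mathrm{G}_n$, $\mathrm{K}_n^1=1+\mathrm{M}_n(\mathfrak{p}_\mathrm{F})$; for $k\in\mathrm{K}_n$, $\overline{k}$ is its image in $\mathrm{K}_n/\mathrm{K}_n^1=\mathrm{GL}_n(k_\mathrm{F})$. For $m\geqslant1$, $\mathrm{K}_n(m)=\{\left(\begin{smallmatrix}a&b\\c&d\end{smallmatrix}\right)\in\mathrm{K}_n: c\in\mathrm{M}_{1\times(n-1)}(\mathfrak{p}_\mathrm{F}^m),\ d\in1+\mathfrak{p}_\mathrm{F}^m\}$ (blocks of size $(n-1)+1$), $\mathrm{K}_n(0)=\mathrm{K}_n$; the conductor $c(\pi)$ is the least $m\geqslant0$ with $\pi^{\mathrm{K}_n(m)}\neq0$. $\Sigma_n=\mathrm{diag}(\varpi_\mathrm{F}^{n-1},\varpi_\mathrm{F}^{n-2},\dots,\varpi_\mathrm{F},1)$. Finite field data: $\mathrm{U}(k_\mathrm{F})$ is the upper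 unitriangular subgroup of $\mathrm{GL}_n(k_\mathrm{F})$; $\overline{\psi}:k_\mathrm{F}\to\mathrm{R}^\times$ is a fixed non-trivial character, extended to $\mathrm{U}(k_\mathrm{F})$ by $\overline{\psi}(u)=\overline{\psi}(u_{1,2}+\dots+u_{n-1,n})$. For a cuspidal $\tau$ of $\mathrm{GL}_n(k_\mathrm{F})$, $W(\tau,\overline{\psi})$ is its (unique) Whittaker model: the subspace of functions $W:\mathrm{GL}_n(k_\mathrm{F})\to\mathrm{R}$ with $W(ug)=\overline{\psi}(u)W(g)$ isomorphic to $\tau$, with $\mathrm{GL}_n(k_\mathrm{F})$ acting by right translation $(h\cdot W)(x)=W(xh)$. The Bessel function $B_{\tau,\overline{\psi}}$ is the unique $W\in W(\tau,\overline{\psi})$ with $W(gu)=\overline{\psi}(u)W(g)$ for $u\in\mathrm{U}(k_\mathrm{F})$ and $W(1)=1$. $\mathrm{B}^{\mathrm{op}}_{n-1}(k_\mathrm{F})$ is the group of invertible lower triangular $(n-1)\times(n-1)$ matrices over $k_\mathrm{F}$, embedded in $\mathrm{GL}_n(k_\mathrm{F})$ via $g\mapsto\mathrm{diag}(g,1)$ (for $n=2$ it is $\mathrm{GL}_1(k_\mathrm{F})$). Depth zero model: $\widetilde{\tau}=\omega_\pi\tau$ is the representation $zk\mapsto\omega_\pi(z)\tau(\overline{k})$ of $\mathrm{Z}_n\mathrm{K}_n$ (with $\omega_\pi$ a character of $\mathrm{Z}_n\simeq\mathrm{F}^\times$ compatible with the central character of $\tau$), and $\mathrm{ind}_{\mathrm{Z}_n\mathrm{K}_n}^{\mathrm{G}_n}(\widetilde\tau)$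 is the space of functions $f:\mathrm{G}_n\to W(\tau,\overline{\psi})$, compactly supported modulo $\mathrm{Z}_n$, with $f(zkg)=\omega_\pi(z)\,\overline{k}\cdot f(g)$, $\mathrm{G}_n$ acting by right translation. Every depth zero cuspidal $\mathrm{R}$-representation is of this form. The Bessel vector $\mathcal{B}_{\widetilde\tau}\in\mathrm{ind}_{\mathrm{Z}_n\mathrm{K}_n}^{\mathrm{G}_n}(\widetilde\tau)$ is supported in $\mathrm{Z}_n\mathrm{K}_n$ with $\mathcal{B}_{\widetilde\tau}(zk)=\omega_\pi(z)\,\overline{k}\cdot B_{\tau,\overline{\psi}}$. *)

(* Defs.v *)
From mathcomp Require Import all_boot all_order all_algebra.
Set Implicit Arguments. Unset Strict Implicit. Unset Printing Implicit Defensive.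
Import GRing.Theory.
Local Open Scope ring_scope.

(* O : ring of integers (as a predicate on F), w : uniformiser,
   k : residue field, red : reduction map (only meaningful on O). *)

Definition in_pow (F : fieldType) (O : pred F) (w : F) (m : nat) (x : F) : Prop :=
  exists y, O y /\ x = w ^+ m * y.

Definition is_nonarch_local_field (F : fieldType) (O : pred F) (w : F)
    (k : finFieldType) (red : F -> k) : Prop :=
  [/\ O 1 /\ (forall x y, O x -> O y -> O (x - y) /\ O (x * y)),
      O w /\ w != 0 /\ ~~ O w^-1,
      (forall x, x != 0 -> exists (e : int) (u : F), [/\ O u, u != 0, O u^-1 & x = w ^ e * u]),
      [/\ red 1 = 1,
          (forall x y, O x -> O y -> red (x + y) = red x + red y /\ red (x * y) = red x * red y),
          (forall a : k, exists x, O x /\ red x = a)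
        & (forall x, O x -> (red x = 0 <-> in_pow O w 1 x))]
    &
      (forall s : nat -> F, (forall i, O (s i)) ->
         (forall i, in_pow O w i (s i.+1 - s i)) ->
         exists x, forall i, in_pow O w i (x - s i))].

Definition inK (F : fieldType) (O : pred F) (n : nat) (g : 'M[F]_n) : Prop :=
  [/\ forall i j, O (g i j), \det g != 0 & O (\det g)^-1].

Definition inKm (F : fieldType) (O : pred F) (w : F) (n m : nat) (g : 'M[F]_n) : Prop :=
  inK O g /\
  forall i j : 'I_n, val i = n.-1 ->
    ((val j < n.-1)%N -> in_pow O w m (g i j)) /\ (val j = n.-1 -> in_pow O w m (g i j - 1)).

Definition inKN (F : fieldType) (O : pred F) (w : F) (n N : nat) (g : 'M[F]_n) : Prop :=
  forall i j, in_pow O w N (g i j - (i == j)%:R).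

Definition isZK (F : fieldType) (O : pred F) (n : nat) (g : 'M[F]_n) : Prop :=
  exists z k0, [/\ z != 0, inK O k0 & g = z%:M *m k0].

Definition Sigma (F : fieldType) (w : F) (n : nat) : 'M[F]_n :=
  \matrix_(i, j) (if i == j then w ^+ (n.-1 - i) else 0).

Definition unitri (k : finFieldType) (n : nat) (u : 'M[k]_n) : Prop :=
  forall i j : 'I_n, ((j < i)%N -> u i j = 0) /\ (i = j -> u i j = 1).

Definition psiU (k : finFieldType) (R : fieldType) (psi : k -> R) (n : nat)
    (u : 'M[k]_n) : R :=
  psi (\sum_(i : 'I_n) \sum_(j : 'I_n | val j == (val i).+1) u i j).

Definition nontrivial_char (k : finFieldType) (R : fieldType) (psi : k -> R) : Prop :=
  (forall a b, psi (a + b) = psi a * psi b) /\ exists a, psi a != 1.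

Definition upper_block (k : finFieldType) (n n1 : nat) (X : 'M[k]_n) : Prop :=
  forall i j : 'I_n, ~~ ((val i < n1)%N && (n1 <= val j)%N) -> X i j = 0.

(* Wsp is the Whittaker model W(tau, psi) of an (irreducible) cuspidal
   representation tau of GL_n(k), GL_n(k) acting by right translation.
   Functions are on 'M[k]_n and vanish off GL_n(k). *)
Definition cusp_whittaker (k : finFieldType) (R : fieldType) (n : nat)
    (psi : k -> R) (Wsp : ('M[k]_n -> R) -> Prop) : Prop :=
  [/\
      Wsp (fun _ => 0) /\
      (forall c W W', Wsp W -> Wsp W' -> Wsp (fun x => c * W x + W' x)),
      (forall W h, Wsp W -> h \in unitmx -> Wsp (fun x => W (x *m h))) /\
      (forall W x, Wsp W -> x \notin unitmx -> W x = 0),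
      (forall W u g, Wsp W -> unitri u -> W (u *m g) = psiU psi u * W g),
      (exists W, Wsp W /\ exists x, W x != 0) /\
      (forall W W', Wsp W -> Wsp W' -> (exists x, W x != 0) ->
         exists c : 'M[k]_n -> R,
           forall x, W' x = \sum_(h : 'M[k]_n | h \in unitmx) c h * W (x *m h))
    & (* cuspidal: no nonzero invariants under unipotent radicals of proper
         (maximal) standard parabolics *)
      (forall n1, (0 < n1 < n)%N -> forall W, Wsp W ->
         (forall X, upper_block n1 X -> forall x, W (x *m (1%:M + X)) = W x) ->
         forall x, W x = 0)].

Definition isBessel (k : finFieldType) (R : fieldType) (n : nat)
    (psi : k -> R) (Wsp : ('M[k]_n -> R) -> Prop) (B : 'M[k]_n -> R) : Prop :=
  [/\ Wsp B, B 1%:M = 1 &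
      forall u g, unitri u -> B (g *m u) = psiU psi u * B g].

Definition central_compat (F : fieldType) (O : pred F) (k : finFieldType)
    (red : F -> k) (R : fieldType) (n : nat) (Wsp : ('M[k]_n -> R) -> Prop)
    (omega : F -> R) : Prop :=
  [/\ forall a b, a != 0 -> b != 0 -> omega (a * b) = omega a * omega b,
      forall a, a != 0 -> omega a != 0
    & forall z, z != 0 -> O z -> O z^-1 -> forall W x, Wsp W ->
        W (x *m (red z)%:M) = omega z * W x].

(* f : G_n -> W(tau,psi), encoded as 'M[F]_n -> 'M[k]_n -> R (zero off G_n) *)
Definition ind_space (F : fieldType) (O : pred F) (k : finFieldType)
    (red : F -> k) (R : fieldType) (n : nat) (Wsp : ('M[k]_n -> R) -> Prop)
    (omega : F -> R) (f : 'M[F]_n -> 'M[k]_n -> R) : Prop :=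
  [/\ forall g, Wsp (f g),
      forall g x, g \notin unitmx -> f g x = 0,
      forall z k0 g x, z != 0 -> inK O k0 -> g \in unitmx ->
        f (z%:M *m k0 *m g) x = omega z * f g (x *m map_mx red k0)
    & (* compactly supported modulo Z_n *)
      exists gs : seq 'M[F]_n, forall g, (exists x, f g x != 0) ->
        exists z k0 h, [/\ z != 0, inK O k0, h \in gs & g = z%:M *m k0 *m h]].

Definition inv_space (F : fieldType) (O : pred F) (w : F) (k : finFieldType)
    (red : F -> k) (R : fieldType) (n : nat) (Wsp : ('M[k]_n -> R) -> Prop)
    (omega : F -> R) (m : nat) (f : 'M[F]_n -> 'M[k]_n -> R) : Prop :=
  ind_space O red Wsp omega f /\
  forall g k0 x, inKm O w m k0 -> f (g *m k0) x = f g x.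

Definition has_dim (F : fieldType) (k : finFieldType) (R : fieldType) (n : nat)
    (S : ('M[F]_n -> 'M[k]_n -> R) -> Prop) (d : nat) : Prop :=
  exists b : 'I_d -> 'M[F]_n -> 'M[k]_n -> R,
    [/\ forall i, S (b i),
        (forall c : 'I_d -> R, (forall g x, \sum_i c i * b i g x = 0) -> forall i, c i = 0)
      & forall f, S f -> exists c : 'I_d -> R, forall g x, f g x = \sum_i c i * b i g x].

(* Bessel vector: the element of ind supported in Z_n K_n with value B at 1
   (hence B(zk) = omega(z) kbar . B) *)
Definition isBesselVec (F : fieldType) (O : pred F) (k : finFieldType)
    (red : F -> k) (R : fieldType) (n : nat) (Wsp : ('M[k]_n -> R) -> Prop)
    (omega : F -> R) (B : 'M[k]_n -> R) (Bt : 'M[F]_n -> 'M[k]_n -> R) : Prop :=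
  [/\ ind_space O red Wsp omega Bt,
      forall g x, ~ isZK O g -> Bt g x = 0
    & forall x, Bt 1%:M x = B x].

(* the lower-triangular Borel B^op_{n-1}(k), embedded as diag(b, 1) *)
Definition lowerB (k : finFieldType) (n : nat) (b : 'M[k]_n) : bool :=
  [&& b \in unitmx,
      [forall i : 'I_n, forall j : 'I_n, (val i < val j)%N ==> (b i j == 0)]
    & [forall i : 'I_n, forall j : 'I_n, (val i == n.-1) ==> (b i j == (i == j)%:R)]].

Definition loc_const (F : fieldType) (O : pred F) (w : F) (R : fieldType)
    (n m : nat) (f : 'M[F]_n -> R) : Prop :=
  exists N, (0 < N)%N /\
    forall k0 k1, inKm O w m k0 -> inKN O w N k1 -> f (k0 *m k1) = f k0.

(* a Haar measure = nonzero left-invariant R-linear functional on the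
   locally constant R-valued functions on K_n(m) *)
Definition isHaar (F : fieldType) (O : pred F) (w : F) (R : fieldType)
    (n m : nat) (mu : ('M[F]_n -> R) -> R) : Prop :=
  [/\ forall f f', loc_const O w m f -> loc_const O w m f' ->
        (forall k0, inKm O w m k0 -> f k0 = f' k0) -> mu f = mu f',
      forall a f f', loc_const O w m f -> loc_const O w m f' ->
        mu (fun x => a * f x + f' x) = a * mu f + mu f',
      forall h f, inKm O w m h -> loc_const O w m f ->
        mu (fun x => f (h *m x)) = mu f
    & exists f, loc_const O w m f /\ mu f != 0].

(* Main.v *)
(** Every g in G lies in some Z K n(v) lam(a) K(m), where lam(a) = diag(w^a_1, ..., w^a_n) with
    a_n = 0 and n(v) = 1 + v e_n with v reduced modulo both sides. For an invariant function f the
    vector f(g) of W(tau, psi) is fixed by the image in GL_n(k) of the intersection of K and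
    g K(m) g^-1. Unless v = 0 and m > a_1 > ... > a_n = 0 (up to the order of the a_i), this image
    contains a conjugate of the unipotent radical of a proper parabolic subgroup, or a simple root
    group on which psi is non-trivial, and f(g) = 0. In the remaining case it is the group of
    lower triangular matrices of GL_(n-1)(k), whose invariants form the line spanned by the sum of
    the b.B: a Whittaker function is determined by its restriction to the mirabolic subgroup, by
    Fourier expansion along columns and the uniqueness of the Bessel vector. Conversely each
    admissible exponent a carries the average over K(m) of the translates of the Bessel vector,
    which does not vanish because the volume that computes it is a power of q. There are
    binom(m-1, n-1) such exponents, and for m = n only that of Sigma. *)

Require Import Defs.
From mathcomp Require Import all_boot all_order all_fingroup all_algebra.
From mathcomp Require Import boolp.
From mathcomp Require Import zify ring.
Set Implicit Arguments. Unset Strict Implicit. Unset Printing Implicit Defensive.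
Import Order.TTheory GRing.Theory Num.Theory.
Local Open Scope ring_scope.

(** * Pivoting and monomial matrices *)

(** The characteristic of R may divide the order of GL_n(k), and the volume of K(m) itself may
    vanish in R. This shapes three steps. Uniqueness of the Bessel vector comes from the
    Gelfand-Kazhdan anti-involution, which makes bi-equivariant functions commute under convolution,
    and from an eigenvector over the algebraically closed R, which replaces projections. The Haar
    measure is normalised on congruence cosets and not on K(m). Non-vanishing is always tested at
    the identity matrix: the sum of the b.B has value 1 there, whatever the order of the group, so
    an invariant f is governed by the scalars f(lam a)(1), and the oldforms are built as a dual
    family to these evaluations. Where the last row matters, matrices have size [n.+1], so [n] is
    then one less than in the theorem. *)

Section Pivot.
Variables (F : fieldType) (n : nat).
Implicit Types (A N M : 'M[F]_n) (c : 'cV[F]_n) (r : 'rV[F]_n).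

Definition monomial M :=
  (forall i j j', M i j != 0 -> M i j' != 0 -> j = j') /\
  (forall i i' j, M i j != 0 -> M i' j != 0 -> i = i').

Lemma mul_cr c r (i j : 'I_n) : (c *m r) i j = c i 0 * r 0 j.
Proof. by rewrite mxE big_ord1. Qed.

(** The matrices that clear column [j] from the left and row [i] from the right around the pivot.
    They are the identity plus a rank one matrix, so that unitriangularity and integrality are both
    read off from the ratios [N a j / N i j] and [N i b / N i j]. *)
Definition pivL N i j : 'M[F]_n :=
  1%:M - ((N i j)^-1 *: col j N - delta_mx i (0 : 'I_1)) *m delta_mx (0 : 'I_1) i.
Definition pivR N i j : 'M[F]_n :=
  1%:M - delta_mx j (0 : 'I_1) *m ((N i j)^-1 *: row i N - delta_mx (0 : 'I_1) j).
Definition schur N i j : 'M[F]_n := N - (N i j)^-1 *: (col j N *m row i N).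

Lemma schurE N i j a b : schur N i j a b = N a b - (N i j)^-1 * (N a j * N i b).
Proof. by rewrite mxE mxE mxE mul_cr !mxE. Qed.

Lemma pivLE N i j a b :
  pivL N i j a b = (a == b)%:R - ((N i j)^-1 * N a j - (a == i)%:R) * (b == i)%:R.
Proof. by rewrite !mxE big_ord1 !mxE !eqxx !andbT. Qed.

Lemma pivRE N i j a b :
  pivR N i j a b = (a == b)%:R - (a == j)%:R * ((N i j)^-1 * N i b - (b == j)%:R).
Proof. by rewrite !mxE big_ord1 !mxE !eqxx !andbT. Qed.

Lemma delta_row_mul p (A : 'M[F]_(n, p)) (i : 'I_n) : delta_mx (0 : 'I_1) i *m A = row i A.
Proof. by rewrite rowE. Qed.

Lemma delta_col_mul p (A : 'M[F]_(p, n)) (j : 'I_n) : A *m delta_mx j (0 : 'I_1) = col j A.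
Proof. by rewrite colE. Qed.

Lemma pivLR N i j : N i j != 0 ->
  pivL N i j *m N *m pivR N i j = schur N i j + N i j *: delta_mx i j.
Proof.
move=> nz.
have -> : pivL N i j *m N = schur N i j + delta_mx i (0 : 'I_1) *m row i N.
  rewrite /pivL /schur mulmxBl mul1mx -mulmxA delta_row_mul mulmxBl -scalemxAl.
  by rewrite opprB addrA addrAC.
rewrite /pivR mulmxBr mulmx1 mulmxA delta_col_mul.
have -> : col j (schur N i j + delta_mx i (0 : 'I_1) *m row i N)
   = N i j *: delta_mx i (0 : 'I_1).
  apply/matrixP=> a b; rewrite mxE [LHS]mxE schurE mul_cr !mxE ?eqxx ?andbT.
  by rewrite [N a j * _]mulrC mulKf // subrr add0r [b]ord1 eqxx andbT mulrC.
rewrite -scalemxAl mulmxBr scalerBr -scalemxAr scalerA mulfV // scale1r opprB.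
by rewrite -addrA (addrC (_ *m row i N)) subrK mul_delta_mx.
Qed.

(* A zero row or column of [N] is left alone by the row and column operations; this is what the
   last two clauses record, and it lets the reduction run inside a block. *)
Lemma pivot_reduction (L R : 'M[F]_n -> Prop) :
  L 1%:M -> R 1%:M ->
  (forall A B, L A -> L B -> L (A *m B)) -> (forall A B, R A -> R B -> R (A *m B)) ->
  (forall N, N != 0 -> exists i j, [/\ N i j != 0, L (pivL N i j) & R (pivR N i j)]) ->
  forall N, exists l r : 'M[F]_n, [/\ L l, R r, monomial (l *m N *m r),
    forall i, row i N = 0 ->
      [/\ col i l = delta_mx i 0, row i l = delta_mx 0 i & row i (l *m N *m r) = 0]
  & forall j, col j N = 0 -> row j r = delta_mx 0 j /\ col j (l *m N *m r) = 0].
Proof.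
move=> L1 R1 LM RM sel N.
(* Induction on the number of non-zero rows: the Schur complement loses row [i] and gains none. *)
have [d] := ubnP #|[pred i | row i N != 0]|; elim: d N => // d IH N ltd.
have [->|Nnz] := eqVneq N 0.
  exists 1%:M, 1%:M; rewrite !mulmx0 mul0mx; split=> //.
  - by split=> ? ? ?; rewrite mxE eqxx.
  - by move=> i _; rewrite -delta_col_mul mul1mx row0 row1.
  - by move=> j _; rewrite -delta_row_mul mulmx1 col0.
have [i [j [nz Ll Rr]]] := sel N Nnz.
have rowi : row i (schur N i j) = 0.
  by apply/matrixP=> a b; rewrite mxE schurE mxE mulrA mulVf // mul1r subrr.
have colj : col j (schur N i j) = 0.
  by apply/matrixP=> a b; rewrite mxE schurE mxE [N a j * _]mulrC mulKf // subrr.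
have row_z a : row a N = 0 -> row a (schur N i j) = 0.
  move=> z; have za b : N a b = 0 by have /matrixP/(_ 0 b) := z; rewrite !mxE.
  by apply/matrixP=> x b; rewrite mxE schurE !za mul0r mulr0 subrr mxE.
have col_z a : col a N = 0 -> col a (schur N i j) = 0.
  move=> z; have za b : N b a = 0 by have /matrixP/(_ b 0) := z; rewrite !mxE.
  by apply/matrixP=> x b; rewrite mxE schurE !za !mulr0 subrr mxE.
have [|l [r [Ll' Rr' mon rows cols]]] := IH (schur N i j).
  rewrite -ltnS; apply: leq_trans ltd; rewrite ltnS.
  apply/proper_card/properP; split.
    by apply/subsetP=> a; rewrite !inE; apply: contra => /eqP/row_z ->.
  exists i; rewrite !inE ?rowi ?eqxx //; apply/eqP=> /matrixP/(_ 0 j).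
  by rewrite !mxE; apply/eqP.
have [li _ Di] := rows i rowi; have [rj Dj] := cols j colj.
(* Row [i] and column [j] of the Schur complement vanish, so [l] fixes the basis column [i] and [r]
   the basis row [j]: the pivot passes through unchanged. *)
have E : (l *m pivL N i j) *m N *m (pivR N i j *m r)
    = l *m schur N i j *m r + N i j *: delta_mx i j.
  rewrite -!mulmxA (mulmxA N) (mulmxA (pivL _ _ _)) (mulmxA (pivL _ _ _)) pivLR //.
  rewrite mulmxDl mulmxDr mulmxA; congr (_ + _).
  rewrite -scalemxAl -scalemxAr -(mul_delta_mx (0 : 'I_1)) -mulmxA delta_row_mul rj.
  by rewrite mulmxA delta_col_mul li.
exists (l *m pivL N i j), (pivR N i j *m r); rewrite E; set D := l *m _ *m r.
have D0 b : D i b = 0 by have /matrixP/(_ 0 b) := Di; rewrite !mxE.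
have D0' b : D b j = 0 by have /matrixP/(_ b 0) := Dj; rewrite !mxE.
have DE a b : (D + N i j *: delta_mx i j) a b != 0 -> (a = i /\ b = j) \/ [/\ a != i, b != j & D a b != 0].
  have -> : (D + N i j *: delta_mx i j) a b = D a b + N i j * ((a == i) && (b == j))%:R.
    by rewrite [LHS]mxE; congr (_ + _); rewrite !mxE.
  case: (eqVneq a i) => [->|ai]; case: (eqVneq b j) => [->|bj] /=.
  - by left.
  - by rewrite D0 mulr0 addr0 eqxx.
  - by rewrite D0' mulr0 addr0 eqxx.
  - by rewrite mulr0 addr0; right.
split.
- exact: LM.
- exact: RM.
- case: mon => m1 m2; split.
    move=> a b b' /DE [[-> ->]|[ai bj h]] /DE [[? ?]|[ai' bj' h']] //; subst.
    + by rewrite eqxx in ai'.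
    + by rewrite eqxx in ai.
    + exact: m1 h h'.
  move=> a a' b /DE [[-> ->]|[ai bj h]] /DE [[? ?]|[ai' bj' h']] //; subst.
  + by rewrite eqxx in bj'.
  + by rewrite eqxx in bj.
  + exact: m2 h h'.
- move=> a az; have [la la' Da] := rows a (row_z a az).
  have ai : a != i.
    by apply/eqP=> e; move: az; rewrite e => /matrixP/(_ 0 j); rewrite !mxE; apply/eqP.
  split.
  - rewrite -delta_col_mul -mulmxA /pivL mulmxBl mul1mx -mulmxA.
    rewrite [delta_mx 0 i *m _]mul_delta_mx_0 1?eq_sym // mulmx0 subr0 delta_col_mul.
  - by rewrite la.
  - rewrite -delta_row_mul mulmxA delta_row_mul la' delta_row_mul; apply/rowP=> b.
    have Na0 : N a j = 0 by have /rowP/(_ j) := az; rewrite !mxE.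
    by rewrite mxE pivLE Na0 mulr0 (negPf ai) subrr mul0r subr0 mxE eq_sym eqxx.
  by rewrite raddfD /= Da linearZ /= -delta_row_mul mul_delta_mx_0 // scaler0 addr0.
- move=> b bz; have [rb Db] := cols b (col_z b bz).
  have bj : b != j.
    by apply/eqP=> e; move: bz; rewrite e => /matrixP/(_ i 0); rewrite !mxE; apply/eqP.
  split.
    rewrite -delta_row_mul mulmxA /pivR mulmxBr mulmx1 mulmxA.
    by rewrite mul_delta_mx_0 // mul0mx subr0 delta_row_mul.
  by rewrite raddfD /= Db linearZ /= -delta_col_mul mul_delta_mx_0 1?eq_sym // scaler0 addr0.
Qed.

Lemma monomial_perm M : monomial M -> M \in unitmx ->
  exists s : 'S_n, forall i j, (M i j != 0) = (j == s i).
Proof.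
move=> [m1 m2] Mu.
have ex i : exists j, M i j != 0.
  apply/existsP; apply: contraT; rewrite negb_exists => /forallP h.
  have r0 : row i M = 0 by apply/matrixP=> a b; rewrite !mxE; have := h b; rewrite negbK => /eqP.
  have : row i M *m invmx M = 0 by rewrite r0 mul0mx.
  rewrite -row_mul mulmxV // => /matrixP/(_ 0 i); rewrite !mxE eqxx => /eqP.
  by rewrite oner_eq0.
have [f fP] := fin_all_exists ex.
have inj : injective f by move=> a b e; apply: (m2 _ _ (f a)); rewrite // e.
exists (perm inj) => i j; rewrite permE; apply/idP/eqP => [h|->//].
exact: m1 h (fP i).
Qed.

(** Sherman-Morrison formula. For integral [c] and [r] it also shows that the inverse is integral as
    soon as [s] is a unit of O. *)
Lemma rank1_mul c r : let s := 1 + (r *m c) 0 0 in s != 0 ->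
  (1%:M + c *m r) *m (1%:M - s^-1 *: (c *m r)) = 1%:M.
Proof.
move=> s nz; rewrite mulmxBr mulmx1 -scalemxAr mulmxDl mul1mx mulmxA -(mulmxA c r c).
rewrite (mx11_scalar (r *m c)) mul_mx_scalar -scalemxAl.
have -> : c *m r + (r *m c) 0 0 *: (c *m r) = s *: (c *m r) by rewrite /s scalerDl scale1r.
by rewrite scalerA mulVf // scale1r addrK.
Qed.

Lemma rank1_unit c r : 1 + (r *m c) 0 0 != 0 -> 1%:M + c *m r \in unitmx.
Proof. by move=> nz; have /mulmx1_unit[] := rank1_mul nz. Qed.

End Pivot.

(** * Matrices with last row (0, ..., 0, 1) *)

Section Mirabolic.
Variables (F : fieldType) (n : nat).
Implicit Types (x y : 'M[F]_n.+1).

Definition mirabolic x := row ord_max x = delta_mx 0 ord_max.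

Lemma mirabolic_mulr x y : mirabolic x -> mirabolic y -> mirabolic (x *m y).
Proof. by rewrite /mirabolic row_mul => ->; rewrite delta_row_mul. Qed.

Lemma mirabolicE x j : mirabolic x -> x ord_max j = (j == ord_max)%:R.
Proof. by move=> /rowP/(_ j); rewrite !mxE eqxx. Qed.

Lemma mirabolic_inv x : x \in unitmx -> mirabolic x -> mirabolic (invmx x).
Proof.
by move=> xu mx; rewrite /mirabolic -delta_row_mul -{1}mx -row_mul mulmxV // row1.
Qed.

Lemma mirabolic_split x : mirabolic x -> exists (v : 'cV[F]_n.+1) y,
  [/\ v ord_max 0 = 0, row ord_max y = delta_mx 0 ord_max,
      col ord_max y = delta_mx ord_max 0
    & x = (1%:M + v *m delta_mx (0 : 'I_1) ord_max) *m y].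
Proof.
move=> mx; pose v : 'cV[F]_n.+1 := col ord_max x - delta_mx ord_max 0.
pose y : 'M[F]_n.+1 := \matrix_(i, j) if j == ord_max then (i == j)%:R else x i j.
have ry : row ord_max y = delta_mx 0 ord_max.
  by apply/rowP=> j; rewrite !mxE mirabolicE // eqxx [ord_max == j]eq_sym; case: (j == ord_max).
exists v, y; split=> //.
- by rewrite !mxE mirabolicE // !eqxx subrr.
- by apply/colP=> i; rewrite !mxE !eqxx andbT.
rewrite mulmxDl mul1mx -mulmxA delta_row_mul ry; apply/matrixP=> i j.
rewrite mxE mul_cr !mxE !eqxx /=; case: eqVneq => [->|]; last by rewrite mulr0 addr0.
by rewrite andbT mulr1 addrC subrK.
Qed.

(** Reduction of the upper left block: with the corner entry removed, the last row and column of [y]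
    are zero, and the clauses of [pivot_reduction] on zero rows and columns keep the operations
    mirabolic. It serves over the residue field as well as over O. *)
Lemma pivot_mirabolic (L R : 'M[F]_n.+1 -> Prop) y :
  L 1%:M -> R 1%:M ->
  (forall A B, L A -> L B -> L (A *m B)) -> (forall A B, R A -> R B -> R (A *m B)) ->
  (forall N : 'M[F]_n.+1, N != 0 -> exists i j, [/\ N i j != 0, L (pivL N i j) & R (pivR N i j)]) ->
  row ord_max y = delta_mx 0 ord_max -> col ord_max y = delta_mx ord_max 0 ->
  exists l r, [/\ L l, R r, mirabolic l, mirabolic r & monomial (l *m y *m r)].
Proof.
move=> L1 R1 LM RM sel ry cy; pose N := y - delta_mx ord_max ord_max.
have [l [r [Ll Rr mon rows cols]]] := pivot_reduction L1 R1 LM RM sel N.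
have [] := rows ord_max; first by rewrite raddfB /= ry -delta_row_mul mul_delta_mx subrr.
move=> lN ml DrN; have [] := cols ord_max; first by rewrite raddfB /= cy -delta_col_mul mul_delta_mx subrr.
move=> rN DcN.
exists l, r; split=> //.
have E : l *m y *m r = l *m N *m r + delta_mx ord_max ord_max.
  have -> : l *m N *m r = l *m y *m r -
      (l *m delta_mx ord_max (0 : 'I_1)) *m (delta_mx (0 : 'I_1) ord_max *m r).
    by rewrite /N mulmxBr mulmxBl mulmxA -(mulmxA l (delta_mx _ _)) mul_delta_mx.
  by rewrite delta_col_mul lN delta_row_mul rN mul_delta_mx subrK.
rewrite E; set D := l *m N *m r in mon DrN DcN *.
have D0 j : D ord_max j = 0 by have /matrixP/(_ 0 j) := DrN; rewrite !mxE.
have D1 i : D i ord_max = 0 by have /matrixP/(_ i 0) := DcN; rewrite !mxE.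
clearbody D.
have DE i j : (D + delta_mx ord_max ord_max) i j != 0 ->
    (i = ord_max /\ j = ord_max) \/ [/\ i != ord_max, j != ord_max & D i j != 0].
  rewrite !mxE; case: (eqVneq i ord_max) => [->|ai]; case: (eqVneq j ord_max) => [->|bj] /=.
  - by left.
  - by rewrite D0 addr0 eqxx.
  - by rewrite D1 addr0 eqxx.
  - by rewrite addr0; right.
case: mon => m1 m2; split.
  move=> a b b' /DE [[-> ->]|[ai bj h]] /DE [[? ?]|[ai' bj' h']] //; subst.
  - by rewrite eqxx in ai'.
  - by rewrite eqxx in ai.
  - exact: m1 h h'.
move=> a a' b /DE [[-> ->]|[ai bj h]] /DE [[? ?]|[ai' bj' h']] //; subst.
- by rewrite eqxx in bj'.
- by rewrite eqxx in bj.
- exact: m2 h h'.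
Qed.

End Mirabolic.

Section MonomialConj.
Variables (F : fieldType) (n : nat) (M : 'M[F]_n) (s : 'S_n).
Hypothesis Ms : forall i j, (M i j != 0) = (j == s i).

Lemma monomialE i j : M i j = (j == s i)%:R * M i (s i).
Proof.
case: eqP => [->|/eqP h]; first by rewrite mul1r.
by rewrite mul0r; apply/eqP; rewrite -[_ == _]negbK Ms.
Qed.

Lemma elem_monomial t i j :
  (1%:M + t *: delta_mx i j) *m M =
  M *m (1%:M + (t * M j (s j) / M i (s i)) *: delta_mx (s i) (s j)).
Proof.
have nz : M i (s i) != 0 by rewrite Ms.
rewrite mulmxDl mulmxDr mul1mx mulmx1; congr (_ + _).
rewrite -scalemxAl -scalemxAr; apply/matrixP=> a b.
rewrite -[delta_mx i j](mul_delta_mx (0 : 'I_1)) -[delta_mx (s i) _](mul_delta_mx (0 : 'I_1)).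
rewrite -mulmxA delta_row_mul [in RHS]mulmxA delta_col_mul.
rewrite !mxE !big_ord1 !mxE !eqxx ?andbT /= (monomialE j) (monomialE a).
rewrite (inj_eq perm_inj); case: (eqVneq i a) => [<-|ia].
  by field.
by rewrite !(mul0r, mulr0).
Qed.

End MonomialConj.

(* [v] will be the reversal of the permutation underlying a monomial matrix on which some
   bi-equivariant function does not vanish; the hypothesis [descent] makes it a direct sum of
   decreasing runs of consecutive values, hence an involution. *)
Section Layered.
Variables (n : nat) (T : Type) (v : 'S_n) (t : 'I_n -> T).
Hypothesis descent : forall i j : 'I_n, j = i.+1 :> nat -> (v j < v i)%N ->
  v i = (v j).+1 :> nat /\ t i = t j.

(** A discrete intermediate value property: a descent between neighbours has size one, so [v] cannot
    jump over a value on its way down. *)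
Lemma layered_ivt (i j : 'I_n) (c : nat) : (i < j)%N -> (v j < c)%N -> (c < v i)%N ->
  exists l : 'I_n, [/\ (i < l)%N, (l < j)%N & v l = c :> nat].
Proof.
move: j; suff H d (j : 'I_n) : j = (i + d.+1)%N :> nat -> (v j < c)%N -> (c < v i)%N ->
    exists l : 'I_n, [/\ (i < l)%N, (l < j)%N & v l = c :> nat].
  by move=> j ij; apply: (H (j - i.+1)%N); lia.
elim: d j => [|d IH] j jE vj vi.
  have [||E _] := descent (i := i) (j := j); lia.
have lt : (i + d.+1 < n)%N by have := ltn_ord j; lia.
pose j' := Ordinal lt; have [e|ne] := eqVneq (v j' : nat) c.
  by exists j'; split=> //=; lia.
have [lt'|ge] := ltnP (v j') c.
  have [|l [l1 l2 l3]] := IH j' _ lt' vi; first by [].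
  by exists l; split=> //; move: l2 => /=; lia.
have [||E _] := descent (i := j') (j := j); rewrite /=; lia.
Qed.

(** Everything between an inverted pair belongs to one decreasing run: if the value just before [j]
    were not between [v j] and [v i], the intermediate value property would make [v] take some value
    twice. *)
Lemma layered_inversion (i j : 'I_n) : (i < j)%N -> (v j < v i)%N ->
  (i + v i = j + v j)%N /\ t i = t j.
Proof.
move: j; suff H d (j : 'I_n) : j = (i + d.+1)%N :> nat -> (v j < v i)%N ->
    (i + v i = j + v j)%N /\ t i = t j.
  by move=> j ij; apply: (H (j - i.+1)%N); lia.
elim: d j => [|d IH] j jE vji.
  have [||E ->] := descent (i := i) (j := j); rewrite ?jE //; first by lia.
  by split=> //; rewrite E; lia.
have lt : (i + d.+1 < n)%N by have := ltn_ord j; lia.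
pose j' := Ordinal lt.
have nvi : v j' != v i by rewrite (inj_eq perm_inj) -val_eqE /=; lia.
have nvj : v j' != v j by rewrite (inj_eq perm_inj) -val_eqE /=; lia.
have vj'i : (v j' < v i)%N.
  rewrite ltnNge leq_eqVlt negb_or -val_eqE /= in nvi *; rewrite eq_sym nvi /=.
  apply/negP=> h; have [|l [l1 l2 l3]] := layered_ivt (i := j') (j := j) _ vji h; first by rewrite /=; lia.
  by move/val_inj/perm_inj: l3 l1 => -> /=; lia.
have vjj' : (v j < v j')%N.
  rewrite ltnNge leq_eqVlt negb_or -val_eqE /= in nvj *; rewrite nvj /=.
  apply/negP=> h; have [|l [l1 l2 l3]] := layered_ivt (i := i) (j := j') _ h vji; first by rewrite /=; lia.
  by move/val_inj/perm_inj: l3 l2 => -> /=; lia.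
have [//|E1 E2] := IH j' _ vj'i.
have [||E3 E4] := descent (i := j') (j := j) => //; first by rewrite /=; lia.
by split; [move: E1 => /=; lia | rewrite E2].
Qed.

Lemma layered_involution (i : 'I_n) : v (v i) = i /\ t (v i) = t i.
Proof.
have [c cE] : exists c, c = v i by exists (v i).
rewrite -cE; have vE : v i = c :> nat by rewrite cE.
have [e|ne] := eqVneq c i; first by rewrite e -cE e.
have nvc : v c != c by rewrite {2}cE (inj_eq perm_inj).
rewrite -val_eqE /= in ne; rewrite -val_eqE /= in nvc.
have [lt|ge] := ltnP i c; have [vlt|vge] := ltnP (v c) c.
- have [||E1 E2] := layered_inversion (i := i) (j := c); try lia.
  by split=> //; apply: val_inj => /=; lia.
- exfalso.
  (* Pigeonhole: [v] would map the indices that are at least [c] injectively into those above [c].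
     The other mixed case is the mirror image. *)
  have H (j : 'I_n) : (c <= j)%N -> (c < v j)%N.
    rewrite leq_eqVlt => /orP [/eqP/val_inj <-|cj]; first by lia.
    have nvj : v j != c by rewrite cE (inj_eq perm_inj) -val_eqE /=; lia.
    rewrite -val_eqE /= in nvj; case: (ltnP c (v j)) => // vj.
    have [||E1 _] := layered_inversion (i := c) (j := j) => //; first by lia.
    have [||E2 _] := layered_inversion (i := i) (j := j); lia.
  have : (#|[pred j : 'I_n | c <= j]| <= #|[pred j : 'I_n | c < j]|)%N.
    rewrite -(card_imset _ (@perm_inj _ v)); apply/subset_leq_card/subsetP => x.
    by case/imsetP => j; rewrite !inE => cj ->; apply: H.
  apply/negP; rewrite -ltnNge; apply/proper_card/properP; split.
    by apply/subsetP=> x; rewrite !inE; apply: ltnW.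
  by exists c; rewrite !inE ?ltnn.
- exfalso.
  have H (j : 'I_n) : (j <= c)%N -> (v j < c)%N.
    rewrite leq_eqVlt => /orP [/eqP/val_inj ->|cj]; first by lia.
    have nvj : v j != c by rewrite cE (inj_eq perm_inj) -val_eqE /=; lia.
    rewrite -val_eqE /= in nvj; case: (ltnP (v j) c) => // vj.
    have [||E1 _] := layered_inversion (i := j) (j := c) => //; first by lia.
    have [||E2 _] := layered_inversion (i := j) (j := i); lia.
  have : (#|[pred j : 'I_n | j <= c]| <= #|[pred j : 'I_n | j < c]|)%N.
    rewrite -(card_imset _ (@perm_inj _ v)); apply/subset_leq_card/subsetP => x.
    by case/imsetP => j; rewrite !inE => cj ->; apply: H.
  apply/negP; rewrite -ltnNge; apply/proper_card/properP; split.
    by apply/subsetP=> x; rewrite !inE; apply: ltnW.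
  by exists c; rewrite !inE ?ltnn.
- have [||E1 E2] := layered_inversion (i := c) (j := i); try lia.
  by split=> //; apply: val_inj => /=; lia.
Qed.

End Layered.

(** * Unitriangular matrices and the Gelfand-Kazhdan symmetry *)

Section Unitriangular.
Variables (k : finFieldType) (n : nat).
Implicit Types (A u v : 'M[k]_n).

Definition superdiag A : k := \sum_(i : 'I_n) \sum_(j : 'I_n | val j == (val i).+1) A i j.

Lemma superdiagD A u : superdiag (A + u) = superdiag A + superdiag u.
Proof.
rewrite /superdiag -big_split; apply: eq_bigr => i _; rewrite -big_split.
by apply: eq_bigr => j _; rewrite mxE.
Qed.

Lemma superdiag1 : superdiag 1%:M = 0.
Proof.
rewrite /superdiag big1 // => i _; rewrite big1 // => j /eqP e.
by rewrite mxE -val_eqE /= e ltn_eqF.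
Qed.

Lemma superdiag_col (t : 'cV[k]_n) (c : 'I_n) :
  superdiag (t *m delta_mx (0 : 'I_1) c) = \sum_(i : 'I_n | val c == (val i).+1) t i 0.
Proof.
rewrite /superdiag [RHS]big_mkcond; apply: eq_bigr => i _.
rewrite big_mkcond (bigD1 c) //= big1 ?addr0; last first.
  move=> j /negPf jc; rewrite mxE big_ord1 !mxE jc andbF mulr0; by case: ifP.
by rewrite mxE big_ord1 !mxE !eqxx mulr1.
Qed.

Lemma superdiag_delta (a : k) (i j : 'I_n) :
  superdiag (a *: delta_mx i j) = if val j == (val i).+1 then a else 0.
Proof.
rewrite -(mul_delta_mx (0 : 'I_1)) scalemxAl superdiag_col big_mkcond (bigD1 i) //= big1 ?addr0.
  by rewrite !mxE !eqxx mulr1.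
by move=> l /negPf li; rewrite !mxE li mulr0; case: ifP.
Qed.

Lemma unitri1 : unitri (1%:M : 'M[k]_n).
Proof.
move=> i j; rewrite mxE; split=> [ji|->]; last by rewrite eqxx.
by rewrite -val_eqE /=; case: eqP => //; lia.
Qed.

Lemma unitri_mul u v : unitri u -> unitri v -> unitri (u *m v).
Proof.
move=> uu vv i j; rewrite mxE; split=> [ji|<-{j}].
  rewrite big1 // => l _; have [li|il] := ltnP l i.
    by rewrite (uu i l).1 // mul0r.
  by rewrite (vv l j).1 ?mulr0 //; lia.
rewrite (bigD1 i) //= (uu i i).2 // (vv i i).2 // mul1r big1 ?addr0 // => l li.
rewrite -val_eqE /= in li; have [lt|il] := ltnP l i.
  by rewrite (uu i l).1 // mul0r.
by rewrite (vv l i).1 ?mulr0 //; lia.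
Qed.

Lemma superdiag_mul u v : unitri u -> unitri v ->
  superdiag (u *m v) = superdiag u + superdiag v.
Proof.
move=> uu vv; rewrite /superdiag -big_split; apply: eq_bigr => i _.
rewrite -big_split; apply: eq_bigr => j /eqP ji /=.
have {}ji : (j : 'I_n) = (i : 'I_n).+1 :> nat := ji.
have ij : i != j by rewrite -val_eqE /= ji neq_ltn ltnSn.
rewrite mxE (bigD1 i) //= (bigD1 j) 1?eq_sym //= (uu i i).2 // (vv j j).2 // mul1r mulr1.
rewrite big1 ?addr0 1?addrC // => l /andP [li lj].
rewrite -!val_eqE /= in li lj; have [lt|il] := ltnP l i.
  by rewrite (uu i l).1 // mul0r.
by rewrite (vv l j).1 ?mulr0 //; lia.
Qed.

Lemma unitri_unitmx u : unitri u -> u \in unitmx.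
Proof.
move=> uu; rewrite unitmxE -det_tr det_trig.
  rewrite big1 ?unitr1 // => i _; rewrite mxE; exact: (uu i i).2.
apply/is_trig_mxP => i j ij; rewrite mxE; exact: (uu j i).1.
Qed.

Lemma unitri_inv u : unitri u -> unitri (invmx u).
Proof.
move=> uu; have uU := unitri_unitmx uu.
pose P (B : 'M[k]_n) (m : nat) := forall i j : 'I_n, (i + m >= n)%N ->
  ((j < i)%N -> B i j = 0) /\ (i = j -> B i j = 1).
suff H m : P (invmx u) m by move=> i j; apply: (H n); lia.
elim: m => [|m IH] i j im; first by have := ltn_ord i; lia.
have E : \sum_l u i l * invmx u l j = (i == j)%:R.
  by have /matrixP/(_ i j) := mulmxV uU; rewrite !mxE.
have E' : (j <= i)%N -> invmx u i j = (i == j)%:R.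
  move=> ji; rewrite -E (bigD1 i) //= (uu i i).2 // mul1r big1 ?addr0 // => l li.
  rewrite -val_eqE /= in li; have [lt|il] := ltnP l i; first by rewrite (uu i l).1 // mul0r.
  by rewrite (IH l j _).1 ?mulr0 //; lia.
split=> [ji|e]; last by rewrite E' ?e ?eqxx.
by rewrite E' -?val_eqE /= ?gtn_eqF ?(ltnW ji).
Qed.

Lemma unitri_col (t : 'cV[k]_n) (c : 'I_n) : (forall i : 'I_n, (c <= i)%N -> t i 0 = 0) ->
  unitri (1%:M + t *m delta_mx (0 : 'I_1) c).
Proof.
move=> tz i j; rewrite !mxE big_ord1 !mxE eqxx /=; split=> [ji|<-].
  rewrite -val_eqE /= gtn_eqF // add0r.
  case: (eqVneq j c) => [e|]; last by rewrite mulr0.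
  by rewrite tz ?mul0r // -e ltnW.
rewrite eqxx; case: (eqVneq i c) => [->|]; last by rewrite mulr0 addr0.
by rewrite tz // mul0r addr0.
Qed.

Lemma unitri_elem (a : k) (i j : 'I_n) : (i < j)%N -> unitri (1%:M + a *: delta_mx i j).
Proof.
move=> ij; rewrite -(mul_delta_mx (0 : 'I_1)) scalemxAl; apply: unitri_col => l lj.
by rewrite !mxE -val_eqE /= gtn_eqF ?mulr0 //; apply: leq_trans lj.
Qed.

(** The anti-involution of Gelfand and Kazhdan, transposition about the antidiagonal: unlike the
    transpose, it preserves the upper unitriangular group together with its character. *)
Definition antitranspose A : 'M[k]_n := \matrix_(i, j) A (rev_ord j) (rev_ord i).
Notation sig := antitranspose.

Lemma antitransposeK : involutive antitranspose.
Proof. by move=> A; apply/matrixP=> i j; rewrite !mxE !rev_ordK. Qed.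

Lemma antitranspose1 : sig (1%:M : 'M[k]_n) = 1%:M.
Proof.
by apply/matrixP=> i j; rewrite !mxE (inj_eq rev_ord_inj) eq_sym.
Qed.

Lemma antitranspose_mul A u : sig (A *m u) = sig u *m sig A.
Proof.
apply/matrixP=> i j; rewrite !mxE (reindex_inj rev_ord_inj).
by apply: eq_bigr => l _; rewrite !mxE mulrC.
Qed.

Lemma antitranspose_unit A : (sig A \in unitmx) = (A \in unitmx).
Proof.
suff H B : B \in unitmx -> sig B \in unitmx.
  by apply/idP/idP => [/H|/H //]; rewrite antitransposeK.
move=> Bu; have := congr1 sig (mulmxV Bu); rewrite antitranspose_mul antitranspose1.
by case/mulmx1_unit.
Qed.

Lemma antitranspose_inv A : A \in unitmx -> invmx (sig A) = sig (invmx A).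
Proof.
move=> Au; have := congr1 sig (mulVmx Au); rewrite antitranspose_mul antitranspose1 => E.
have sAu : sig A \in unitmx by rewrite antitranspose_unit.
by rewrite -[LHS]mulmx1 -E mulmxA mulVmx // mul1mx.
Qed.

Lemma unitri_antitranspose u : unitri u -> unitri (sig u).
Proof.
move=> uu i j; rewrite mxE; split=> [ji|->]; last exact: (uu _ _).2.
by apply: (uu _ _).1 => /=; have := ltn_ord i; lia.
Qed.

Lemma superdiag_antitranspose A : superdiag (sig A) = superdiag A.
Proof.
rewrite /superdiag (exchange_big_dep predT) //= (reindex_inj rev_ord_inj).
apply: eq_bigr => i _; rewrite (reindex_inj rev_ord_inj) /=.
apply: eq_big => j; last by rewrite mxE !rev_ordK.
by have := ltn_ord i; have := ltn_ord j; lia.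
Qed.

End Unitriangular.

(** * Symmetry of bi-equivariant functions under the antitranspose *)

Section GelfandKazhdan.
Notation sig := antitranspose.
Variables (k : finFieldType) (R : fieldType) (n : nat) (psi : k -> R).
Hypothesis psiD : forall a b, psi (a + b) = psi a * psi b.
Hypothesis psi0 : psi 0 = 1.
Hypothesis psi_nt : exists a, psi a != 1.
Implicit Types (u v g h : 'M[k]_n) (f : 'M[k]_n -> R).

Lemma psi_neq0 a : psi a != 0.
Proof.
apply/eqP=> e; have := psiD a (- a); rewrite subrr psi0 e mul0r => /eqP.
by rewrite oner_eq0.
Qed.

Lemma psiN a : psi (- a) = (psi a)^-1.
Proof.
by apply: (mulfI (psi_neq0 a)); rewrite -psiD subrr psi0 mulfV // psi_neq0.
Qed.

Lemma psiUE u : psiU psi u = psi (superdiag u). Proof. by []. Qed.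

Lemma psiU_neq0 u : psiU psi u != 0. Proof. exact: psi_neq0. Qed.

Lemma psiU1 : psiU psi (1%:M : 'M[k]_n) = 1.
Proof. by rewrite psiUE superdiag1. Qed.

Lemma psiU_mul u v : unitri u -> unitri v -> psiU psi (u *m v) = psiU psi u * psiU psi v.
Proof. by move=> uu vv; rewrite !psiUE superdiag_mul. Qed.

Lemma psiU_inv u : unitri u -> psiU psi (invmx u) = (psiU psi u)^-1.
Proof.
move=> uu; apply: (mulfI (psiU_neq0 u)); rewrite -psiU_mul //; last exact: unitri_inv.
by rewrite mulmxV ?unitri_unitmx // psiU1 mulfV // psiU_neq0.
Qed.

Lemma psi_scale_inj (a b : k) : (forall t, psi (t * a) = psi (t * b)) -> a = b.
Proof.
move=> H; apply/eqP; rewrite -subr_eq0; apply/negPn/negP => nz.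
have [x /eqP[]] := psi_nt; have := H (x / (a - b)).
move=> E; by rewrite -(mulfVK nz x) mulrBr psiD psiN E mulfV // psi_neq0.
Qed.

Definition bi_equiv f := forall u g, unitri u ->
  f (u *m g) = psiU psi u * f g /\ f (g *m u) = psiU psi u * f g.

Lemma lowest_row (N : 'M[k]_n) : N != 0 -> exists i : 'I_n,
  (exists j, N i j != 0) /\ forall r j : 'I_n, (i < r)%N -> N r j = 0.
Proof.
move=> Nnz; have [i0 Pi0] : exists i, [exists j, N i j != 0].
  apply/existsP; apply: contraNT Nnz; rewrite negb_exists => /forallP h.
  apply/eqP/matrixP=> i j; rewrite mxE; apply/eqP; have := h i.
  by rewrite negb_exists => /forallP/(_ j); rewrite negbK.
have [i /existsP Pi maxi] :=
  @arg_maxnP _ i0 (fun i => [exists j, N i j != 0]) (fun i : 'I_n => val i) Pi0.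
exists i; split=> // r j ir; apply/eqP/negPn/negP => h.
have : (r <= i)%N := maxi r (introT existsP (ex_intro _ j h)).
by rewrite leqNgt ir.
Qed.

Lemma pivL_unitri (N : 'M[k]_n) i j : N i j != 0 ->
  (forall r j' : 'I_n, (i < r)%N -> N r j' = 0) -> unitri (pivL N i j).
Proof.
move=> nz low a b; rewrite pivLE; split=> [ba|<-].
  have -> : (a == b) = false by rewrite -val_eqE /= gtn_eqF.
  case: (eqVneq b i) => [e|]; last by rewrite mulr0 subrr.
  by rewrite (low a) -?e // mulr0 -val_eqE /= gtn_eqF // subr0 mul0r subrr.
rewrite eqxx; case: (eqVneq a i) => [->|]; last by rewrite mulr0 subr0.
by rewrite mulVf // subrr mul0r subr0.
Qed.

(** The pivot is the leftmost non-zero entry of the lowest non-zero row; both clearing matrices are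
    then upper unitriangular. *)
Lemma bruhat g : exists u v, [/\ unitri u, unitri v & monomial (u *m g *m v)].
Proof.
have [|||||l [r [Ll Rr m _ _]]] :=
  @pivot_reduction k n (@unitri k n) (@unitri k n) _ _ _ _ _ g;
  try exact: unitri1; try exact: unitri_mul; last by exists l, r.
move=> N /lowest_row [i [[j0 Pj0] low]].
have [j Pj minj] := @arg_minnP _ j0 (fun j => N i j != 0) (fun j : 'I_n => val j) Pj0.
exists i, j; split=> //; first exact: pivL_unitri.
move=> a b; rewrite pivRE; split=> [ba|<-].
  have -> : (a == b) = false by rewrite -val_eqE /= gtn_eqF.
  case: (eqVneq a j) => [e|]; last by rewrite mul0r subrr.
  have -> : N i b = 0 by apply/eqP/negPn/negP => /minj; rewrite leqNgt -e ba.
  by rewrite mulr0 -val_eqE /= -e ltn_eqF // subr0 mulr0 subrr.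
rewrite eqxx; case: (eqVneq a j) => [->|]; last by rewrite mul0r subr0.
by rewrite mulVf // subrr mulr0 subr0.
Qed.

Section MonomialBi.
Variables (f : 'M[k]_n -> R) (M : 'M[k]_n) (s : 'S_n).
Hypothesis Ms : forall i j, (M i j != 0) = (j == s i).
Hypothesis fbi : bi_equiv f.
Hypothesis fM : f M != 0.

(** A simple root element on the left of [M] becomes a root element at [(s i, s j)] on its right.
    Comparing the two characters for every [t] forces this root to be simple, psi being non-trivial,
    and the two entries of [M] to agree. *)
Lemma bi_equiv_ascent (i j : 'I_n) : j = i.+1 :> nat -> (s i < s j)%N ->
  s j = (s i).+1 :> nat /\ M i (s i) = M j (s j).
Proof.
move=> ji sij; have Mi : M i (s i) != 0 by rewrite Ms.
have E t : psi t = psi (if val (s j) == (val (s i)).+1 then t * M j (s j) / M i (s i) else 0).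
  have ut : unitri (1%:M + t *: delta_mx i j) by apply: unitri_elem; rewrite ji.
  have us := unitri_elem (t * M j (s j) / M i (s i)) sij.
  have := (fbi M ut).1; rewrite (elem_monomial Ms) (fbi M us).2.
  rewrite !psiUE !superdiagD !superdiag1 !add0r !superdiag_delta /= ji eqxx.
  by move/(mulIf fM).
case: eqP E => [e|_] E.
  split=> //; have /psi_scale_inj : forall t, psi (t * 1) = psi (t * (M j (s j) / M i (s i))).
    by move=> t; rewrite mulr1 mulrA.
  by move=> e1; rewrite -[LHS]mul1r e1 divfK.
by have [a /eqP[]] := psi_nt; rewrite E psi0.
Qed.

(** The ascents of [s] are the descents of its reversal [v]. That [v] is an involution along which
    the entries agree is precisely the symmetry of [M] about the antidiagonal. *)
Lemma bi_equiv_antitranspose_monomial : sig M = M.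
Proof.
pose v : 'S_n := (s * perm rev_ord_inj)%g.
have vE i : v i = rev_ord (s i) by rewrite permM permE.
have desc (i j : 'I_n) : j = i.+1 :> nat -> (v j < v i)%N ->
    v i = (v j).+1 :> nat /\ M i (s i) = M j (s j).
  move=> ji; rewrite !vE /= => lt.
  have [|e1 e2] := bi_equiv_ascent ji; first by have := ltn_ord (s i); have := ltn_ord (s j); lia.
  by split=> //; have := ltn_ord (s i); have := ltn_ord (s j); lia.
have inv := layered_involution desc.
apply/matrixP=> i j; rewrite mxE.
have nzE (i' j' : 'I_n) : M i' j' != 0 -> M (rev_ord j') (rev_ord i') = M i' j'.
  rewrite Ms => /eqP ->; have [e1 e2] := inv i'.
  rewrite -vE -e2; congr (M _ _).
  by apply: rev_ord_inj; rewrite rev_ordK -vE e1.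
case: (eqVneq (M i j) 0) => [z|/nzE //].
rewrite z; apply/eqP/negPn/negP => h; have := nzE _ _ h; rewrite !rev_ordK z => e.
by rewrite -e eqxx in h.
Qed.
End MonomialBi.

Theorem gelfand_kazhdan f g : bi_equiv f -> g \in unitmx -> f (sig g) = f g.
Proof.
move=> fbi gu; have [u [v [uu uv mon]]] := bruhat g.
set M := u *m g *m v in mon.
have Mu : M \in unitmx by rewrite !unitmx_mul (unitri_unitmx uu) (unitri_unitmx uv) gu.
have [s Ms] := monomial_perm mon Mu.
(* The monomial case gives symmetry only where [f] does not vanish; if [f M] is zero it is applied
   to [sig M] instead. *)
have fMs : f (sig M) = f M.
  have [z|/(bi_equiv_antitranspose_monomial Ms fbi) -> //] := eqVneq (f M) 0.
  have [->|nz] := eqVneq (f (sig M)) 0; first by rewrite z.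
  have sMs : forall i j, (sig M i j != 0) = (j == (perm rev_ord_inj * s^-1 * perm rev_ord_inj)%g i).
    have rE (x : 'I_n) : perm rev_ord_inj x = rev_ord x by rewrite permE.
    move=> i j; rewrite mxE Ms !permM !rE.
    by apply/eqP/eqP => ->; rewrite ?permK ?rev_ordK ?permKV.
  have := bi_equiv_antitranspose_monomial sMs fbi nz; rewrite antitransposeK => E.
  by rewrite {2}E.
have su := unitri_antitranspose uu; have sv := unitri_antitranspose uv.
move: fMs; rewrite /M !antitranspose_mul (fbi _ _ sv).1 (fbi _ _ su).2.
rewrite (fbi _ _ uv).2 (fbi _ _ uu).1 !psiUE !superdiag_antitranspose.
by move/(mulfI (psi_neq0 _))/(mulfI (psi_neq0 _)).
Qed.

End GelfandKazhdan.

(** * Uniqueness of the Bessel vector *)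

(** Sets of matrices cut out entry by entry have product cardinality. This is how the unitriangular
    group and the relevant sets of residue classes are seen to have a size invertible in [R]. *)
Lemma card_matrix_family (T : finType) (m n : nat) (P : 'I_m -> 'I_n -> pred T) :
  #|[pred M : 'M[T]_(m, n) | [forall i, forall j, P i j (M i j)]]| =
  (\prod_(p : 'I_m * 'I_n) #|P p.1 p.2|)%N.
Proof.
have -> : (\prod_(p : 'I_m * 'I_n) #|P p.1 p.2| = #|family (fun p => P p.1 p.2)|)%N.
  by rewrite card_family [RHS]foldrE big_image.
rewrite -!sum1_card (reindex (fun f : {ffun 'I_m * 'I_n -> T} => \matrix_(i, j) f (i, j))) /=.
  apply: eq_bigl => f; rewrite inE; apply/forallP/familyP => H.
    by move=> [i j]; have /forallP/(_ j) := H i; rewrite mxE.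
  by move=> i; apply/forallP=> j; rewrite mxE; apply: (H (i, j)).
exists (fun M : 'M_(m, n) => [ffun p => M p.1 p.2]) => f _.
  by apply/ffunP=> -[i j]; rewrite ffunE mxE.
by apply/matrixP=> i j; rewrite mxE ffunE.
Qed.

(* Cayley-Hamilton: apply the linear factors of the characteristic polynomial to [v0] one by one;
   the last non-zero vector is an eigenvector. *)
Lemma eigenrow (R : closedFieldType) (N : nat) (A : 'M[R]_N) (Q : 'rV[R]_N -> Prop) v0 :
  Q v0 -> v0 != 0 -> (forall v a, Q v -> Q (v *m A - a *: v)) ->
  exists v a, [/\ Q v, v != 0 & v *m A = a *: v].
Proof.
case: N A Q v0 => [|N] A Q v0 Q0 nz QA; first by rewrite thinmx0 eqxx in nz.
have [rs pE] := closed_field_poly_normal (char_poly A).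
have : v0 *m horner_mx A (char_poly A) = 0 by rewrite Cayley_Hamilton mulmx0.
rewrite pE linearZ /= -scalemxAr => /eqP; rewrite scaler_eq0 lead_coef_eq0.
rewrite -size_poly_eq0 size_char_poly /= => /eqP.
elim: rs v0 Q0 nz {pE} => [|a rs IH] v Qv nz.
  by rewrite big_nil rmorph1 mulmx1 => e; rewrite e eqxx in nz.
rewrite big_cons rmorphM rmorphB /= horner_mx_X horner_mx_C mulmxA mulmxBr mul_mx_scalar.
have [e _|nz'] := eqVneq (v *m A - a *: v) 0; last by apply: IH => //; apply: QA.
by exists v, a; split=> //; apply/eqP; rewrite -subr_eq0 e.
Qed.

(** [Q] stands for an invariant subspace. Only its stability under the kernel operator minus a
    scalar is asked, so that no basis of the Whittaker model has to be chosen. *)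
Lemma eigenfunction (R : closedFieldType) (X : finType) (K : X -> X -> R)
    (Q : (X -> R) -> Prop) f0 :
  Q f0 -> (exists x, f0 x != 0) ->
  (forall f a, Q f -> Q (fun x => \sum_y K x y * f y - a * f x)) ->
  exists f a, [/\ Q f, exists x, f x != 0 & forall x, \sum_y K x y * f y = a * f x].
Proof.
move=> Q0 [x0 f0x] QK.
pose A : 'M[R]_#|X| := \matrix_(i, j) K (enum_val j) (enum_val i).
pose fn (v : 'rV[R]_#|X|) x := v 0 (enum_rank x).
have fnA v x : fn (v *m A) x = \sum_y K x y * fn v y.
  rewrite /fn mxE (reindex (@enum_rank X)) /=; last by apply: onW_bij; apply: enum_rank_bij.
  by apply: eq_bigr => y _; rewrite mxE !enum_rankK mulrC.
pose v0 : 'rV[R]_#|X| := \row_j f0 (enum_val j).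
have f0E : fn v0 = f0 by apply/funext => x; rewrite /fn mxE enum_rankK.
have v0nz : v0 != 0.
  by apply: contra f0x => /eqP e; rewrite -f0E e /fn mxE.
have [|||v [a [Qv vnz vA]]] := @eigenrow R _ A (fun v => Q (fn v)) v0.
- by rewrite f0E.
- by [].
- move=> v a /QK-/(_ a); congr Q; apply/funext => x.
  by rewrite -fnA /fn !mxE.
exists (fn v), a; split=> //.
  have /rV0Pn [j vj] := vnz; exists (enum_val j).
  by rewrite /fn enum_valK.
by move=> x; rewrite -fnA vA /fn mxE.
Qed.

Section SumUnits.
Variables (k : finFieldType) (V : nmodType) (n : nat).
Implicit Types (G : 'M[k]_n -> V) (u : 'M[k]_n).

Lemma sum_unitmx_mull G u : u \in unitmx ->
  \sum_(h | h \in unitmx) G h = \sum_(h | h \in unitmx) G (u *m h).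
Proof.
move=> uu; rewrite (reindex_inj (can_inj (mulKmx uu))) /=.
by apply: eq_bigl => h; rewrite unitmx_mul uu.
Qed.

Lemma sum_unitmx_mulr G u : u \in unitmx ->
  \sum_(h | h \in unitmx) G h = \sum_(h | h \in unitmx) G (h *m u).
Proof.
move=> uu; rewrite (reindex_inj (can_inj (mulmxK uu))) /=.
by apply: eq_bigl => h; rewrite unitmx_mul uu andbT.
Qed.

Lemma sum_unitmx_inv G :
  \sum_(h | h \in unitmx) G h = \sum_(h | h \in unitmx) G (invmx h).
Proof.
rewrite (reindex_inj (can_inj (@invmxK _ _))) /=.
by apply: eq_bigl => h; rewrite unitmx_inv.
Qed.

End SumUnits.

Lemma invmx_uniq (F : comUnitRingType) n (A B : 'M[F]_n) : A *m B = 1%:M -> invmx A = B.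
Proof.
move=> AB; have [Au _] := mulmx1_unit AB.
by rewrite -[LHS]mulmx1 -AB mulKmx.
Qed.

Lemma invmx_mul (F : comUnitRingType) n (A B : 'M[F]_n) : A \in unitmx -> B \in unitmx ->
  invmx (A *m B) = invmx B *m invmx A.
Proof.
by move=> Au Bu; apply: invmx_uniq; rewrite -mulmxA mulKVmx // mulmxV.
Qed.

(** * Commutativity of convolution on bi-equivariant functions *)

Section Convolution.
Variables (k : finFieldType) (R : fieldType) (n : nat) (psi : k -> R).
Hypothesis psiD : forall a b, psi (a + b) = psi a * psi b.
Hypothesis psi0 : psi 0 = 1.
Hypothesis psi_nt : exists a, psi a != 1.
Implicit Types (f : 'M[k]_n -> R) (x : 'M[k]_n).
Notation biequiv := (@bi_equiv k R n psi).

Definition conv f1 f2 x := \sum_(h | h \in unitmx) f1 (x *m h) * f2 (invmx h).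

Lemma conv_bi_equiv f1 f2 : biequiv f1 -> biequiv f2 -> biequiv (conv f1 f2).
Proof.
move=> b1 b2 u g uu; have uU := unitri_unitmx uu; split.
  rewrite mulr_sumr; apply: eq_bigr => h _.
  by rewrite -mulmxA (b1 _ _ uu).1 mulrA.
rewrite mulr_sumr [RHS](sum_unitmx_mull _ uU); apply: eq_bigr => h hu.
rewrite mulmxA invmx_mul // (b2 _ _ (unitri_inv uu)).2 psiU_inv //.
by rewrite mulrCA mulVKf // psiU_neq0.
Qed.

(** Gelfand's trick: the antitranspose reverses products, hence the order of the convolution
    factors, and it fixes [f1], [f2] and their convolution. *)
Lemma conv_comm f1 f2 x : biequiv f1 -> biequiv f2 -> x \in unitmx ->
  conv f1 f2 x = conv f2 f1 x.
Proof.
move=> b1 b2 xu.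
rewrite -(gelfand_kazhdan psiD psi0 psi_nt (conv_bi_equiv b1 b2) xu).
rewrite /conv (reindex_inj (can_inj (@antitransposeK k n))) /=.
under eq_bigl do rewrite antitranspose_unit.
transitivity (\sum_(h | h \in unitmx) f1 (h *m x) * f2 (invmx h)).
  apply: eq_bigr => h hu; rewrite -antitranspose_mul antitranspose_inv //.
  rewrite !(gelfand_kazhdan psiD psi0 psi_nt) ?unitmx_mul ?unitmx_inv ?hu //.
have xiu : invmx x \in unitmx by rewrite unitmx_inv.
rewrite (sum_unitmx_mulr _ xiu) sum_unitmx_inv; apply: eq_bigr => h hu.
by rewrite mulmxKV // invmx_mul ?unitmx_inv // !invmxK mulrC.
Qed.

End Convolution.

Section WhittakerSpace.
Variables (k : finFieldType) (R : fieldType) (n : nat) (psi : k -> R).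
Variable Wsp : ('M[k]_n -> R) -> Prop.
Hypothesis HW : cusp_whittaker psi Wsp.
Implicit Types (W : 'M[k]_n -> R) (g h x : 'M[k]_n).

Lemma Wsp0 : Wsp (fun _ => 0).
Proof. have [[H _] _ _ _ _] := HW.
exact: H. Qed.

Lemma Wsp_lin c W W' : Wsp W -> Wsp W' -> Wsp (fun x => c * W x + W' x).
Proof. have [[_ H] _ _ _ _] := HW; apply: H. Qed.

Lemma Wsp_transl W h : Wsp W -> h \in unitmx -> Wsp (fun x => W (x *m h)).
Proof. have [_ [H _] _ _ _] := HW; apply: H. Qed.

Lemma Wsp_off W x : Wsp W -> x \notin unitmx -> W x = 0.
Proof. have [_ [_ H] _ _ _] := HW; apply: H. Qed.

Lemma Wsp_psi W u g : Wsp W -> unitri u -> W (u *m g) = psiU psi u * W g.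
Proof. have [_ _ H _ _] := HW; apply: H. Qed.

Lemma Wsp_irr W W' : Wsp W -> Wsp W' -> (exists x, W x != 0) ->
  exists c : 'M[k]_n -> R,
    forall x, W' x = \sum_(h : 'M[k]_n | h \in unitmx) c h * W (x *m h).
Proof. have [_ _ _ [_ H] _] := HW; apply: H. Qed.

Lemma Wsp_cusp n1 W : (0 < n1 < n)%N -> Wsp W ->
  (forall X, upper_block n1 X -> forall x, W (x *m (1%:M + X)) = W x) -> forall x, W x = 0.
Proof. have [_ _ _ _ H] := HW; move=> h; exact: (H n1 h W). Qed.

Lemma Wsp_scale c W : Wsp W -> Wsp (fun x => c * W x).
Proof.
move=> Ww; have := Wsp_lin c Ww Wsp0.
by congr Wsp; apply/funext => x; rewrite addr0.
Qed.

Lemma Wsp_sum (I : finType) (P : pred I) (c : I -> R) (G : I -> 'M[k]_n -> R) :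
  (forall i, P i -> Wsp (G i)) -> Wsp (fun x => \sum_(i | P i) c i * G i x).
Proof.
move=> WG; rewrite /index_enum; elim: (X in bigop _ X) => [|i s IH] //.
  by have := Wsp0; congr Wsp; apply/funext=> x; rewrite big_nil.
case Pi: (P i).
  have := Wsp_lin (c i) (WG i Pi) IH; congr Wsp; apply/funext=> x.
  by rewrite big_cons Pi.
by have := IH; congr Wsp; apply/funext=> x; rewrite big_cons Pi.
Qed.

Lemma Wsp_sub W W' : Wsp W -> Wsp W' -> Wsp (fun x => W x - W' x).
Proof.
move=> w w'; have := Wsp_lin (-1) w' w.
by congr Wsp; apply/funext=> x; rewrite mulN1r addrC.
Qed.

End WhittakerSpace.

Section MultiplicityOne.
Variables (k : finFieldType) (R : closedFieldType) (n : nat) (psi : k -> R).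
Variable Wsp : ('M[k]_n -> R) -> Prop.
Hypothesis psiD : forall a b, psi (a + b) = psi a * psi b.
Hypothesis psi0 : psi 0 = 1.
Hypothesis psi_nt : exists a, psi a != 1.
Hypothesis qR : (#|k|%:R : R) != 0.
Hypothesis HW : cusp_whittaker psi Wsp.
Implicit Types (W : 'M[k]_n -> R) (g h x u v : 'M[k]_n).

Definition unitrib u : bool := `[< unitri u >].

Lemma unitribP u : reflect (unitri u) (unitrib u). Proof. exact: asboolP. Qed.

(** The order is a power of q, which makes averaging over the unitriangular group legitimate in
    [R]. *)
Lemma card_unitri_neq0 : (#|unitrib|%:R : R) != 0.
Proof.
pose P (i j : 'I_n) : pred k := fun a => if (j < i)%N then a == 0 else if i == j then a == 1 else true.
have -> : #|unitrib| = #|[pred M : 'M[k]_n | [forall i, forall j, P i j (M i j)]]|.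
  apply: eq_card => u; rewrite !inE; apply/unitribP/forallP => H.
    move=> i; apply/forallP=> j; rewrite /P.
    case: ltnP => [ji|_]; first by rewrite (H i j).1.
    by case: eqP => // ij; rewrite (H i j).2.
  move=> i j; have /forallP/(_ j) b := H i; rewrite /P in b; split=> [ji|e].
    by move: b; rewrite ji => /eqP.
  by move: b; rewrite e ltnn eqxx => /eqP.
rewrite card_matrix_family natr_prod; apply/prodf_neq0 => -[i j] _ /=.
case E: (j < i)%N.
  rewrite (@eq_card _ _ (pred1 0)) ?card1 ?oner_eq0 // => a.
  by rewrite unfold_in /P E.
case E': (i == j).
  rewrite (@eq_card _ _ (pred1 1)) ?card1 ?oner_eq0 // => a.
  by rewrite unfold_in /P E E'.
by rewrite (@eq_card _ _ k) // => a; rewrite unfold_in /P E E'.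
Qed.

Definition right_equiv W := forall u g, unitri u -> W (g *m u) = psiU psi u * W g.

Lemma Wsp_bi_equiv W : Wsp W -> right_equiv W -> @bi_equiv k R n psi W.
Proof. by move=> w r u g uu; split; [apply: (Wsp_psi HW) | apply: r]. Qed.

(* Irreducibility provides some kernel [c]; averaging it over the unitriangular group on both
   sides makes it bi-equivariant. *)
Lemma bi_equiv_kernel W B : right_equiv W -> right_equiv B ->
  (exists c : 'M[k]_n -> R, forall x, W x = \sum_(h | h \in unitmx) c h * B (x *m h)) ->
  exists d, @bi_equiv k R n psi d /\ forall x, W x = conv B d x.
Proof.
move=> rW rB [c cE].
have pn := psiU_neq0 psiD psi0.
pose e h := \sum_(p : 'M[k]_n * 'M[k]_n | unitrib p.1 && unitrib p.2)
  (psiU psi p.1)^-1 * (psiU psi p.2)^-1 * c (invmx p.1 *m h *m invmx p.2).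
pose N : R := #|[pred p : 'M[k]_n * 'M[k]_n | unitrib p.1 && unitrib p.2]|%:R.
have Nnz : N != 0.
  rewrite /N; have -> : #|[pred p : 'M[k]_n * 'M[k]_n | unitrib p.1 && unitrib p.2]| = (#|unitrib| * #|unitrib|)%N.
    by rewrite -cardX; apply: eq_card => -[u v]; rewrite !inE.
  by rewrite natrM mulf_neq0 // card_unitri_neq0.
have eE x : N * W x = \sum_(h | h \in unitmx) e h * B (x *m h).
  have H u v : unitri u -> unitri v -> W x = \sum_(h | h \in unitmx)
      ((psiU psi u)^-1 * (psiU psi v)^-1 * c (invmx u *m h *m invmx v)) * B (x *m h).
    move=> uu vv; have uU := unitri_unitmx uu; have vU := unitri_unitmx vv.
    apply: (mulfI (pn _ u)); rewrite -rW // cE mulr_sumr.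
    rewrite [RHS](sum_unitmx_mull _ uU) [RHS](sum_unitmx_mulr _ vU); apply: eq_bigr => h hu.
    rewrite !mulmxA mulVmx // mul1mx mulmxK // (rB v) //.
    by rewrite -!mulrA mulVKf ?pn // mulrCA mulKf ?pn // !mulmxA.
  rewrite /N -sum1_card natr_sum mulr_suml.
  under [RHS]eq_bigr do rewrite mulr_suml.
  rewrite exchange_big /=; apply: eq_bigr => -[u v] /andP [/unitribP uu /unitribP vv] /=.
  by rewrite mul1r (H u v).
(* The inverse turns a sum of right translates of [B] into the convolution [conv B d]. *)
pose d h := if h \in unitmx then N^-1 * e (invmx h) else 0.
have e1 u0 h : unitri u0 -> e (u0 *m h) = (psiU psi u0)^-1 * e h.
  move=> uu; have uU := unitri_unitmx uu; rewrite /e mulr_sumr.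
  rewrite (reindex (fun p => (u0 *m p.1, p.2))) /=; last first.
    exists (fun p => (invmx u0 *m p.1, p.2)) => -[u v] _ /=; by rewrite ?mulKmx ?mulKVmx.
  apply: eq_big => -[u v] /=.
    congr andb; apply/unitribP/unitribP => h1; last exact: unitri_mul.
    by rewrite -(mulKmx uU u); apply: unitri_mul => //; apply: unitri_inv.
  move=> /andP [/unitribP h1 _].
  have uuu : unitri u by rewrite -(mulKmx uU u); apply: unitri_mul => //; apply: unitri_inv.
  rewrite invmx_mul ?unitri_unitmx // mulmxA mulmxKV // (psiU_mul psiD) // invfM.
  by rewrite !mulrA.
have e2 u0 h : unitri u0 -> e (h *m u0) = (psiU psi u0)^-1 * e h.
  move=> uu; have uU := unitri_unitmx uu; rewrite /e mulr_sumr.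
  rewrite (reindex (fun p => (p.1, p.2 *m u0))) /=; last first.
    exists (fun p => (p.1, p.2 *m invmx u0)) => -[u v] _ /=; by rewrite ?mulmxK ?mulmxKV.
  apply: eq_big => -[u v] /=.
    congr andb; apply/unitribP/unitribP => h1; last exact: unitri_mul.
    by rewrite -(mulmxK uU v); apply: unitri_mul => //; apply: unitri_inv.
  move=> /andP [_ /unitribP h1].
  have vvv : unitri v by rewrite -(mulmxK uU v); apply: unitri_mul => //; apply: unitri_inv.
  rewrite invmx_mul ?unitri_unitmx // !mulmxA mulmxK // (psiU_mul psiD) // invfM.
  by rewrite !mulrA; congr (_ * _); rewrite mulrC mulrA.
exists d; split.
  move=> u g uu; have uU := unitri_unitmx uu; rewrite /d !unitmx_mul uU /= andbT.
  case: ifP => gu; last by rewrite mulr0.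
  have ui := unitri_inv uu.
  by split; rewrite invmx_mul // ?(e2 (invmx u)) ?(e1 (invmx u)) // psiU_inv // invrK mulrCA.
move=> x; apply: (mulfI Nnz); rewrite eE /conv mulr_sumr; apply: eq_bigr => h hu.
by rewrite /d unitmx_inv hu invmxK mulrCA mulVKf // mulrC.
Qed.

(* Convolution by a bi-equivariant kernel is the same on both sides; on one side it preserves
   the Whittaker model, on the other it commutes with translations, so by irreducibility it acts
   by the eigenvalue of any eigenvector. *)
Theorem whittaker_multiplicity_one W B : Wsp W -> Wsp B -> right_equiv W -> right_equiv B ->
  B 1%:M = 1 -> forall x, W x = W 1%:M * B x.
Proof.
move=> wW wB rW rB B1.
have Bnz : exists x, B x != 0 by exists 1%:M; rewrite B1 oner_eq0.
have [d [bd dE]] := bi_equiv_kernel rW rB (Wsp_irr HW wB wW Bnz).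
pose Q X := Wsp X /\ right_equiv X.
(* The matrix of the operator sending [X] to [conv X d], after the substitution y = x h. *)
pose K x y := if (x \in unitmx) && (y \in unitmx) then d (invmx (invmx x *m y)) else 0.
have KE X x : Wsp X -> \sum_y K x y * X y = conv X d x.
  move=> wX; have [xu|xu] := boolP (x \in unitmx); last first.
    rewrite /conv !big1 // => [h hu|y _]; last by rewrite /K (negPf xu) mul0r.
    by rewrite (Wsp_off HW wX) ?mul0r // unitmx_mul (negPf xu).
  rewrite (bigID (fun y => y \in unitmx)) /= [X in _ + X]big1 ?addr0; last first.
    by move=> y /negPf yu; rewrite /K yu andbF mul0r.
  rewrite (sum_unitmx_mull _ xu) /conv; apply: eq_bigr => h hu.
  by rewrite /K unitmx_mul xu hu /= mulKmx // mulrC.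
have rconv X : Wsp X -> right_equiv X -> right_equiv (conv X d).
  move=> wX rX u g uu; have := conv_bi_equiv psiD psi0 (Wsp_bi_equiv wX rX) bd.
  by move=> H; apply: (H _ _ uu).2.
have wconv X : Wsp X -> Wsp (conv X d).
  move=> wX; have := Wsp_sum HW (fun h => d (invmx h))
    (fun h (hu : h \in unitmx) => Wsp_transl HW wX hu).
  by congr Wsp; apply/funext => x; apply: eq_bigr => h _; rewrite mulrC.
have [|X0 [a [[wX rX] Xnz XE]]] := @eigenfunction R _ K Q B (conj wB rB) Bnz.
  move=> X a [wX rX].
  have -> : (fun x => \sum_y K x y * X y - a * X x) = (fun x => (- a) * X x + conv X d x).
    by apply/funext=> x; rewrite KE // mulNr addrC.
  split; first by apply: (Wsp_lin HW) => //; apply: wconv.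
  by move=> u g uu; rewrite rX // rconv // mulrDr mulrCA.
have WE x : x \in unitmx -> W x = a * B x.
  move=> xu; rewrite dE (conv_comm psiD psi0 psi_nt) //; try exact: Wsp_bi_equiv.
  (* [B] is a combination of right translates of the eigenvector. Convolution with [d] on the left
     commutes with these translations, so the eigenvalue [a] passes to [B]. *)
  have [c cE] := Wsp_irr HW wX wB Xnz.
  rewrite /conv; under eq_bigr do rewrite cE mulr_sumr.
  rewrite exchange_big /= cE mulr_sumr; apply: eq_bigr => h hu.
  have xhu : x *m h \in unitmx by rewrite unitmx_mul xu.
  rewrite [RHS]mulrCA -XE KE // (conv_comm psiD psi0 psi_nt) //; try exact: Wsp_bi_equiv.
  rewrite /conv mulr_sumr (sum_unitmx_mull _ hu); apply: eq_bigr => y yu.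
  by rewrite invmx_mul // mulmxKV // mulmxA mulrCA.
move=> x; have [xu|xu] := boolP (x \in unitmx); last by rewrite !(Wsp_off HW (x := x)) ?mulr0.
by rewrite !WE ?unitmx1 // B1 mulr1.
Qed.

End MultiplicityOne.

(** * Restriction to the mirabolic subgroup *)

Section CuspidalSubset.
Variables (k : finFieldType) (R : fieldType) (n : nat) (psi : k -> R).
Variable Wsp : ('M[k]_n -> R) -> Prop.
Hypothesis HW : cusp_whittaker psi Wsp.

Lemma initial_segment_perm (I : {set 'I_n}) :
  exists s : 'S_n, forall i, (s i < #|I|)%N = (i \in I).
Proof.
pose e := enum I ++ enum (~: I).
have eT i : i \in e by rewrite mem_cat !mem_enum inE orbN.
have eS : size e = n by rewrite size_cat -!cardE cardsC card_ord.
have lt i : (index i e < n)%N by rewrite -[X in (_ < X)%N]eS index_mem.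
have inj : injective (fun i => Ordinal (lt i)).
  by move=> i j /(congr1 val) /= E; rewrite -(nth_index i (eT i)) E nth_index.
exists (perm inj) => i; rewrite permE /= /e index_cat mem_enum cardE; case: ifP => iI.
  by rewrite index_mem mem_enum.
by rewrite ltnNge leq_addr.
Qed.

(* A Weyl element moves the root groups [I x ~: I] to a standard unipotent radical. *)
Lemma cusp_subset (I : {set 'I_n}) W : Wsp W -> I != set0 -> I != setT ->
  (forall i j a x, i \in I -> j \notin I -> W (x *m (1%:M + a *: delta_mx i j)) = W x) ->
  forall x, W x = 0.
Proof.
move=> wW I0 IT inv.
pose supp (X : 'M[k]_n) := forall i j, ~~ ((i \in I) && (j \notin I)) -> X i j = 0.
pose P X := supp X /\ forall x, W (x *m (1%:M + X)) = W x.
have P0 : P 0 by split=> [i j _|x]; rewrite ?mxE // addr0 mulmx1.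
have PD X Y : P X -> P Y -> P (X + Y).
  move=> [sX iX] [sY iY]; split=> [i j h|x]; first by rewrite mxE sX ?sY ?addr0.
  (* Matrices supported on [I] times its complement multiply to zero, so X -> 1 + X turns sums into
     products and invariance under single root groups is enough. *)
  have XY : X *m Y = 0.
    apply/matrixP=> i j; rewrite !mxE big1 // => l _; case lI: (l \in I).
      by rewrite sX ?mul0r // lI andbF.
    by rewrite sY ?mulr0 // lI.
  rewrite -(iX x) -(iY (x *m (1%:M + X))) -mulmxA; congr (W (_ *m _)).
  by rewrite mulmxDl mul1mx mulmxDr mulmx1 XY addr0 -addrA [Y + X]addrC.
have suppP X : supp X -> forall x, W (x *m (1%:M + X)) = W x.
  move=> sX; suff [] : P X by [].
  rewrite [X]matrix_sum_delta; apply: big_ind => // i _; apply: big_ind => // j _.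
  case h: ((i \in I) && (j \notin I)); last by rewrite sX ?h // scale0r.
  have /andP [iI jI] := h; split=> [a b|x]; last exact: inv.
  rewrite !mxE; case: eqP => [->|_]; case: eqP => [->|_]; rewrite ?mulr0 //.
  by rewrite h.
have [s sI] := initial_segment_perm I.
have Pu (t : 'S_n) : perm_mx t \in (@unitmx k n) by exact: unitmx_perm.
have n1 : (0 < #|I| < n)%N.
  rewrite card_gt0 I0 /=; have := proper_card (A := I) (B := setT).
  by rewrite properEneq IT subsetT cardsT card_ord => ->.
move=> g; have := Wsp_cusp HW n1 (Wsp_transl HW wW (Pu s^-1%g)) _ (g *m perm_mx s).
rewrite -mulmxA -perm_mxM mulgV perm_mx1 mulmx1; apply=> X upX x.
have E : (1%:M + X) *m perm_mx s^-1 = perm_mx s^-1 *m (1%:M + perm_mx s *m X *m perm_mx s^-1).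
  rewrite mulmxDl mulmxDr mul1mx mulmx1; congr (_ + _).
  by rewrite !mulmxA -perm_mxM mulVg perm_mx1 mul1mx.
rewrite -mulmxA E mulmxA suppP // => i j h.
by rewrite -col_permE -row_permE !mxE upX // [(#|_| <= _)%N]leqNgt !sI.
Qed.

End CuspidalSubset.

Section Kirillov.
Variables (k : finFieldType) (R : closedFieldType) (n : nat) (psi : k -> R).
Hypothesis psiD : forall a b, psi (a + b) = psi a * psi b.
Hypothesis psi0 : psi 0 = 1.
Implicit Types (W : 'M[k]_n.+1 -> R) (t : 'cV[k]_n.+1) (y : 'rV[k]_n.+1).

Definition supp_lt (c : nat) t := forall i : 'I_n.+1, (c <= i)%N -> t i 0 = 0.

Definition mirabolic_null W := forall x, mirabolic x -> W x = 0.

Notation colu t c := (1%:M + t *m delta_mx (0 : 'I_1) c).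

Definition prev_entry (c : 'I_n.+1) t := \sum_(i : 'I_n.+1 | val c == (val i).+1) t i 0.

(** Right equivariance under the unipotent columns from [c] on. It is void for [c = n.+1] and full
    equivariance for [c = 1]; the Fourier argument descends from the first to the second. *)
Definition psi_from (c : nat) W := forall (c' : 'I_n.+1) t x, (c <= c')%N -> supp_lt c' t ->
  W (x *m colu t c') = psi (prev_entry c' t) * W x.

Lemma prev_entryE (c c' : 'I_n.+1) t : c = c'.+1 :> nat -> prev_entry c t = t c' 0.
Proof.
move=> e; rewrite /prev_entry (bigD1 c') /=; last by rewrite e.
rewrite big1 ?addr0 // => i /andP [/eqP e' /eqP []].
by apply: val_inj => /=; rewrite /= e in e'; case: e'.
Qed.

Lemma prev_entry_lt (c : 'I_n.+1) (b : nat) t : (b < c)%N -> supp_lt b t -> prev_entry c t = 0.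
Proof.
move=> bc st; rewrite /prev_entry big1 // => i /eqP e; apply: st.
by rewrite -ltnS -[(val i).+1]e.
Qed.

Lemma colu_mul t t' (c c' : 'I_n.+1) :
  colu t c *m colu t' c' = 1%:M + t *m delta_mx (0 : 'I_1) c + t' *m delta_mx (0 : 'I_1) c'
   + t' c 0 *: (t *m delta_mx (0 : 'I_1) c').
Proof.
rewrite mulmxDl mul1mx mulmxDr mulmx1 -!addrA; congr (_ + _).
rewrite addrCA; congr (_ + _); congr (_ + _).
rewrite mulmxA -[t *m _ *m t']mulmxA delta_row_mul (mx11_scalar (row c t')) mxE.
by rewrite mul_mx_scalar scalemxAl.
Qed.

Lemma colu_mul_same t t' (c : 'I_n.+1) : supp_lt c t' -> colu t c *m colu t' c = colu (t + t') c.
Proof. by move=> st; rewrite colu_mul st // scale0r addr0 -addrA -mulmxDl. Qed.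

Lemma colu_commute t t' (c c' : 'I_n.+1) : (c < c')%N -> supp_lt c t -> supp_lt c' t' ->
  colu t' c' *m colu t c = colu t c *m colu (t' - t' c 0 *: t) c'.
Proof.
move=> cc st st'; rewrite !colu_mul st ?(ltnW cc) // scale0r addr0.
rewrite !mxE [t c 0]st // mulr0 subr0 mulmxBl -scalemxAl.
by rewrite -[RHS]addrA subrK addrAC.
Qed.

(** A unitriangular matrix is a product of column unipotents, split off from its rightmost
    non-trivial column. Column 0 is always trivial, whence the level 1. *)
Lemma psi_from_right_equiv W : psi_from 1 W -> right_equiv psi W.
Proof.
move=> lW; suff H d u : unitri u -> (forall i j : 'I_n.+1, (d < j)%N -> u i j = (i == j)%:R) ->
    forall x, W (x *m u) = psiU psi u * W x.
  move=> u x uu; apply: (H n.+1) => // i j; have := ltn_ord j; lia.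
elim: d u => [|d IH] u uu ud x.
  have -> : u = 1%:M.
    apply/matrixP=> i j; rewrite mxE; have [j0|/ud//] := leqP j 0.
    case: (eqVneq i j) => [/(uu i j).2 //|ij]; apply: (uu i j).1.
    by rewrite -val_eqE /= in ij; lia.
  by rewrite mulmx1 psiU1 // mul1r.
have [dn|nd] := ltnP d.+1 n.+1; last first.
  apply: IH => // i j dj; apply: ud; have := ltn_ord j; lia.
pose c := Ordinal dn.
pose t : 'cV[k]_n.+1 := \col_i (u i c - (i == c)%:R).
pose u' : 'M[k]_n.+1 := \matrix_(i, j) if j == c then (i == j)%:R else u i j.
have st : supp_lt c t.
  move=> i; rewrite leq_eqVlt mxE => /orP [/eqP/val_inj <-|ci].
    by rewrite (uu c c).2 // eqxx subrr.
  by rewrite (uu i c).1 // -val_eqE /= gtn_eqF // subrr.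
have uu' : unitri u'.
  move=> i j; rewrite mxE; case: (eqVneq j c) => [_|jc]; last exact: uu.
  split=> [ji|->]; last by rewrite eqxx.
  by rewrite -val_eqE /= gtn_eqF.
have uE : u = colu t c *m u'.
  rewrite mulmxDl mul1mx -mulmxA delta_row_mul; apply/matrixP=> i j.
  rewrite mxE mul_cr !mxE; have [->|jc] := eqVneq j c; first by rewrite mulr1 addrC subrK.
  have [lt|] := ltnP j c; first by rewrite (uu c j).1 // mulr0 addr0.
  rewrite leq_eqVlt eq_sym val_eqE (negPf jc) /= => cj.
  by rewrite [u c j]ud // [c == j]eq_sym (negPf jc) mulr0 addr0.
have ut := unitri_col st.
rewrite uE mulmxA (IH u') //.
  rewrite lW // mulrA (psiU_mul psiD) //; congr (_ * _); rewrite mulrC; congr (_ * _).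
  by rewrite psiUE superdiagD superdiag1 add0r superdiag_col.
move=> i j dj; rewrite mxE; case: eqVneq => // jc; apply: ud.
by rewrite -val_eqE /= in jc; lia.
Qed.

End Kirillov.

Section KirillovStep.
Variables (k : finFieldType) (R : closedFieldType) (n : nat) (psi : k -> R).
Variable Wsp : ('M[k]_n.+1 -> R) -> Prop.
Hypothesis psiD : forall a b, psi (a + b) = psi a * psi b.
Hypothesis psi0 : psi 0 = 1.
Hypothesis psi_nt : exists a, psi a != 1.
Hypothesis qR : (#|k|%:R : R) != 0.
Hypothesis HW : cusp_whittaker psi Wsp.
Implicit Types (W : 'M[k]_n.+1 -> R) (t : 'cV[k]_n.+1) (y : 'rV[k]_n.+1).
Notation colu t c := (1%:M + t *m delta_mx (0 : 'I_1) c).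
Notation pair y t := ((y *m t) 0 0).

Lemma psi_orthogonality t :
  \sum_(y : 'rV[k]_n.+1) psi (- pair y t) = if t == 0 then (#|{: 'rV[k]_n.+1}|)%:R else 0.
Proof.
case: eqVneq => [->|tnz].
  rewrite -sum1_card natr_sum; apply: eq_bigr => y _.
  by rewrite mulmx0 mxE oppr0 psi0.
have [i ti] : exists i, t i 0 != 0.
  by have /matrix0Pn [i [j]] := tnz; rewrite (ord1 j); exists i.
have [a pa] := psi_nt.
pose y1 : 'rV[k]_n.+1 := (- (a / t i 0)) *: delta_mx (0 : 'I_1) i.
set S := \sum_y _; have E : S = psi a * S.
  rewrite {1}/S (reindex_inj (addrI y1)) mulr_sumr; apply: eq_bigr => y _.
  rewrite mulmxDl mxE -scalemxAl delta_row_mul !mxE mulNr divfK // opprD opprK.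
  by rewrite psiD.
apply/eqP; have := subrr S; rewrite {1}E -[X in _ - X]mul1r -mulrBl => /eqP.
by rewrite mulf_eq0 subr_eq0 (negPf pa).
Qed.

Definition suppb (c : nat) t := [forall i : 'I_n.+1, (c <= i)%N ==> (t i 0 == 0)].

Lemma suppbP c t : reflect (supp_lt c t) (suppb c t).
Proof.
apply: (iffP forallP) => H i; first by move=> ci; have := H i; rewrite ci => /eqP.
by apply/implyP => /H ->.
Qed.

Lemma supp_ltD c t t' : supp_lt c t -> supp_lt c t' -> supp_lt c (t + t').
Proof. by move=> s s' i ci; rewrite mxE s ?s' ?addr0. Qed.

Lemma supp_ltZ c a t : supp_lt c t -> supp_lt c (a *: t).
Proof. by move=> s i ci; rewrite mxE s ?mulr0. Qed.

Lemma supp_ltB c t t' : supp_lt c t -> supp_lt c t' -> supp_lt c (t - t').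
Proof. by move=> s s'; rewrite -scaleN1r; apply: supp_ltD => //; apply: supp_ltZ. Qed.

Lemma supp_ltW b c t : (b <= c)%N -> supp_lt b t -> supp_lt c t.
Proof. by move=> bc s i ci; apply: s; apply: leq_trans ci. Qed.

Lemma supp_lt_delta b (i : 'I_n.+1) : (i < b)%N -> supp_lt b (delta_mx i 0 : 'cV[k]_n.+1).
Proof. by move=> ib j bj; rewrite mxE -val_eqE /= gtn_eqF //; apply: leq_trans bj. Qed.

Lemma colu_unit t (c : 'I_n.+1) : supp_lt c t -> colu t c \in unitmx.
Proof. by move=> st; apply/unitri_unitmx/unitri_col. Qed.

Lemma mirabolic_colu t (c : 'I_n.+1) : supp_lt c t -> mirabolic (colu t c).
Proof.
move=> st; apply/rowP=> j; rewrite !mxE big_ord1 st ?mul0r ?addr0; last by rewrite -ltnS.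
by rewrite eq_sym.
Qed.

(** Only the first [c] entries of [y] matter here, but [y] runs over full rows to keep one type for
    all columns: in the inversion each frequency is then repeated a power of q times, which is
    harmless in [R]. *)
Definition fourier (c : 'I_n.+1) y W x :=
  \sum_(t | suppb c t) psi (- pair y t) * W (x *m colu t c).

Section Fourier.
Variables (c : 'I_n.+1) (W : 'M[k]_n.+1 -> R).
Hypothesis wW : Wsp W.
Hypothesis pW : mirabolic_null W.
Hypothesis lW : psi_from psi c.+1 W.

Lemma fourier_Wsp y : Wsp (fourier c y W).
Proof.
apply: (Wsp_sum HW (fun t => psi (- pair y t))) => t /suppbP st.
by apply: (Wsp_transl HW wW); apply: colu_unit.
Qed.

Lemma fourier_null y : mirabolic_null (fourier c y W).
Proof.
move=> x Px; rewrite /fourier big1 // => t /suppbP st.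
by rewrite pW ?mulr0 //; apply: mirabolic_mulr => //; apply: mirabolic_colu.
Qed.

Lemma fourier_col y t x : supp_lt c t ->
  fourier c y W (x *m colu t c) = psi (pair y t) * fourier c y W x.
Proof.
move=> st; rewrite /fourier mulr_sumr [RHS](reindex_inj (addrI t)) /=.
apply: eq_big => t'.
  apply/suppbP/suppbP => st'; last by rewrite -[t'](addKr t) addrC; apply: supp_ltB.
  exact: supp_ltD.
move/suppbP=> st'; rewrite -mulmxA colu_mul_same // mulrA -psiD.
have -> : pair y (t + t') = pair y t + pair y t' by rewrite mulmxDr mxE.
by rewrite opprD addrA subrr add0r.
Qed.

Lemma fourier_level y : psi_from psi c.+1 (fourier c y W).
Proof.
move=> c' t' x cc st'; rewrite /fourier mulr_sumr; apply: eq_bigr => t /suppbP st.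
rewrite -mulmxA colu_commute // mulmxA lW //; last first.
  by apply: supp_ltB => //; apply: supp_ltZ; apply: supp_ltW st; apply: ltnW.
rewrite mulrCA; congr (psi _ * _).
rewrite /prev_entry; apply: eq_bigr => i /eqP e; rewrite !mxE [t i 0]st ?mulr0 ?subr0 //.
by rewrite -ltnS -[(val i).+1]e.
Qed.

Lemma fourier_inversion x : (forall y, fourier c y W x = 0) -> W x = 0.
Proof.
move=> H; have : \sum_y fourier c y W x = 0 by rewrite big1.
rewrite /fourier exchange_big /= (bigD1 0) /=; last by apply/suppbP => i _; rewrite mxE.
rewrite -mulr_suml psi_orthogonality eqxx mul0mx addr0 mulmx1 [X in _ + X]big1; last first.
  by move=> t /andP [_ /negPf t0]; rewrite -mulr_suml psi_orthogonality t0 mul0r.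
rewrite addr0 => /eqP; rewrite mulf_eq0 card_mx natrX expf_eq0 (negPf qR) andbF /=.
by move/eqP.
Qed.

Lemma fourier_zero_freq y : (0 < c)%N -> (forall i : 'I_n.+1, (i < c)%N -> y 0 i = 0) ->
  forall x, fourier c y W x = 0.
Proof.
move=> c0 y0; apply: (cusp_subset HW (I := [set i : 'I_n.+1 | (i < c)%N]) (fourier_Wsp y)).
- by apply/set0Pn; exists ord0; rewrite inE.
- by apply/eqP => /setP/(_ c); rewrite !inE ltnn.
move=> i j a x; rewrite !inE -leqNgt => ic cj.
have sd b : (i < b)%N -> supp_lt b (a *: (delta_mx i 0 : 'cV[k]_n.+1)).
  by move=> ib; apply/supp_ltZ/supp_lt_delta.
rewrite -(mul_delta_mx (0 : 'I_1)) scalemxAl.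
move: cj; rewrite leq_eqVlt => /orP [/eqP/val_inj <-|cj].
  rewrite fourier_col; last exact: sd.
  rewrite [X in psi X](_ : _ = 0) ?psi0 ?mul1r //.
  by rewrite -scalemxAr delta_col_mul !mxE y0 // mulr0.
(* In a column beyond [c], the rows above [c] lie strictly above the superdiagonal, where psi is
   trivial. *)
rewrite fourier_level //; last by apply: sd; apply: ltn_trans cj.
by rewrite (prev_entry_lt (b := i.+1)) ?psi0 ?mul1r //; [apply: leq_trans cj | apply: sd].
Qed.

End Fourier.

(* Fourier expansion along column [c]: the zero frequency is invariant under a unipotent radical,
   so it vanishes, and any other frequency [y] is conjugate by [g] in the mirabolic subgroup to
   the one that defines [psi_from]. *)
Lemma kirillov_step (c : 'I_n.+1) W : (0 < c)%N -> Wsp W -> mirabolic_null W ->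
  psi_from psi c.+1 W -> (exists x, W x != 0) ->
  exists W', [/\ Wsp W', mirabolic_null W', psi_from psi c W' & exists x, W' x != 0].
Proof.
move=> c0 wW pW lW [x0 Wx0].
have [y Vx0] : exists y, fourier c y W x0 != 0.
  apply/existsP; apply: contraR Wx0; rewrite negb_exists => /forallP h.
  by apply/eqP/(fourier_inversion (c := c)) => y; have := h y; rewrite negbK => /eqP.
set V := fourier c y W in Vx0.
have wV : Wsp V by apply: fourier_Wsp.
have [i [ic yi]] : exists i : 'I_n.+1, (i < c)%N /\ y 0 i != 0.
  suff : [exists i : 'I_n.+1, (i < c)%N && (y 0 i != 0)].
    by case/existsP => i /andP [? ?]; exists i.
  apply: contraR Vx0; rewrite negb_exists => /forallP h.
  apply/eqP/fourier_zero_freq => // i ic; have := h i.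
  by rewrite ic /= negbK => /eqP.
(* [e] is the row whose entry in column [c] is read by the condition of level [c]; the frequency has
   to be moved to the basis row [e]. *)
have c1n : (c.-1 < n.+1)%N by have := ltn_ord c; lia.
pose e := Ordinal c1n.
have ec : (e < c)%N by rewrite /=; lia.
pose y' : 'rV[k]_n.+1 := \row_j if (j < c)%N then y 0 j else 0.
have y'E t : supp_lt c t -> pair y' t = pair y t.
  move=> st; rewrite !mxE; apply: eq_bigr => j _; rewrite !mxE.
  by case: ltnP => // cj; rewrite st // !mulr0.
(* For [g = 1 + u r] below, the three conditions say that [g] fixes the basis rows from [c] on,
   sends the basis row [e] to [y'], and is invertible, with determinant [y' u]. *)
have [u [su ue uy]] : exists u : 'cV[k]_n.+1, [/\ supp_lt c u, u e 0 = 1 & pair y' u != 0].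
  have [ye|ye] := eqVneq (y 0 e) 0.
    exists (delta_mx e 0 + delta_mx i 0); split.
    - by apply: supp_ltD; apply: supp_lt_delta.
    - rewrite !mxE !eqxx andbT; case: eqVneq => [ei|]; last by rewrite addr0.
      by rewrite -ei ye eqxx in yi.
    - by rewrite mulmxDr mxE !delta_col_mul !mxE ec ic ye add0r.
  exists (delta_mx e 0); split; first exact: supp_lt_delta.
    by rewrite mxE !eqxx.
  by rewrite delta_col_mul !mxE ec.
pose r := y' - delta_mx (0 : 'I_1) e.
pose g := 1%:M + u *m r.
have ru : 1 + pair r u = pair y' u.
  have -> : pair r u = pair y' u - u e 0.
    by rewrite /r mulmxBl delta_row_mul [LHS]mxE; congr (_ + _); rewrite !mxE.
  by rewrite ue addrC subrK.
have gu : g \in unitmx by apply: rank1_unit; rewrite ru.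
have rowg (j : 'I_n.+1) : (c <= j)%N -> delta_mx (0 : 'I_1) j *m g = delta_mx (0 : 'I_1) j.
  move=> cj; rewrite mulmxDr mulmx1 mulmxA delta_row_mul.
  have -> : row j u = 0 by apply/matrixP=> a b; rewrite !mxE !ord1 su.
  by rewrite mul0mx addr0.
have rowe : delta_mx (0 : 'I_1) e *m g = y'.
  rewrite mulmxDr mulmx1 mulmxA delta_row_mul.
  have -> : row e u = 1%:M by apply/matrixP=> a b; rewrite !mxE !ord1 ue eqxx.
  by rewrite mul1mx addrC subrK.
(* This is the inverse of [g] applied to [t], by the Sherman-Morrison formula. *)
pose s t := t - (pair r t / pair y' u) *: u.
have gs t : g *m s t = t.
  have rs : pair r (s t) = pair r t - pair r t / pair y' u * pair r u.
    by rewrite /s mulmxBr -scalemxAr; move: (r *m t) (r *m u) (pair y' u) => X Y z; rewrite !mxE.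
  have sE a : s t a 0 = t a 0 - pair r t / pair y' u * u a 0.
    by rewrite /s; move: (_ / _) => z; rewrite !mxE.
  apply/matrixP=> a b; rewrite (ord1 b).
  have -> : (g *m s t) a 0 = s t a 0 + u a 0 * pair r (s t).
    rewrite mulmxDl mul1mx -mulmxA; move: (r *m s t) => X.
    by rewrite [LHS]mxE [(u *m X) _ _]mxE big_ord1.
  rewrite rs sE; rewrite -ru in uy *; move: uy.
  by move: (pair r t) (pair r u) => X Y nz; field.
have ss b t : (c <= b)%N -> supp_lt b t -> supp_lt b (s t).
  by move=> cb st; apply: supp_ltB => //; apply: supp_ltZ; apply: supp_ltW su.
have colg (c' : 'I_n.+1) t : (c <= c')%N -> colu t c' *m g = g *m colu (s t) c'.
  move=> cc; rewrite mulmxDl mul1mx -mulmxA rowg // mulmxDr mulmx1 mulmxA gs //.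
exists (fun x => V (x *m g)); split.
- exact: (Wsp_transl HW wV gu).
- move=> x Px; apply: fourier_null => //; apply: mirabolic_mulr => //.
  by rewrite /mirabolic -delta_row_mul rowg // -ltnS.
- move=> c' t x cc st; rewrite -mulmxA colg // mulmxA.
  have ust := ss _ _ cc st.
  move: cc; rewrite leq_eqVlt => /orP [/eqP/val_inj E|cc].
    rewrite -E in st ust *; rewrite /V fourier_col //; congr (psi _ * _).
    rewrite -y'E // -rowe -mulmxA gs delta_row_mul mxE.
    by rewrite (prev_entryE (c' := e)) //=; lia.
  rewrite /V fourier_level //; congr (psi _ * _).
  apply: eq_bigr => i' /eqP e'; rewrite !mxE [u i' 0]su ?mulr0 ?subr0 //.
  by rewrite -ltnS -[(val i').+1]e'.
by exists (x0 *m invmx g); rewrite mulmxKV.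
Qed.

(** A non-zero [W] would descend to a non-zero function of level 1 that still vanishes on the
    mirabolic subgroup. By multiplicity one it is a multiple of [B], with factor its value at the
    identity, which is mirabolic. *)
Lemma kirillov_injective W B : isBessel psi Wsp B -> Wsp W -> mirabolic_null W ->
  forall x, W x = 0.
Proof.
move=> [wB B1 rB] wW pW x; apply/eqP/negPn/negP => Wx.
suff H d : (d <= n)%N -> exists W', [/\ Wsp W', mirabolic_null W',
    psi_from psi (n.+1 - d) W' & exists x, W' x != 0].
  have [W' [wW' pW' lW' [x' /eqP[]]]] := H n (leqnn n).
  rewrite subSnn in lW'.
  rewrite (whittaker_multiplicity_one psiD psi0 psi_nt qR HW wW' wB) //.
    by rewrite pW' ?mul0r // /mirabolic row1.
  exact: psi_from_right_equiv.
elim: d => [|d IH] dn.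
  exists W; split=> //; last by exists x.
  by move=> c t y; rewrite subn0 leqNgt ltn_ord.
have [|W' [wW' pW' lW' nz]] := IH; first exact: ltnW.
have lt : (n.+1 - d.+1 < n.+1)%N by lia.
have e : (n.+1 - d.+1).+1 = (n.+1 - d)%N by lia.
by apply: (@kirillov_step (Ordinal lt) W') => //=; rewrite ?e //; lia.
Qed.

End KirillovStep.

(** * Invariants of the opposite Borel subgroup *)

Lemma increasing_perm_id n (s : 'S_n) :
  (forall i j : 'I_n, j = i.+1 :> nat -> (s i < s j)%N) -> forall i, s i = i.
Proof.
move=> inc; have H d : forall i j : 'I_n, j = (i + d)%N :> nat -> (s i + d <= s j)%N.
  elim: d => [|d IH] i j e; first by rewrite !addn0 in e *; rewrite (val_inj e : j = i).
  have lt : (i + d < n)%N by have := ltn_ord j; lia.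
  have := IH i (Ordinal lt) erefl; have := inc (Ordinal lt) j _; rewrite /= => /(_ ltac:(lia)).
  lia.
move=> i; apply: val_inj => /=.
have n0 : (0 < n)%N by have := ltn_ord i; lia.
have n1 : (n.-1 < n)%N by lia.
have := H i (Ordinal n0) i erefl; have := H (n.-1 - i)%N i (Ordinal n1).
rewrite /= => /(_ ltac:(have := ltn_ord i; lia)).
have := ltn_ord (s (Ordinal n1)); have := ltn_ord i; lia.
Qed.

Section LowerBorel.
Variables (k : finFieldType) (n : nat).
Implicit Types (b : 'M[k]_n.+1).

Lemma lowerBP b : reflect [/\ b \in unitmx, forall i j : 'I_n.+1, (i < j)%N -> b i j = 0 & mirabolic b]
  (lowerB b).
Proof.
apply: (iffP and3P) => [] [bu low last]; split=> //.
- by move=> i j ij; have /forallP/(_ i)/forallP/(_ j) := low; rewrite ij => /eqP.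
- apply/rowP=> j; rewrite !mxE eqxx /=.
  have /forallP/(_ ord_max)/forallP/(_ j) := last.
  by rewrite /= eqxx => /eqP ->; rewrite eq_sym.
- by apply/forallP=> i; apply/forallP=> j; apply/implyP=> ij; rewrite low.
apply/forallP=> i; apply/forallP=> j; apply/implyP=> /eqP e.
have -> : i = ord_max by apply: val_inj.
by have /rowP/(_ j) := last; rewrite !mxE eqxx /= eq_sym => ->.
Qed.

Lemma lowerB_diag b i : lowerB b -> b i i != 0.
Proof.
case/lowerBP => bu low _; have tr : is_trig_mx b by apply/is_trig_mxP.
by move: bu; rewrite unitmxE det_trig // unitfE => /prodf_neq0/(_ i isT).
Qed.

Lemma lowerB_mull b0 b : lowerB b0 -> lowerB (b0 *m b) = lowerB b.
Proof.
move=> b0L; have /lowerBP [b0u b0l b0m] := b0L.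
apply/lowerBP/lowerBP => -[bu bl bm].
  split.
  - by move: bu; rewrite unitmx_mul b0u.
  - suff H d (i j : 'I_n.+1) : (i <= d)%N -> (i < j)%N -> b i j = 0 by move=> i j; apply: (H i).
    elim: d i j => [|d IH] i j id ij.
      have := bl i j ij; rewrite mxE (bigD1 i) //= big1 ?addr0 => [|l li]; last first.
        by rewrite b0l ?mul0r //; rewrite -val_eqE /= in li; lia.
      by move/eqP; rewrite mulf_eq0 (negPf (lowerB_diag _ b0L)) => /eqP.
    have := bl i j ij; rewrite mxE (bigD1 i) //= big1 ?addr0 => [|l li].
      by move/eqP; rewrite mulf_eq0 (negPf (lowerB_diag _ b0L)) => /eqP.
    have [il|li'] := ltnP i l; first by rewrite b0l ?mul0r.
    by rewrite -val_eqE /= in li; rewrite IH ?mulr0 //; lia.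
  - by move: bm; rewrite /mirabolic row_mul b0m delta_row_mul.
split; first by rewrite unitmx_mul b0u.
  move=> i j ij; rewrite mxE big1 // => l _.
  have [il|li] := ltnP i l; first by rewrite b0l ?mul0r.
  by rewrite bl ?mulr0 //; lia.
exact: mirabolic_mulr.
Qed.

Lemma lowerB_elem (a : k) (i j : 'I_n.+1) : (j < i)%N -> (i < n)%N -> lowerB (1%:M + a *: delta_mx i j).
Proof.
move=> ji iN; have nz : (i == j) = false by rewrite -val_eqE /= gtn_eqF.
have low (c d : 'I_n.+1) : (c < d)%N -> (1%:M + a *: delta_mx i j) c d = 0.
  move=> cd; rewrite !mxE [c == d](_ : _ = false) ?add0r; last by rewrite -val_eqE /= ltn_eqF.
  by case: (eqVneq c i) => [e1|]; case: (eqVneq d j) => [e2|]; rewrite ?mulr0 //; subst; lia.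
apply/lowerBP; split.
- rewrite unitmxE det_trig; last first.
    by apply/is_trig_mxP.
  rewrite big1 ?unitr1 // => c _; rewrite !mxE eqxx.
  by case: eqP => [->|_]; rewrite ?nz /= ?mulr0 ?addr0.
- exact: low.
apply/rowP=> d; rewrite !mxE -!val_eqE /= eq_sym.
by rewrite [X in (X && _)]gtn_eqF //= mulr0 addr0.
Qed.

End LowerBorel.

Section BorelInvariants.
Variables (k : finFieldType) (R : closedFieldType) (n : nat) (psi : k -> R).
Variable Wsp : ('M[k]_n.+1 -> R) -> Prop.
Hypothesis psiD : forall a b, psi (a + b) = psi a * psi b.
Hypothesis psi0 : psi 0 = 1.
Hypothesis psi_nt : exists a, psi a != 1.
Hypothesis HW : cusp_whittaker psi Wsp.
Variable B : 'M[k]_n.+1 -> R.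
Hypothesis HB : isBessel psi Wsp B.
Implicit Types (W : 'M[k]_n.+1 -> R).

Definition bop_inv W := forall b x, lowerB b -> W (x *m b) = W x.

(** As for [bruhat], but with the rightmost non-zero entry of the lowest row as pivot: the right
    factor is then lower unitriangular. *)
Lemma pivot_unitri_lowerB (y : 'M[k]_n.+1) :
  row ord_max y = delta_mx 0 ord_max -> col ord_max y = delta_mx ord_max 0 ->
  exists l r, [/\ unitri l, lowerB r & monomial (l *m y *m r)].
Proof.
move=> ry cy.
have [|||||||l [r [Ll Rr ml mr mon]]] :=
  @pivot_mirabolic k n (@unitri k n.+1) (fun r => unitri r^T) y.
- exact: unitri1.
- by rewrite trmx1; apply: unitri1.
- exact: unitri_mul.
- by move=> A A' u u'; rewrite trmx_mul; apply: unitri_mul.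
- move=> N' /lowest_row [i [[j0 Pj0] low]].
  have [j Pj maxj] := @arg_maxnP _ j0 (fun j => N' i j != 0) (fun j : 'I_n.+1 => val j) Pj0.
  exists i, j; split=> //; first exact: pivL_unitri.
  move=> a b; rewrite mxE pivRE; split=> [ba|<-].
    have -> : (b == a) = false by rewrite -val_eqE /= ltn_eqF.
    case: (eqVneq b j) => [e|]; last by rewrite mul0r subrr.
    have -> : N' i a = 0.
      by apply/eqP/negPn/negP => /maxj; rewrite /geq /= leqNgt -e ba.
    by rewrite mulr0 -val_eqE /= -e gtn_eqF // subr0 mulr0 subrr.
  rewrite eqxx; case: (eqVneq a j) => [->|]; last by rewrite mul0r subr0.
  by rewrite mulVf // subrr mulr0 subr0.
- exact: ry.
- exact: cy.
exists l, r; split=> //; apply/lowerBP; split=> //.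
  by rewrite -unitmx_tr; apply: unitri_unitmx.
by move=> i j ij; have := (Rr j i).1 ij; rewrite mxE.
Qed.

(** At a descent of the permutation, a simple root element on the left becomes a lower triangular
    one on the right, so psi and invariance contradict each other unless [W M] is zero. Without
    descent [M] is diagonal, and [W M] is [W] at the identity. *)
Lemma bop_inv_monomial W (M : 'M[k]_n.+1) : Wsp W -> bop_inv W -> W 1%:M = 0 ->
  monomial M -> M \in unitmx -> M ord_max ord_max != 0 -> mirabolic M -> W M = 0.
Proof.
move=> wW iW W1 mon Mu Mnn mirM.
have [s Ms] := monomial_perm mon Mu.
have sN : s ord_max = ord_max by apply/esym/eqP; rewrite -Ms.
have [/existsP [i /existsP [j /andP [/eqP ji sji]]]|] :=
  boolP [exists i : 'I_n.+1, exists j : 'I_n.+1, (val j == i.+1) && (s j < s i)%N].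
  have [t pt] := psi_nt; apply/eqP/negPn/negP => nz.
  (* On the right the root element alters row [s i], which must not be the last one if it is to stay
     in the group of [lowerB]. *)
  have si : (s i < n)%N.
    have : s i != ord_max.
      by rewrite -sN (inj_eq perm_inj) -val_eqE /=; have := ltn_ord j; rewrite ji; lia.
    by rewrite -val_eqE /=; have := ltn_ord (s i); lia.
  have ut : unitri (1%:M + t *: delta_mx i j) by apply: unitri_elem; rewrite ji.
  have := Wsp_psi HW M wW ut; rewrite (elem_monomial Ms) iW ?lowerB_elem //.
  rewrite psiUE superdiagD superdiag1 add0r superdiag_delta /= ji eqxx => /esym/eqP.
  by rewrite -subr_eq0 -[X in _ - X]mul1r -mulrBl mulf_eq0 (negPf nz) orbF subr_eq0 (negPf pt).
rewrite negb_exists => /forallP h.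
have sid : forall i, s i = i.
  apply: increasing_perm_id => i j ji; have := h i; rewrite negb_exists => /forallP/(_ j).
  rewrite negb_and => /orP [/eqP //|].
  rewrite -leqNgt leq_eqVlt => /orP [/eqP/val_inj/perm_inj e|//].
  by rewrite e in ji; lia.
rewrite -[M]mul1mx iW //; apply/lowerBP; split=> // i j ij.
by apply/eqP; rewrite -[_ == _]negbK Ms sid eq_sym -val_eqE /= ltn_eqF.
Qed.

(** Let [r] be the lowest row where [b] differs from the identity. As row [r + 1] of [b] is a basis
    row, [b] moves across a unipotent in column [r + 1], changing its vector [x] to [b x]. If [B b]
    is non-zero the characters agree, and this forces row [r] to be a basis row too. *)
Lemma bessel_lowerB b : lowerB b -> b != 1%:M -> B b = 0.
Proof.
move=> bL b1; have /lowerBP [bu low mb] := bL.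
have [wB B1 rB] := HB.
have [i0 Pi0] : exists i, row i b != delta_mx 0 i.
  apply/existsP; apply: contraR b1; rewrite negb_exists => /forallP h.
  by apply/eqP/row_matrixP => i; rewrite row1; have := h i; rewrite negbK => /eqP.
have [r Pr maxr] := @arg_maxnP _ i0 (fun i => row i b != delta_mx 0 i) (fun i : 'I_n.+1 => val i) Pi0.
have above (i : 'I_n.+1) : (r < i)%N -> row i b = delta_mx 0 i.
  by move=> ri; apply/eqP/negPn/negP => /maxr; rewrite /geq /= leqNgt ri.
have rN : (r < n)%N.
  rewrite ltn_neqAle -ltnS ltn_ord andbT; apply/eqP => e.
  by move: Pr; rewrite (_ : r = ord_max) ?mb ?eqxx //; apply: val_inj.
pose r1 : 'I_n.+1 := Ordinal (rN : (r.+1 < n.+1)%N).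
apply/eqP/negPn/negP => nz; case/eqP: Pr; apply/rowP => c; rewrite !mxE eqxx /=.
have [rc|cr] := ltnP r c; first by rewrite low // -val_eqE /= gtn_eqF.
apply: (psi_scale_inj psiD psi0 psi_nt) => a.
pose x : 'cV[k]_n.+1 := a *: delta_mx c 0.
have sx : supp_lt r1 x by apply/supp_ltZ/supp_lt_delta.
have sbx : supp_lt r1 (b *m x).
  move=> i ri; rewrite -scalemxAr delta_col_mul !mxE.
  have /rowP/(_ c) := above i ri; rewrite !mxE eqxx /= => ->.
  by rewrite -val_eqE /= ltn_eqF ?mulr0 //; apply: leq_ltn_trans ri.
have E : b *m (1%:M + x *m delta_mx (0 : 'I_1) r1) = (1%:M + (b *m x) *m delta_mx (0 : 'I_1) r1) *m b.
  by rewrite mulmxDl mulmxDr mul1mx mulmx1 -[in RHS]mulmxA delta_row_mul above //= mulmxA.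
have := rB _ b (unitri_col sx); rewrite E (Wsp_psi HW _ wB (unitri_col sbx)).
move/(mulIf nz); rewrite !psiUE !superdiagD !superdiag1 !add0r !superdiag_col.
have pe (t : 'cV[k]_n.+1) : \sum_(i : 'I_n.+1 | val r1 == (val i).+1) t i 0 = t r 0.
  exact: (prev_entryE (c := r1) (c' := r)).
rewrite !pe -scalemxAr delta_col_mul !mxE eqxx andbT => ->.
by rewrite eq_sym.
Qed.

Definition bop_vector x := \sum_(b : 'M[k]_n.+1 | lowerB b) B (x *m b).

(** Only [b = 1] contributes. This proves non-vanishing without dividing by the order of the group,
    whose factors q - 1 may be zero in [R]. *)
Lemma bop_vector1 : bop_vector 1%:M = 1.
Proof.
have l1 : lowerB (1%:M : 'M[k]_n.+1).
  apply/lowerBP; split; rewrite ?unitmx1 // /mirabolic ?row1 // => i j ij.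
  by rewrite mxE -val_eqE /= ltn_eqF.
rewrite /bop_vector (bigD1 1%:M) //= mul1mx; have [_ -> _] := HB.
rewrite big1 ?addr0 // => b /andP [bL b1].
by rewrite mul1mx bessel_lowerB.
Qed.

Lemma bop_vector_Wsp : Wsp bop_vector.
Proof.
have [wB _ _] := HB.
have := Wsp_sum HW (fun=> 1) (fun b (bL : lowerB b) => Wsp_transl HW wB (andP bL).1).
by congr Wsp; apply/funext => x; apply: eq_bigr => b _; rewrite mul1r.
Qed.

Lemma bop_vector_inv : bop_inv bop_vector.
Proof.
move=> b0 x b0L; have b0u : b0 \in unitmx by case/lowerBP: b0L.
rewrite /bop_vector [RHS](reindex_inj (can_inj (mulKmx b0u))) /=.
by apply: eq_big => b; [rewrite lowerB_mull | rewrite mulmxA].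
Qed.

Hypothesis qR : (#|k|%:R : R) != 0.

(** Invertible mirabolic matrices lie in double cosets of a monomial matrix under the unitriangular
    group and [lowerB], so [W] vanishes on all of them and Kirillov injectivity applies. *)
Lemma bop_inv_null W : Wsp W -> bop_inv W -> W 1%:M = 0 -> forall x, W x = 0.
Proof.
move=> wW iW W1; apply: (kirillov_injective psiD psi0 psi_nt qR HW HB wW) => x mx.
have [xu|/(Wsp_off HW wW) //] := boolP (x \in unitmx).
have [v [y [v0 ry cy xE]]] := mirabolic_split mx.
have vN : supp_lt (ord_max : 'I_n.+1) v.
  by move=> i Ni; have /eqP -> : i == ord_max by rewrite -val_eqE eqn_leq Ni andbT -ltnS ltn_ord.
have uv := unitri_col vN.
rewrite xE (Wsp_psi HW) //.
have yu : y \in unitmx by move: xu; rewrite {1}xE unitmx_mul => /andP [].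
have [l [r [ul rL mon]]] := pivot_unitri_lowerB ry cy.
have mm : mirabolic (l *m y *m r).
  have /lowerBP [_ _ rm] := rL.
  apply: mirabolic_mulr => //; apply: mirabolic_mulr => //.
  apply/rowP=> j; rewrite !mxE eqxx /=.
  have [->|ne] := eqVneq j ord_max; first by rewrite (ul _ _).2.
  by apply: (ul _ _).1; rewrite ltn_neqAle ne -ltnS ltn_ord.
have : W (l *m y *m r) = 0.
  apply: bop_inv_monomial => //.
    rewrite !unitmx_mul (unitri_unitmx ul) yu; by case/lowerBP: rL.
  by have /rowP/(_ ord_max) := mm; rewrite !mxE !eqxx => ->; rewrite oner_eq0.
rewrite iW // (Wsp_psi HW) // => /eqP; rewrite mulf_eq0 (negPf (psiU_neq0 psiD psi0 _)) /=.
by move/eqP => ->; rewrite mulr0.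
Qed.

Theorem bop_invariants W : Wsp W -> bop_inv W -> forall x, W x = W 1%:M * bop_vector x.
Proof.
move=> wW iW x; apply/eqP; rewrite -subr_eq0; apply/eqP.
have wS := Wsp_scale HW (W 1%:M) bop_vector_Wsp.
apply: (bop_inv_null (W := fun x => W x - W 1%:M * bop_vector x)).
- exact: (Wsp_sub HW wW wS).
- by move=> b y bL; rewrite iW // bop_vector_inv.
- by rewrite bop_vector1 mulr1 subrr.
Qed.

End BorelInvariants.

(** * Local fields and maximal compact subgroups *)

Section LocalField.
Variables (F : fieldType) (O : pred F) (w : F) (k : finFieldType) (red : F -> k).
Hypothesis HF : is_nonarch_local_field O w red.

Lemma O_1 : O 1. Proof. by have [[H _] _ _ _ _] := HF. Qed.

Lemma O_sub x y : O x -> O y -> O (x - y).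
Proof. by have [[_ H] _ _ _ _] := HF => ox oy; case: (H x y ox oy). Qed.

Lemma O_mul x y : O x -> O y -> O (x * y).
Proof. by have [[_ H] _ _ _ _] := HF => ox oy; case: (H x y ox oy). Qed.

Lemma O_0 : O 0. Proof. by rewrite -(subrr 1) O_sub // O_1. Qed.

Lemma O_opp x : O x -> O (- x). Proof. by move=> ox; rewrite -sub0r O_sub // O_0. Qed.

Lemma O_add x y : O x -> O y -> O (x + y).
Proof. by move=> ox oy; rewrite -[y]opprK O_sub // O_opp. Qed.

Lemma O_nat n : O n%:R.
Proof. by elim: n => [|n IH]; rewrite ?O_0 // mulrS O_add ?O_1. Qed.

Lemma O_exp x n : O x -> O (x ^+ n).
Proof. by move=> ox; elim: n => [|n IH]; rewrite ?expr0 ?O_1 // exprS O_mul. Qed.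

Lemma O_sum (I : Type) (r : seq I) (P : pred I) (G : I -> F) :
  (forall i, P i -> O (G i)) -> O (\sum_(i <- r | P i) G i).
Proof. by move=> H; apply: (big_ind (fun x => is_true (O x))) => //; [exact: O_0 | exact: O_add]. Qed.

Lemma O_prod (I : Type) (r : seq I) (P : pred I) (G : I -> F) :
  (forall i, P i -> O (G i)) -> O (\prod_(i <- r | P i) G i).
Proof. by move=> H; apply: (big_ind (fun x => is_true (O x))) => //; [exact: O_1 | exact: O_mul]. Qed.

Lemma w_neq0 : w != 0. Proof. by have [_ [_ [H _]] _ _ _] := HF. Qed.

Lemma O_w : O w. Proof. by have [_ [H _] _ _ _] := HF. Qed.

Lemma O_wz (e : int) : O (w ^ e) = (0 <= e).
Proof.
case: e => n; first by rewrite -exprnP O_exp ?O_w.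
have [_ [_ [_ nO]] _ _ _] := HF.
rewrite NegzE /=; apply/negbTE/negP => H; case/negP: nO.
have -> : w^-1 = w ^ (- (n.+1)%:Z) * w ^+ n.
  rewrite exprnP -expfzDr ?w_neq0 // (_ : - (n.+1)%:Z + n%:Z = -1); last by lia.
  by rewrite exprN1.
by rewrite O_mul // O_exp // O_w.
Qed.

Definition unitO (u : F) := [/\ u != 0, O u & O u^-1].

Lemma unitO1 : unitO 1. Proof. by split; rewrite ?invr1 ?oner_eq0 ?O_1. Qed.

Lemma unitO_mul u v : unitO u -> unitO v -> unitO (u * v).
Proof. by move=> [a b c] [d e f]; split; rewrite ?mulf_neq0 ?invfM ?O_mul. Qed.

Lemma unitO_inv u : unitO u -> unitO u^-1.
Proof. by move=> [a b c]; split; rewrite ?invr_eq0 ?invrK. Qed.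

Lemma O_mul_unit u x : unitO u -> O (x * u) = O x.
Proof.
move=> [a b c]; apply/idP/idP => H; last exact: O_mul.
by rewrite -[x](mulfK a) O_mul.
Qed.

Lemma uniformizer_decomp x : x != 0 -> exists (e : int) u, unitO u /\ x = w ^ e * u.
Proof. by have [_ _ H _ _] := HF => /H [e [u [a b c d]]]; exists e, u. Qed.

(* [val_ge d x] says that the valuation of [x] is at least [d]. *)
Definition val_ge (d : int) (x : F) : bool := O (w ^ (- d) * x).

Lemma val_geE d x : val_ge d x = O (w ^ (- d) * x). Proof. by []. Qed.

Lemma val_geE0 x : val_ge 0 x = O x. Proof. by rewrite /val_ge oppr0 expr0z mul1r. Qed.

Lemma val_ge_0 d : val_ge d 0. Proof. by rewrite /val_ge mulr0 O_0. Qed.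

Lemma val_geD d x y : val_ge d x -> val_ge d y -> val_ge d (x + y).
Proof. by rewrite /val_ge mulrDr; apply: O_add. Qed.

Lemma val_geN d x : val_ge d x -> val_ge d (- x).
Proof. by rewrite /val_ge mulrN; apply: O_opp. Qed.

Lemma val_geB d x y : val_ge d x -> val_ge d y -> val_ge d (x - y).
Proof. by move=> hx hy; apply: val_geD => //; apply: val_geN. Qed.

Lemma val_geM d e x y : val_ge d x -> val_ge e y -> val_ge (d + e) (x * y).
Proof. by rewrite /val_ge opprD expfzDr ?w_neq0 // mulrACA; apply: O_mul. Qed.

Lemma val_ge_wz d e x : val_ge d (w ^ e * x) = val_ge (d - e) x.
Proof. by rewrite /val_ge opprB mulrA -expfzDr ?w_neq0 // addrC. Qed.

Lemma val_ge_mulO d x y : val_ge d x -> O y -> val_ge d (x * y).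
Proof. by rewrite -val_geE0 => hx hy; rewrite -[d]addr0 val_geM. Qed.

Lemma val_ge_Omul d x y : O x -> val_ge d y -> val_ge d (x * y).
Proof. by move=> hx hy; rewrite mulrC val_ge_mulO. Qed.

Lemma val_ge_le d e x : d <= e -> val_ge e x -> val_ge d x.
Proof.
move=> de; rewrite /val_ge => H.
have -> : w ^ (- d) * x = w ^ (e - d) * (w ^ (- e) * x).
  by rewrite mulrA -expfzDr ?w_neq0 //; congr (w ^ _ * x); lia.
by rewrite O_mul // O_wz; lia.
Qed.

Lemma val_ge_O d x : 0 <= d -> val_ge d x -> O x.
Proof. by move=> d0 /(val_ge_le d0); rewrite val_geE0. Qed.

Lemma val_ge_unit d e u : unitO u -> val_ge d (w ^ e * u) = (d <= e).
Proof. by move=> hu; rewrite val_ge_wz /val_ge O_mul_unit // O_wz; lia. Qed.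

Lemma val_ge_sum d (I : Type) (r : seq I) (P : pred I) (G : I -> F) :
  (forall i, P i -> val_ge d (G i)) -> val_ge d (\sum_(i <- r | P i) G i).
Proof. by move=> H; apply: (big_ind (fun x => is_true (val_ge d x))) => //; [exact: val_ge_0 | exact: val_geD]. Qed.

Lemma valuation_exists x : x != 0 -> exists e : int, forall d, val_ge d x = (d <= e).
Proof. by case/uniformizer_decomp => e [u [uu ->]]; exists e => d; rewrite val_ge_unit. Qed.

Lemma in_powP (m : nat) x : in_pow O w m x <-> val_ge m%:Z x.
Proof.
split=> [[y [oy ->]]|h]; first by rewrite exprnP val_ge_wz subrr val_geE0.
exists (w ^ (- m%:Z) * x); split=> //.
by rewrite exprnP mulrA -expfzDr ?w_neq0 // subrr mul1r.
Qed.

Lemma redD x y : O x -> O y -> red (x + y) = red x + red y.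
Proof. by have [_ _ _ [_ H _ _] _] := HF => ox oy; case: (H x y ox oy). Qed.

Lemma redM x y : O x -> O y -> red (x * y) = red x * red y.
Proof. by have [_ _ _ [_ H _ _] _] := HF => ox oy; case: (H x y ox oy). Qed.

Lemma red1 : red 1 = 1. Proof. by have [_ _ _ [H _ _ _] _] := HF. Qed.

Lemma red0 : red 0 = 0.
Proof. by apply: (addrI (red 0)); rewrite -redD ?O_0 // !addr0. Qed.

Lemma redN x : O x -> red (- x) = - red x.
Proof.
by move=> ox; apply: (addrI (red x)); rewrite -redD ?O_opp // !subrr red0.
Qed.

Lemma red_surj a : exists x, O x /\ red x = a.
Proof. by have [_ _ _ [_ _ H _] _] := HF. Qed.

Lemma red_eq0 x : O x -> (red x == 0) = val_ge 1 x.
Proof.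
have [_ _ _ [_ _ _ H] _] := HF => /H h; apply/eqP/idP => [/h /in_powP //|hx].
by apply/h/in_powP.
Qed.

Lemma red_eq x y : O x -> O y -> (red x == red y) = val_ge 1 (x - y).
Proof. by move=> ox oy; rewrite -subr_eq0 -redN // -redD ?O_opp // red_eq0 // O_sub. Qed.

Lemma unit_of_red x : O x -> red x != 0 -> unitO x.
Proof.
move=> ox; rewrite red_eq0 //; have [->|xnz] := eqVneq x 0; first by rewrite val_ge_0.
have [e [u [uu xE]]] := uniformizer_decomp xnz.
have e0 : 0 <= e by have := val_ge_unit 0 e uu; rewrite -xE val_geE0 ox => <-.
rewrite xE val_ge_unit // => h; have -> : e = 0 by lia.
by rewrite expr0z mul1r.
Qed.

Lemma unit_1p x : val_ge 1 x -> unitO (1 + x).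
Proof.
move=> hx; have ox : O x by apply: val_ge_O hx.
apply: unit_of_red; first by rewrite O_add // O_1.
by rewrite redD ?O_1 // red1; move: hx; rewrite -red_eq0 // => /eqP ->; rewrite addr0 oner_eq0.
Qed.

Lemma red_sum (I : Type) (r : seq I) (P : pred I) (G : I -> F) :
  (forall i, P i -> O (G i)) -> red (\sum_(i <- r | P i) G i) = \sum_(i <- r | P i) red (G i).
Proof.
move=> H; elim: r => [|i r IH]; first by rewrite !big_nil red0.
by rewrite !big_cons; case Pi: (P i) => //; rewrite redD ?IH //; [exact: H | exact: O_sum].
Qed.

Definition Omx m n (M : 'M[F]_(m, n)) := forall i j, O (M i j).

Lemma Omx_mul m n p (A : 'M[F]_(m, n)) (B : 'M[F]_(n, p)) : Omx A -> Omx B -> Omx (A *m B).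
Proof. by move=> a b i j; rewrite mxE; apply: O_sum => l _; apply: O_mul. Qed.

Lemma Omx_add m n (A B : 'M[F]_(m, n)) : Omx A -> Omx B -> Omx (A + B).
Proof. by move=> a b i j; rewrite mxE O_add. Qed.

Lemma Omx_sub m n (A B : 'M[F]_(m, n)) : Omx A -> Omx B -> Omx (A - B).
Proof. by move=> a b i j; rewrite !mxE O_sub. Qed.

Lemma Omx_scale m n a (A : 'M[F]_(m, n)) : O a -> Omx A -> Omx (a *: A).
Proof. by move=> oa oA i j; rewrite mxE O_mul. Qed.

Lemma Omx1 n : Omx (1%:M : 'M[F]_n).
Proof. by move=> i j; rewrite mxE O_nat. Qed.

Lemma Omx_delta m n i j : Omx (delta_mx i j : 'M[F]_(m, n)).
Proof. by move=> a b; rewrite mxE O_nat. Qed.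

Lemma O_det n (A : 'M[F]_n) : Omx A -> O (\det A).
Proof.
move=> oA; apply: O_sum => s _; apply: O_mul; first by apply: O_exp; apply: O_opp O_1.
exact: O_prod.
Qed.

Definition redmx m n (A : 'M[F]_(m, n)) : 'M[k]_(m, n) := map_mx red A.

Lemma redmx_mul m n p (A : 'M[F]_(m, n)) (B : 'M[F]_(n, p)) : Omx A -> Omx B ->
  redmx (A *m B) = redmx A *m redmx B.
Proof.
move=> a b; apply/matrixP=> i j; rewrite !mxE red_sum => [|l _]; last exact: O_mul.
by apply: eq_bigr => l _; rewrite !mxE redM.
Qed.

Lemma redmx1 n : redmx (1%:M : 'M[F]_n) = 1%:M.
Proof. by apply/matrixP=> i j; rewrite !mxE; case: eqP => _; rewrite ?red1 ?red0. Qed.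

Lemma redmx_elem n a (i j : 'I_n) : O a ->
  redmx (1%:M + a *: delta_mx i j) = 1%:M + red a *: delta_mx i j.
Proof.
move=> oa; apply/matrixP=> c d; rewrite !mxE redD ?O_nat ?O_mul ?O_nat // redM ?O_nat //.
by case: (c == d); case: ((c == i) && (d == j)); rewrite /= ?red1 ?red0.
Qed.

Lemma red_bool (b : bool) : red b%:R = b%:R.
Proof. by case: b; rewrite ?red1 ?red0. Qed.

Lemma redmx_eq1 n (g : 'M[F]_n) : Omx g ->
  (redmx g == 1%:M) = [forall i, forall j, val_ge 1 (g i j - (i == j)%:R)].
Proof.
move=> gO; have E i j : (redmx g i j == (1%:M : 'M_n) i j) = val_ge 1 (g i j - (i == j)%:R).
  by rewrite !mxE -red_bool red_eq ?O_nat.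
apply/eqP/forallP => [e i|H]; first by apply/forallP=> j; rewrite -E e.
by apply/matrixP=> i j; apply/eqP; rewrite E; apply: (forallP (H i)).
Qed.

Lemma Omx_of_congr1 n (g : 'M[F]_n) : (forall i j, val_ge 1 (g i j - (i == j)%:R)) -> Omx g.
Proof.
by move=> H i j; rewrite -[g i j](subrK (i == j)%:R) O_add ?O_nat //; apply: val_ge_O (H i j).
Qed.

Section K.
Variable n : nat.
Implicit Types (g h : 'M[F]_n).

Lemma inK_unitmx g : inK O g -> g \in unitmx.
Proof. by case=> _ d _; rewrite unitmxE unitfE. Qed.

Lemma inK_Omx g : inK O g -> Omx g. Proof. by case. Qed.

Lemma inK_of_inv g h : Omx g -> Omx h -> g *m h = 1%:M -> inK O g.
Proof.
move=> og oh gh; have := det_mulmx g h; rewrite gh det1 => E.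
have dg : \det g != 0.
  by apply/eqP=> e; move: E; rewrite e mul0r => /eqP; rewrite oner_eq0.
split=> //; have -> : (\det g)^-1 = \det h by rewrite -[LHS]mulr1 E mulKf.
exact: O_det.
Qed.

Lemma inK_inv_Omx g : inK O g -> Omx (invmx g).
Proof.
move=> gK; have [og d oi] := gK; rewrite /invmx inK_unitmx // => i j; rewrite !mxE.
apply: O_mul => //; apply: O_mul; first by apply: O_exp; apply: O_opp O_1.
by apply: O_det => a b; rewrite !mxE.
Qed.

Lemma inK_inv g : inK O g -> inK O (invmx g).
Proof.
move=> gK; apply: (inK_of_inv (inK_inv_Omx gK) (inK_Omx gK)).
by rewrite mulVmx // inK_unitmx.
Qed.

Lemma inK1 : inK O (1%:M : 'M[F]_n).
Proof. by apply: (inK_of_inv (Omx1 (n := n)) (Omx1 (n := n))); rewrite mulmx1. Qed.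

Lemma inK_mul g h : inK O g -> inK O h -> inK O (g *m h).
Proof.
move=> [a b c] [d e f]; split; [exact: Omx_mul | rewrite det_mulmx mulf_neq0 // |].
by rewrite det_mulmx invfM O_mul.
Qed.

Lemma inK_redmx_unit g : inK O g -> redmx g \in unitmx.
Proof.
move=> gK; have := redmx_mul (inK_Omx gK) (inK_inv_Omx gK).
by rewrite mulmxV ?inK_unitmx // redmx1 => /esym/mulmx1_unit [].
Qed.

Lemma inK_rank1 (c : 'cV[F]_n) (r : 'rV[F]_n) : Omx c -> Omx r ->
  unitO (1 + (r *m c) 0 0) -> inK O (1%:M + c *m r).
Proof.
move=> oc or [a b d]; apply: inK_of_inv (rank1_mul a).
  by apply: Omx_add; [exact: Omx1 | exact: Omx_mul].
apply: Omx_sub; first exact: Omx1.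
by apply: Omx_scale => //; apply: Omx_mul.
Qed.

Lemma inK_elem a (i j : 'I_n) : O a -> i != j -> inK O (1%:M + a *: delta_mx i j).
Proof.
move=> oa ij; rewrite -(mul_delta_mx (0 : 'I_1)) scalemxAl.
apply: inK_rank1; [by apply: Omx_scale => //; apply: Omx_delta | exact: Omx_delta |].
rewrite -scalemxAr mul_delta_mx_0 1?eq_sym // scaler0 mxE addr0; exact: unitO1.
Qed.

Lemma redmx_det (g : 'M[F]_n) : Omx g -> red (\det g) = \det (redmx g).
Proof.
move=> oA; rewrite /determinant red_sum => [|s _]; last first.
  by apply: O_mul; [apply: O_exp; apply: O_opp O_1 | apply: O_prod].
apply: eq_bigr => s _; rewrite redM; [|by apply: O_exp; apply: O_opp O_1|exact: O_prod].
congr (_ * _).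
  by case: (s : bool); rewrite ?expr1 ?expr0 ?redN ?red1 ?O_1.
elim: (index_enum _) => [|i r IH]; first by rewrite !big_nil red1.
by rewrite !big_cons redM ?IH ?mxE //; apply: O_prod.
Qed.

Lemma inK_of_redmx g : Omx g -> redmx g \in unitmx -> inK O g.
Proof.
move=> og; rewrite unitmxE unitfE -redmx_det // => ru.
by have [] := unit_of_red (O_det og) ru; split.
Qed.

End K.
End LocalField.

(** * Iwasawa and Cartan decompositions *)

Section Decomposition.
Variables (F : fieldType) (O : pred F) (w : F) (k : finFieldType) (red : F -> k).
Hypothesis HF : is_nonarch_local_field O w red.
Variable n : nat.
Implicit Types (g x y : 'M[F]_n.+1) (v : 'cV[F]_n.+1) (a : 'I_n.+1 -> int).
Notation N := (@ord_max n).
Notation val_ge := (val_ge O w).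

Lemma inKmP m g : inKm O w m g <->
  inK O g /\ forall j : 'I_n.+1, val_ge m%:Z (g N j - (N == j)%:R).
Proof.
split=> [[gK H]|[gK H]]; split=> //.
  move=> j; have [H1 H2] := H N j erefl.
  have [jN|jN] := ltnP j n.
    rewrite -val_eqE /= gtn_eqF // subr0; apply/(in_powP HF); exact: H1.
  have e : val j = n by apply/eqP; rewrite eqn_leq jN -ltnS ltn_ord.
  by rewrite -val_eqE /= e eqxx; apply/(in_powP HF); apply: H2.
move=> i j /= iN; have -> : i = N by apply: val_inj.
have := H j; rewrite -val_eqE /=; split=> [jN|jN].
  by apply/(in_powP HF); move: H0; rewrite gtn_eqF // subr0.
by apply/(in_powP HF); move: H0; rewrite jN eqxx.
Qed.

Lemma inKm_inK m g : inKm O w m g -> inK O g. Proof. by case. Qed.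

Lemma inKm_mirabolic m g : inK O g -> mirabolic g -> inKm O w m g.
Proof.
move=> gK mg; apply/inKmP; split=> // j.
by rewrite mirabolicE // eq_sym subrr (val_ge_0 HF).
Qed.

Lemma sum_kronecker (G : 'I_n.+1 -> F) (i : 'I_n.+1) : \sum_l (i == l)%:R * G l = G i.
Proof.
rewrite (bigD1 i) //= eqxx mul1r big1 ?addr0 // => l.
by rewrite eq_sym => /negPf ->; rewrite mul0r.
Qed.

Lemma inKm_mul m g x : inKm O w m g -> inKm O w m x -> inKm O w m (g *m x).
Proof.
move=> /inKmP [gK gN] /inKmP [xK xN]; apply/inKmP; split; first exact: (inK_mul HF).
move=> j; have -> : (g *m x) N j - (N == j)%:R =
    \sum_l (g N l - (N == l)%:R) * x l j + (x N j - (N == j)%:R).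
  rewrite mxE addrA; congr (_ - _).
  under [in RHS]eq_bigr do rewrite mulrBl.
  by rewrite sumrB sum_kronecker subrK.
apply: (val_geD HF) => //; apply: (val_ge_sum HF) => l _; apply: (val_ge_mulO HF) => //.
exact: (inK_Omx xK).
Qed.

Lemma inKm_inv m g : inKm O w m g -> inKm O w m (invmx g).
Proof.
move=> /inKmP [gK gN]; apply/inKmP; split; first exact: (inK_inv HF).
have gu := inK_unitmx gK.
move=> j; have -> : invmx g N j - (N == j)%:R = - \sum_l (g N l - (N == l)%:R) * invmx g l j.
  have := congr1 (fun M : 'M_n.+1 => M N j) (mulmxV gu); rewrite !mxE => <-.
  under [in RHS]eq_bigr do rewrite mulrBl; rewrite sumrB opprB; congr (_ - _).
  by rewrite sum_kronecker.
apply: (val_geN HF); apply: (val_ge_sum HF) => l _; apply: (val_ge_mulO HF) => //.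
exact: (inK_inv_Omx HF).
Qed.

Lemma minimal_entry (I : finType) (G : I -> F) : (exists i, G i != 0) ->
  exists i, G i != 0 /\ forall j, O (G j / G i).
Proof.
move=> [i0 Gi0].
have : forall i, exists e : int, G i != 0 -> forall d, val_ge d (G i) = (d <= e).
  move=> i; have [->|/(valuation_exists HF) [e eE]] := eqVneq (G i) 0; first by exists 0.
  by exists e.
move/fin_all_exists => [e eE].
have [i Gi mini] := @arg_minP _ _ _ i0 (fun i => G i != 0) e Gi0.
exists i; split=> // j; have [->|Gj] := eqVneq (G j) 0; first by rewrite mul0r (O_0 HF).
have pj : val_ge (e i) (G j) by rewrite eE // mini.
have [d [u [uu GE]]] := uniformizer_decomp HF Gi.
have ed : d = e i by apply/eqP; rewrite eq_le -eE // GE !(val_ge_unit HF _ _ uu) lexx /= -(val_ge_unit HF _ _ uu) -GE eE.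
rewrite GE invfM mulrA (O_mul_unit HF); last exact: unitO_inv.
by move: pj; rewrite val_geE -ed mulrC -invr_expz.
Qed.

Definition lam a : 'M[F]_n.+1 := \matrix_(i, j) if i == j then w ^ a i else 0.

Lemma lam_mulE p a (g : 'M[F]_(n.+1, p)) i j : (lam a *m g) i j = w ^ a i * g i j.
Proof.
rewrite mxE (bigD1 i) //= mxE eqxx big1 ?addr0 // => l li.
by rewrite mxE eq_sym (negPf li) mul0r.
Qed.

Lemma mul_lamE p a (g : 'M[F]_(p, n.+1)) i j : (g *m lam a) i j = g i j * w ^ a j.
Proof.
rewrite mxE (bigD1 j) //= mxE eqxx big1 ?addr0 // => l li.
by rewrite mxE (negPf li) mulr0.
Qed.

Lemma lam_inv a : lam a *m lam (fun i => - a i) = 1%:M.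
Proof.
apply/matrixP=> i j; rewrite lam_mulE !mxE; case: eqP => _; last by rewrite mulr0.
by rewrite -expfzDr ?(w_neq0 HF) // subrr.
Qed.

Lemma lam_unit a : lam a \in unitmx.
Proof. by case/mulmx1_unit: (lam_inv a). Qed.

Definition nv v : 'M[F]_n.+1 := 1%:M + v *m delta_mx (0 : 'I_1) N.

Lemma nv_mul v v' : v' N 0 = 0 -> nv v *m nv v' = nv (v + v').
Proof.
move=> v'0; rewrite /nv mulmxDl mul1mx mulmxDr mulmx1 mulmxA -(mulmxA v) delta_row_mul.
have -> : row N v' = 0 by apply/matrixP=> i j; rewrite !mxE ord1.
by rewrite mulmx0 mul0mx addr0 [in RHS]mulmxDl [in RHS]addrA addrAC.
Qed.

Lemma nv_mirabolic v : v N 0 = 0 -> mirabolic (nv v).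
Proof.
move=> v0; apply/rowP=> j; rewrite !mxE big_ord1 v0 mul0r addr0 eq_sym.
by [].
Qed.

Lemma nv_inK v : v N 0 = 0 -> Omx O v -> inK O (nv v).
Proof.
move=> v0 ov; apply: (inK_rank1 HF) => //; first exact: (Omx_delta HF).
by rewrite delta_row_mul mxE v0 addr0; apply: (unitO1 HF).
Qed.

Lemma primitive_row_complete (y : 'rV[F]_n.+1) : y != 0 ->
  exists z k', [/\ z != 0, inK O k' & row N k' = z *: y].
Proof.
case/rV0Pn => j0 yj0.
have [i [yi yO]] := minimal_entry (ex_intro (fun j => y 0 j != 0) j0 yj0).
pose y1 : 'rV[F]_n.+1 := (y 0 i)^-1 *: y.
have Oy1 : Omx O y1 by move=> a j; rewrite (ord1 a) mxE mulrC.
have y1i : y1 0 i = 1 by rewrite mxE mulVf.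
(* Chosen so that the last entry of [u] is 1 and [y1 - e_N] kills [u]: then [1 + u (y1 - e_N)] has
   last row [y1] and determinant 1. *)
pose u : 'cV[F]_n.+1 := delta_mx N 0 + (1 - y1 0 N) *: delta_mx i 0.
have uN : u N 0 = 1.
  rewrite !mxE !eqxx /= andbT; case: (eqVneq N i) => [e|_]; last by rewrite mulr0 addr0.
  by rewrite {1}e mulVf // subrr mul0r addr0.
exists (y 0 i)^-1, (1%:M + u *m (y1 - delta_mx 0 N)); split.
- by rewrite invr_eq0.
- apply: (inK_rank1 HF).
  + apply: (Omx_add HF); first exact: (Omx_delta HF).
    by apply: (Omx_scale HF); [rewrite (O_sub HF) ?(O_1 HF) | exact: (Omx_delta HF)].
  + by apply: (Omx_sub HF) => //; exact: (Omx_delta HF).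
  have -> : ((y1 - delta_mx 0 N) *m u) 0 0 = 0; last by rewrite addr0; apply: (unitO1 HF).
  rewrite mulmxBl delta_row_mul [LHS]mxE [(- row N u) 0 0]mxE [row N u 0 0]mxE uN.
  rewrite /u mulmxDr -scalemxAr !delta_col_mul; move: y1i; move: (y1) => Y Yi.
  by rewrite !mxE Yi mulr1 [Y 0 N + _]addrC subrK subrr.
rewrite raddfD /= row1 row_mul.
have -> : row N u = 1%:M by apply/matrixP=> a b; rewrite [LHS]mxE [RHS]mxE !ord1 uN eqxx.
by rewrite mul1mx addrC subrK.
Qed.

(** An entry of minimal valuation divides all the others, so both clearing matrices are integral, of
    determinant 1. *)
Lemma inK_pivots g : g != 0 ->
  exists i j, [/\ g i j != 0, inK O (pivL g i j) & inK O (pivR g i j)].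
Proof.
case/matrix0Pn => i0 [j0 g0].
have [] := @minimal_entry _ (fun p : 'I_n.+1 * 'I_n.+1 => g p.1 p.2).
  by exists (i0, j0).
move=> [i j] /= [nz H]; exists i, j; split=> //.
  rewrite /pivL -mulNmx; apply: (inK_rank1 HF); try exact: (Omx_delta HF).
    rewrite opprB; apply: (Omx_sub HF); first exact: (Omx_delta HF).
    by move=> a b; rewrite !mxE mulrC; apply: (H (a, j)).
  by rewrite delta_row_mul !mxE !eqxx mulVf // subrr oppr0 addr0; apply: (unitO1 HF).
rewrite /pivR -mulmxN; apply: (inK_rank1 HF); try exact: (Omx_delta HF).
  rewrite opprB; apply: (Omx_sub HF); first exact: (Omx_delta HF).
  by move=> a b; rewrite !mxE mulrC; apply: (H (i, b)).
by rewrite delta_col_mul !mxE !eqxx mulVf // subrr oppr0 addr0; apply: (unitO1 HF).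
Qed.

Lemma monomial_lam (M : 'M[F]_n.+1) : monomial M -> M \in unitmx -> mirabolic M ->
  exists a kappa, [/\ a N = 0, inK O kappa, mirabolic kappa & M = lam a *m kappa].
Proof.
move=> mon Mu mM; have [s Ms] := monomial_perm mon Mu.
have sN : s N = N by apply/esym/eqP; rewrite -Ms mirabolicE // eqxx oner_eq0.
have : forall i, exists p : int * F,
    [/\ unitO O p.2, M i (s i) = w ^ p.1 * p.2 & i = N -> p.1 = 0 /\ p.2 = 1].
  move=> i; have [->|iN] := eqVneq i N.
    by exists (0, 1); split=> //; [exact: (unitO1 HF) | rewrite sN mirabolicE // eqxx mulr1].
  have nz : M i (s i) != 0 by rewrite Ms.
  by have [e [u [uu E]]] := uniformizer_decomp HF nz; exists (e, u); split=> // e'; rewrite e' eqxx in iN.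
case/fin_all_exists => p pP.
pose kappa : 'M[F]_n.+1 := \matrix_(i, j) if j == s i then (p i).2 else 0.
pose kappa' : 'M[F]_n.+1 := \matrix_(i, j) if i == s j then (p j).2^-1 else 0.
exists (fun i => (p i).1), kappa; split.
- by have [_ _ /(_ erefl) []] := pP N.
- apply: (inK_of_inv HF (h := kappa')).
  + by move=> i j; rewrite mxE; case: ifP => _; rewrite ?(O_0 HF) //; have [[]] := pP i.
  + by move=> i j; rewrite mxE; case: ifP => _; rewrite ?(O_0 HF) //; have [[]] := pP j.
  apply/matrixP=> i j; rewrite !mxE (bigD1 (s i)) //= !mxE eqxx (inj_eq perm_inj) big1 ?addr0.
    by case: eqP => [->|_]; rewrite ?mulr0 // mulfV //; have [[]] := pP j.
  by move=> l /negPf li; rewrite mxE li mul0r.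
- apply/rowP=> j; rewrite !mxE sN eqxx /=; case: eqP => // _.
  by have [_ _ /(_ erefl) []] := pP N.
apply/matrixP=> i j; rewrite lam_mulE (monomialE Ms) mxE.
have [_ E _] := pP i; rewrite E; case: ifP; by rewrite ?mul1r ?mul0r ?mulr0.
Qed.

(** An entry in O can be removed from the left, and one in w^(a_i) O from the right after
    conjugation by [lam a]; a surviving entry lies in neither. *)
Definition reduced_col a v := v N 0 = 0 /\
  forall i, v i 0 != 0 -> ~~ O (v i 0) /\ ~~ val_ge (a i) (v i 0).

Lemma nv_lam a v : a N = 0 -> (nv (lam a *m v)) *m lam a = lam a *m nv v.
Proof.
move=> aN; rewrite /nv mulmxDl mulmxDr mul1mx mulmx1 mulmxA -!mulmxA; congr (_ + _ *m (_ *m _)).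
rewrite delta_row_mul; apply/rowP=> j; rewrite !mxE eqxx eq_sym aN.
by case: eqP => // ->.
Qed.

Lemma nv_reduce a v : a N = 0 -> v N 0 = 0 ->
  exists (x y : 'cV[F]_n.+1) v', [/\ x N 0 = 0 /\ Omx O x, y N 0 = 0 /\ Omx O y, reduced_col a v'
    & nv v *m lam a = nv x *m (nv v' *m lam a) *m nv y].
Proof.
move=> aN vN.
pose x : 'cV[F]_n.+1 := \col_i if O (v i 0) then v i 0 else 0.
pose y : 'cV[F]_n.+1 := \col_i if ~~ O (v i 0) && val_ge (a i) (v i 0) then w ^ (- a i) * v i 0 else 0.
pose v' : 'cV[F]_n.+1 := \col_i if ~~ O (v i 0) && ~~ val_ge (a i) (v i 0) then v i 0 else 0.
have O0 := O_0 HF.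
exists x, y, v'; split.
- by rewrite mxE vN O0; split=> // i j; rewrite mxE; case: ifP.
- rewrite mxE vN O0; split=> // i j; rewrite mxE; case: ifP => // /andP [_].
  by rewrite val_geE.
- rewrite /reduced_col mxE vN O0; split=> // i; rewrite mxE; case: ifP => [/andP [] //|].
  by rewrite eqxx.
rewrite -!mulmxA -nv_lam // !mulmxA !nv_mul; last 2 first.
- by rewrite ?lam_mulE mxE vN O0 ?mulr0.
- by rewrite ?lam_mulE mxE vN O0 ?mulr0.
congr (nv _ *m _); apply/matrixP=> i j; rewrite (ord1 j) mxE lam_mulE 3!mxE mxE.
case: (O (v i 0)); case: (val_ge (a i) (v i 0)); rewrite /= ?mulr0 ?addr0 ?add0r //.
by rewrite mulrA -expfzDr ?(w_neq0 HF) // subrr mul1r.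
Qed.

(** The right factor is mirabolic, hence in K(m) for every m: one decomposition serves all
    levels. *)
Theorem iwasawa_cartan g : g \in unitmx -> exists z k0 v a k1,
  [/\ z != 0, inK O k0, inK O k1 /\ mirabolic k1, a N = 0 /\ reduced_col a v
    & g = z%:M *m k0 *m (nv v *m lam a) *m k1].
Proof.
move=> gu.
have y0 : row N (invmx g) != 0.
  apply/eqP=> e; have : row N (invmx g *m g) = 0 by rewrite row_mul e mul0mx.
  by rewrite mulVmx // row1 => /rowP/(_ N); rewrite !mxE !eqxx => /eqP; rewrite oner_eq0.
have [z [k' [z0 k'K k'N]]] := primitive_row_complete y0.
(* The last row of [k'] is [z] times that of the inverse of [g], so the last row of [k' g] is
   [z e_N]. *)
pose p0 := z^-1 *: (k' *m g).
have mp0 : mirabolic p0.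
  rewrite /mirabolic linearZ /= row_mul k'N -scalemxAl scalerA mulVf // scale1r.
  by rewrite -row_mul mulVmx // row1.
have p0u : p0 \in unitmx by rewrite unitmxZ ?unitfE ?invr_eq0 // unitmx_mul (inK_unitmx k'K).
have [v0 [p1 [v0N rp cp p0E]]] := mirabolic_split mp0.
have [l [r [lK rK ml mr mon]]] :=
  pivot_mirabolic (inK1 HF n.+1) (inK1 HF n.+1) (inK_mul HF (n := n.+1)) (inK_mul HF (n := n.+1))
    inK_pivots rp cp.
have p1u : p1 \in unitmx by move: p0u; rewrite p0E unitmx_mul => /andP [].
have lu := inK_unitmx lK; have ru := inK_unitmx rK; have k'u := inK_unitmx k'K.
have [||a [kp [aN kpK mkp ME]]] := monomial_lam mon.
- by rewrite !unitmx_mul lu p1u.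
- by apply: mirabolic_mulr => //; apply: mirabolic_mulr => //.
have lvN : (l *m v0) N 0 = 0.
  by have := congr1 (fun M : 'rV_1 => M 0 0) (row_mul N l v0); rewrite ml delta_row_mul !mxE => ->.
have [x [y [v' [[xN xO] [yN yO] red_v E]]]] := nv_reduce aN lvN.
have liK := inK_inv HF lK; have riK := inK_inv HF rK.
exists z, (invmx k' *m invmx l *m nv x), v', a, (nv y *m kp *m invmx r); split=> //.
- apply: (inK_mul HF); last exact: nv_inK.
  by apply: (inK_mul HF) => //; exact: (inK_inv HF).
- split.
    by apply: (inK_mul HF) => //; apply: (inK_mul HF) => //; exact: nv_inK.
  apply: mirabolic_mulr; last exact: mirabolic_inv.
  by apply: mirabolic_mulr => //; apply: nv_mirabolic.
have p1E : p1 = invmx l *m (lam a *m kp) *m invmx r.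
  by rewrite -ME -!mulmxA mulmxV // mulmx1 mulKmx.
have lnv : nv v0 *m invmx l = invmx l *m nv (l *m v0).
  rewrite /nv mulmxDl mulmxDr mul1mx mulmx1; congr (_ + _).
  by rewrite -!mulmxA mulKmx // delta_row_mul mirabolic_inv.
have gE : g = z%:M *m invmx k' *m p0.
  by rewrite mul_scalar_mx -scalemxAl -scalemxAr scalerA mulfV // scale1r mulKmx.
rewrite gE p0E -/(nv v0) p1E -!mulmxA; congr (_ *m (_ *m _)).
rewrite !mulmxA lnv -!mulmxA; congr (_ *m _).
by rewrite !mulmxA in E *; rewrite E.
Qed.

End Decomposition.

(** * Support of invariant functions *)

Section Support.
Variables (F : fieldType) (O : pred F) (w : F) (k : finFieldType) (red : F -> k).
Hypothesis HF : is_nonarch_local_field O w red.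
Variables (R : closedFieldType) (n : nat) (psi : k -> R).
Variable Wsp : ('M[k]_n.+1 -> R) -> Prop.
Hypothesis psiD : forall a b, psi (a + b) = psi a * psi b.
Hypothesis psi0 : psi 0 = 1.
Hypothesis psi_nt : exists a, psi a != 1.
Hypothesis HW : cusp_whittaker psi Wsp.
Variable omega : F -> R.
Hypothesis HC : central_compat O red Wsp omega.
Variable B : 'M[k]_n.+1 -> R.
Hypothesis HB : isBessel psi Wsp B.
Notation N := (@ord_max n).
Notation val_ge := (val_ge O w).
Notation lam := (@lam F w n).
Notation redmx := (redmx red).
Notation ind_space := (ind_space O red Wsp omega).
Notation inv_space := (inv_space O w red Wsp omega).
Implicit Types (f : 'M[F]_n.+1 -> 'M[k]_n.+1 -> R) (a : 'I_n.+1 -> int).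

Lemma omega_neq0 z : z != 0 -> omega z != 0. Proof. by have [_ H _] := HC; apply: H. Qed.

Lemma omega1 : omega 1 = 1.
Proof.
have [H _ _] := HC; have := H 1 1 (oner_neq0 _) (oner_neq0 _).
by rewrite mulr1 -[LHS]mulr1 => /(mulfI (omega_neq0 (oner_neq0 _))) <-.
Qed.

Lemma inv_space_Wsp m f g : inv_space m f -> Wsp (f g).
Proof. by case=> -[H _ _ _] _; apply: H. Qed.

Lemma inv_space_left m f z k0 g x : inv_space m f -> z != 0 -> inK O k0 -> g \in unitmx ->
  f (z%:M *m k0 *m g) x = omega z * f g (x *m redmx k0).
Proof. by case=> -[_ _ H _] _; apply: H. Qed.

Lemma inv_space_right m f g k0 x : inv_space m f -> inKm O w m k0 -> f (g *m k0) x = f g x.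
Proof. by case=> _; apply. Qed.

Lemma inv_space_stable m f g k0 k1 x : inv_space m f -> inK O k0 -> inKm O w m k1 -> g \in unitmx ->
  k0 *m g = g *m k1 -> f g (x *m redmx k0) = f g x.
Proof.
move=> Hf k0K k1K gu E; rewrite -[RHS](inv_space_right _ _ Hf k1K) -E.
have := inv_space_left x Hf (oner_neq0 F) k0K gu.
by rewrite omega1 mul1r mul_scalar_mx scale1r => ->.
Qed.

Lemma lam_stable m f a k0 x : inv_space m f -> a N = 0 -> inK O k0 ->
  (forall i j, val_ge (a i - a j) (k0 i j)) ->
  (forall j, val_ge (m%:Z - a j) (k0 N j - (N == j)%:R)) ->
  f (lam a) (x *m redmx k0) = f (lam a) x.
Proof.
move=> Hf aN k0K H1 H2.
pose k1 := lam (fun i => - a i) *m k0 *m lam a.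
have k1E i j : k1 i j = w ^ (a j - a i) * k0 i j.
  by rewrite mul_lamE lam_mulE mulrC mulrA -expfzDr ?(w_neq0 HF).
have E : k0 *m lam a = lam a *m k1.
  by rewrite /k1 !mulmxA (lam_inv HF) mul1mx.
apply: (inv_space_stable (k1 := k1) _ Hf) => //; last exact: (lam_unit HF).
apply/(inKmP HF); split.
  have [_ d oi] := k0K.
  have dE : \det k1 = \det k0.
    rewrite /k1 !det_mulmx mulrAC -det_mulmx.
    by rewrite (mulmx1C (lam_inv HF a)) det1 mul1r.
  split; rewrite ?dE //.
  by move=> i j; rewrite k1E; have := H1 i j; rewrite val_geE opprB.
move=> j; rewrite k1E aN subr0.
have -> : w ^ a j * k0 N j - (N == j)%:R = w ^ a j * (k0 N j - (N == j)%:R).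
  by rewrite mulrBr; case: eqP => [<-|_]; rewrite ?aN ?expr0z ?mulr1 ?mulr0.
by rewrite (val_ge_wz HF).
Qed.

Lemma lam_stable_elem m f a (c : k) (i j : 'I_n.+1) x : inv_space m f -> a N = 0 -> i != j ->
  a i <= a j -> (i = N -> m%:Z <= a j) ->
  f (lam a) (x *m (1%:M + c *: delta_mx i j)) = f (lam a) x.
Proof.
move=> Hf aN ij aij mj; have [c' [oc <-]] := red_surj HF c.
rewrite -(redmx_elem HF) //; apply: (lam_stable _ Hf) => //.
- exact: (inK_elem HF).
- move=> i' j'; rewrite !mxE; apply: (val_geD HF).
    case: eqVneq => [->|_]; last exact: (val_ge_0 HF).
    by rewrite subrr val_geE0 (O_1 HF).
  case: (eqVneq i' i) => [->|]; case: (eqVneq j' j) => [->|] *; rewrite ?mulr0 ?(val_ge_0 HF) //.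
  by rewrite mulr1; apply: (val_ge_le HF (e := 0)); [lia | rewrite val_geE0].
move=> j'; rewrite !mxE addrAC subrr add0r.
case: (eqVneq N i) => [iN|]; case: (eqVneq j' j) => [->|] *; rewrite ?mulr0 ?(val_ge_0 HF) //.
rewrite mulr1; apply: (val_ge_le HF (e := 0)); last by rewrite val_geE0.
by have := mj (esym iN); lia.
Qed.

(** The rows with non-positive exponent, apart from the last, have exponents no larger than all
    remaining ones, the last included: the corresponding unipotent radical fixes the value of
    [f]. *)
Lemma lam_positive m f a : inv_space m f -> a N = 0 -> (exists x, f (lam a) x != 0) ->
  forall i, i != N -> 0 < a i.
Proof.
move=> Hf aN [x fx] i iN; rewrite ltNge; apply/negP => ai.
case/eqP: fx; apply: (cusp_subset HW (I := [set i | (i != N) && (a i <= 0)]) (inv_space_Wsp _ Hf)).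
- by apply/set0Pn; exists i; rewrite inE iN.
- by apply/eqP => /setP/(_ N); rewrite !inE eqxx.
move=> i' j c y; rewrite !inE negb_and negbK => /andP [iN' ai'] jI.
apply: (lam_stable_elem _ _ Hf) => //.
- by apply: contraTneq jI => <-; rewrite negb_or iN' negbK ai'.
- by case/orP: jI => [/eqP ->|]; lia.
by move=> e; rewrite e eqxx in iN'.
Qed.

(** The radical now has the indices of exponent at least [m] as columns; there even the root groups
    in the last row come from K(m). *)
Lemma lam_bounded m f a : inv_space m f -> a N = 0 -> (exists x, f (lam a) x != 0) ->
  forall i, i != N -> a i < m%:Z.
Proof.
move=> Hf aN [x fx] i iN; rewrite ltNge; apply/negP => ai.
case/eqP: fx; apply: (cusp_subset HW (I := [set i | ~~ ((i != N) && (m%:Z <= a i))]) (inv_space_Wsp _ Hf)).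
- by apply/set0Pn; exists N; rewrite inE eqxx.
- by apply/eqP => /setP/(_ i); rewrite !inE iN ai.
move=> i' j c y; rewrite !inE negbK => iI /andP [jN aj].
apply: (lam_stable_elem _ _ Hf) => //.
- by apply/eqP => e; move: iI; rewrite e jN aj.
by move: iI; rewrite negb_and negbK => /orP [/eqP ->|]; lia.
Qed.

Lemma lam_bop_inv m f a : inv_space m f -> a N = 0 -> (forall i, i != N -> a i < m%:Z) ->
  (forall i j : 'I_n.+1, (i <= j)%N -> a j <= a i) -> bop_inv (f (lam a)).
Proof.
move=> Hf aN am adec b x bL; have /lowerBP [bu bl bm] := bL.
(* Entries 0 and 1 are lifted to exactly 0 and 1, so the lift of [b] is still lower triangular and
   its last row is exactly a basis row. *)
have : forall i, exists r : 'I_n.+1 -> F, forall j,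
    [/\ O (r j), red (r j) = b i j, b i j = 0 -> r j = 0 & b i j = 1 -> r j = 1].
  move=> i; have H j : exists c : F,
      [/\ O c, red c = b i j, b i j = 0 -> c = 0 & b i j = 1 -> c = 1].
    have [->|b0] := eqVneq (b i j) 0.
      by exists 0; split=> //; rewrite ?(O_0 HF) ?(red0 HF) // => /esym/eqP; rewrite oner_eq0.
    have [->|b1] := eqVneq (b i j) 1.
      by exists 1; split=> //; rewrite ?(O_1 HF) ?(red1 HF) // => /eqP; rewrite oner_eq0.
    have [c [oc E]] := red_surj HF (b i j); exists c; split=> // e.
      by rewrite e eqxx in b0.
    by rewrite e eqxx in b1.
  by have [r rP] := fin_all_exists H; exists r.
case/fin_all_exists => r rP; pose k0 : 'M[F]_n.+1 := \matrix_(i, j) r i j.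
have k0b : redmx k0 = b by apply/matrixP=> i j; rewrite !mxE; case: (rP i j).
have k0O : Omx O k0 by move=> i j; rewrite mxE; case: (rP i j).
have k0N j : k0 N j = (N == j)%:R.
  rewrite mxE; have [_ _ h0 h1] := rP N j; move: h0 h1; rewrite mirabolicE // eq_sym.
  by case: eqP => _ h0 h1; [rewrite h1 | rewrite h0].
rewrite -{1}k0b; apply: (lam_stable _ Hf) => //.
- by apply: (inK_of_redmx HF) => //; rewrite k0b.
- move=> i j; have [ij|ji] := ltnP i j.
    by have [_ _ h _] := rP i j; rewrite mxE h ?(val_ge_0 HF) // bl.
  apply: (val_ge_le HF (e := 0)); last by rewrite val_geE0.
  by have := adec j i ji; lia.
by move=> j; rewrite k0N subrr (val_ge_0 HF).
Qed.

(* Put e_i = - val(v_i). Choosing [i] with v_i != 0 and a_i + e_i maximal, the rows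
   [j] with a_j <= a_i + e_i span a unipotent radical that fixes the value of [f]: for the last
   column, the lift [k0] below compensates the entry (i', N) by an entry (i', i) of [w O]. *)
Lemma nv_lam_vanish m f a v x : inv_space m f -> a N = 0 -> reduced_col O w a v ->
  (exists i, v i 0 != 0) -> f (nv v *m lam a) x = 0.
Proof.
move=> Hf aN [vN red_v] [i0 vi0].
have : forall i, exists e : int, v i 0 != 0 ->
    [/\ 0 < e, 0 < a i + e & forall d, val_ge d (v i 0)^-1 = (d <= e)].
  move=> i; have [->|vi] := eqVneq (v i 0) 0; first by exists 0.
  have [e [u [uu E]]] := uniformizer_decomp HF vi; exists (- e) => _.
  have [h1 h2] := red_v i vi; move: h1 h2; rewrite -(val_geE0 O w) E !(val_ge_unit HF _ _ uu) => h1 h2.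
  split; [lia | lia | move=> d].
  by rewrite invfM invr_expz (val_ge_unit HF) //; apply: unitO_inv.
case/fin_all_exists => e eP.
have [i vi maxi] := @arg_maxP _ _ _ i0 (fun i => v i 0 != 0) (fun i => a i + e i) vi0.
have [ei aei eE] := eP i vi.
have iN : i != N by apply: contraNneq vi => ->; rewrite vN.
have pu : nv v *m lam a \in unitmx.
  rewrite unitmx_mul (lam_unit HF) andbT; have := nv_mul v (v' := - v).
  by rewrite mxE vN oppr0 subrr {3}/nv mul0mx addr0 => /(_ erefl)/mulmx1_unit [].
apply: (cusp_subset HW (I := [set j | (j != N) && (a j <= a i + e i)]) (inv_space_Wsp _ Hf)).
- by apply/set0Pn; exists i; rewrite inE iN /=; lia.
- by apply/eqP => /setP/(_ N); rewrite !inE eqxx.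
move=> i' j c y; rewrite !inE negb_and negbK => /andP [iN' ai'] jI.
have [c' [oc <-]] := red_surj HF c.
have mir (d : F) j' : mirabolic (1%:M + d *: delta_mx i' j' : 'M[F]_n.+1).
  apply/rowP=> l; rewrite !mxE !eqxx /= [N == i']eq_sym (negPf iN') /= mulr0 addr0.
  by rewrite eq_sym.
have lam_elem (d : F) j' : (1%:M + d *: delta_mx i' j') *m lam a
    = lam a *m (1%:M + (d * w ^ (a j' - a i')) *: delta_mx i' j').
  apply/matrixP=> p q; rewrite mul_lamE lam_mulE !mxE mulrDl mulrDr; congr (_ + _).
    by rewrite mulrC; case: eqP => [->|]; rewrite ?mul0r ?mulr0.
  case: (eqVneq p i') => [->|]; last by rewrite !(mulr0, mul0r).
  case: (eqVneq q j') => [->|]; last by rewrite !(mulr0, mul0r).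
  by rewrite !mulr1 mulrCA -expfzDr ?(w_neq0 HF) // addrC subrK.
have nv_delta (j' : 'I_n.+1) : nv v *m delta_mx i' j' = delta_mx i' j'.
  by rewrite /nv mulmxDl mul1mx -mulmxA mul_delta_mx_0 1?eq_sym // mulmx0 addr0.
have [jN|jN] := eqVneq j N; last first.
  have aj : a i + e i < a j by move: jI; rewrite (negPf jN) /=; clear; lia.
  (* A non-zero [v j] would give [a j + e j > a i + e i], against the choice of [i]. Hence the root
     element commutes with [nv v]. *)
  have vj : v j 0 = 0.
    apply/eqP/negPn/negP => vj; have [ej _ _] := eP j vj; have := maxi j vj; clear -aj ej; lia.
  have ij : i' != j by apply: contraTneq aj => <-; clear -ai'; lia.
  rewrite -(redmx_elem HF) //.
  apply: (inv_space_stable (k1 := 1%:M + (c' * w ^ (a j - a i')) *: delta_mx i' j) _ Hf) => //.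
  + exact: (inK_elem HF).
  + apply: (inKm_mirabolic HF) => //; apply: (inK_elem HF) => //.
    by rewrite (O_mul HF) // (O_wz HF); clear -aj ai'; lia.
  have delta_nv : delta_mx i' j *m nv v = delta_mx i' j :> 'M[F]_n.+1.
    rewrite /nv mulmxDr mulmx1 mulmxA -{2}(mul_delta_mx (0 : 'I_1) i') -(mulmxA _ _ v) delta_row_mul.
    have -> : row j v = 0 by apply/matrixP=> p q; rewrite !mxE (ord1 q) vj.
    by rewrite mulmx0 mul0mx addr0.
  rewrite -mulmxA -lam_elem !mulmxA; congr (_ *m _); move: (nv v) (nv_delta j) delta_nv => V E1 E2.
  by rewrite mulmxDl mulmxDr mul1mx mulmx1 -scalemxAl -scalemxAr E1 E2.
(* [r v = - c'], so [r nv v = d e_i] has no entry left in column N, while [r] reduces to the wanted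
   row because the inverse of [v i] lies in w O. *)
rewrite jN; set r : 'rV[F]_n.+1 := c' *: (delta_mx 0 N - (v i 0)^-1 *: delta_mx 0 i).
pose k0 : 'M[F]_n.+1 := 1%:M + delta_mx i' (0 : 'I_1) *m r.
pose d := - (c' / v i 0).
have pvi : val_ge 1 (v i 0)^-1 by rewrite eE; clear -ei; lia.
have ovi : O (v i 0)^-1 by apply: (val_ge_O HF) pvi.
have pd : val_ge 1 d by apply: (val_geN HF); apply: (val_ge_Omul HF).
have k0E p q : k0 p q = (p == q)%:R + (p == i')%:R * (c' * ((q == N)%:R - (v i 0)^-1 * (q == i)%:R)).
  by rewrite mxE mul_cr !mxE eqxx andbT.
have k0red : redmx k0 = 1%:M + red c' *: delta_mx i' N.
  apply/matrixP=> p q; rewrite mxE k0E !mxE (redD HF) ?(O_mul HF) ?(O_sub HF) ?(O_mul HF) ?(O_nat HF) //.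
  congr (_ + _); first by case: eqP; rewrite ?(red1 HF) ?(red0 HF).
  case: (eqVneq p i') => _; last by rewrite mul0r (red0 HF) mulr0.
  rewrite mul1r (redM HF) ?(O_sub HF) ?(O_mul HF) ?(O_nat HF) //; congr (_ * _).
  apply/eqP; have -> : (true && (q == N))%:R = red (q == N)%:R.
    by case: eqP; rewrite ?(red1 HF) ?(red0 HF).
  rewrite (red_eq HF) ?(O_sub HF) ?(O_mul HF) ?(O_nat HF) //.
  by rewrite addrC addKr; apply: (val_geN HF); apply: (val_ge_mulO HF) => //; apply: (O_nat HF).
rewrite -k0red.
have orr : Omx O r.
  apply: (Omx_scale HF) => //; apply: (Omx_sub HF); first exact: (Omx_delta HF).
  by apply: (Omx_scale HF) => //; exact: (Omx_delta HF).
apply: (inv_space_stable (k1 := 1%:M + (d * w ^ (a i - a i')) *: delta_mx i' i) _ Hf) => //.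
- apply: (inK_rank1 HF) => //; first exact: (Omx_delta HF).
  apply: (unit_1p HF); rewrite delta_col_mul !mxE eqxx /= (negPf iN') sub0r.
  rewrite mulrN; apply: (val_geN HF); apply: (val_ge_Omul HF) => //.
  by apply: (val_ge_mulO HF) => //; apply: (O_nat HF).
- apply: (inKm_mirabolic HF) => //.
  have pdw : val_ge (1 + (a i - a i' )) (d * w ^ (a i - a i')) by rewrite mulrC (val_ge_wz HF) addrK.
  have od : O (d * w ^ (a i - a i')).
    rewrite mulrC /d mulrN mulrCA (O_opp HF) // (O_mul HF) //.
    by rewrite -(val_geE0 O w) (val_ge_wz HF) eE; clear -ai'; lia.
  have [e1|ne] := eqVneq i' i; last exact: (inK_elem HF).
  rewrite -(mul_delta_mx (0 : 'I_1)) scalemxAl; apply: (inK_rank1 HF).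
  + by apply: (Omx_scale HF) => //; exact: (Omx_delta HF).
  + exact: (Omx_delta HF).
  rewrite -scalemxAr e1 mul_delta_mx !mxE eqxx mulr1; apply: (unit_1p HF).
  by move: pdw; rewrite e1 subrr addr0.
rewrite -mulmxA -lam_elem !mulmxA; congr (_ *m _).
have -> : k0 *m nv v = nv v + delta_mx i' (0 : 'I_1) *m (r *m nv v).
  by rewrite mulmxDl mul1mx mulmxA.
have -> : nv v *m (1%:M + d *: delta_mx i' i) = nv v + d *: delta_mx i' i.
  by move: (nv v) (nv_delta i) => V E1; rewrite mulmxDr mulmx1 -scalemxAr E1.
rewrite -[delta_mx i' i](mul_delta_mx (0 : 'I_1)) scalemxAr; congr (_ + _ *m _).
apply/rowP=> q; rewrite /nv mulmxDr mulmx1 mulmxA mxE [(r *m v *m _) _ _]mxE big_ord1.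
have -> : (r *m v) 0 0 = - c'.
  rewrite /r -scalemxAl mulmxBl -scalemxAl !delta_row_mul !mxE vN sub0r mulVf //.
  by rewrite mulrN1.
by rewrite !mxE eqxx /= /d; case: (q == N); case: (q == i); rewrite /= ?mulr0 ?mulr1; ring.
Qed.

Definition good_exponents (m : nat) a :=
  [/\ a N = 0, forall i j : 'I_n.+1, (i < j)%N -> a j < a i & forall i, i != N -> a i < m%:Z].

(** Positivity keeps the exponent 0 in last place, so the sorting permutation matrix is mirabolic
    and can be absorbed into K(m). *)
Lemma sort_exponents a : a N = 0 -> (forall i, i != N -> 0 < a i) ->
  exists s : 'S_n.+1, s N = N /\ forall i j : 'I_n.+1, (i <= j)%N -> a (s j) <= a (s i).
Proof.
move=> aN apos; pose t := [tuple a i | i < n.+1].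
pose leT (x y : int) := y <= x.
have sz : size (sort leT t) = n.+1 by rewrite size_sort size_tuple.
have [s sE] : exists s : 'S_n.+1, sort leT t = [tuple tnth t (s i) | i < n.+1] :> seq int.
  by apply/tuple_permP; rewrite perm_sort.
have tot : total leT by move=> x y; rewrite /leT le_total.
have tr : transitive leT by move=> x y z h1 h2; apply: le_trans h2 h1.
have srt : sorted leT (sort leT t) by apply: sort_sorted.
have aE i : nth 0 (sort leT t) (i : 'I_n.+1) = a (s i).
  by rewrite sE -tnth_nth !tnth_mktuple.
have dec (i j : 'I_n.+1) : (i <= j)%N -> a (s j) <= a (s i).
  move=> ij; rewrite -!aE; apply: (sorted_leq_nth tr _ 0 srt) => //.
  - by move=> x; rewrite /leT.
  - by rewrite inE sz.
  - by rewrite inE sz.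
exists s; split=> //; apply/eqP/negPn/negP => h.
have := dec (s^-1%g N) N; rewrite permKV aN -ltnS ltn_ord => /(_ isT).
by rewrite leNgt apos.
Qed.

Hypothesis qR : (#|k|%:R : R) != 0.

(** Two equal neighbouring exponents let a simple root group fix [f (lam a)]. The contradiction with
    psi is read at the identity, where the value is non-zero since it determines a
    [lowerB]-invariant vector. *)
Lemma lam_strict m f a : inv_space m f -> a N = 0 -> (exists x, f (lam a) x != 0) ->
  (forall i j : 'I_n.+1, (i <= j)%N -> a j <= a i) ->
  f (lam a) 1%:M != 0 /\ forall i j : 'I_n.+1, (i < j)%N -> a j < a i.
Proof.
move=> Hf aN nz adec; have apos := lam_positive Hf aN nz; have abd := lam_bounded Hf aN nz.
have bi := lam_bop_inv Hf aN abd adec.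
have f1 : f (lam a) 1%:M != 0.
  apply/eqP => e; case: nz => x /eqP [].
  by apply: (bop_inv_null psiD psi0 psi_nt HW HB qR (inv_space_Wsp _ Hf)).
split=> // i j ij.
have lt : (i.+1 < n.+1)%N by have := ltn_ord j; lia.
pose i1 := Ordinal lt.
suff H : a i1 < a i by apply: le_lt_trans H; apply: adec.
rewrite lt_neqAle adec ?leqnSn // andbT; apply/eqP => e.
have iN : i != N by rewrite -val_eqE /=; have := ltn_ord j; lia.
have i1N : i1 != N by apply/eqP=> e1; have := apos i iN; rewrite -e e1 aN ltxx.
have [c /eqP []] := psi_nt.
have u : unitri (1%:M + c *: delta_mx i i1) by apply: unitri_elem.
have := Wsp_psi HW 1%:M (inv_space_Wsp (lam a) Hf) u; rewrite mulmx1 -[1%:M + _]mul1mx.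
rewrite (lam_stable_elem _ _ Hf) //; first last.
- by move=> e'; rewrite e' eqxx in iN.
- by rewrite e.
- by rewrite -val_eqE /= ltn_eqF.
rewrite mul1mx psiUE superdiagD superdiag1 add0r superdiag_delta eqxx -[LHS]mul1r.
by move/(mulIf f1).
Qed.

Theorem inv_space_support m f g : inv_space m f -> (exists x, f g x != 0) ->
  exists z k0 k1 a, [/\ z != 0, inK O k0, inKm O w m k1, good_exponents m a
    & g = z%:M *m k0 *m lam a *m k1 /\ f (lam a) 1%:M != 0].
Proof.
move=> Hf [x fx].
have gu : g \in unitmx.
  by apply: contraR fx => gu; case: Hf => -[_ H _ _] _; rewrite H.
have [z [k0 [v [a [k1 [z0 k0K [k1K mk1] [aN red_v] gE]]]]]] := iwasawa_cartan HF gu.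
have k1m : inKm O w m k1 by apply: (inKm_mirabolic HF).
have k1u := inK_unitmx k1K; have k0u := inK_unitmx k0K.
have pu : nv v *m lam a \in unitmx.
  by move: gu; rewrite gE !unitmx_mul => /andP [/andP [_ ->]].
have fp : f (nv v *m lam a) (x *m redmx k0) != 0.
  apply: contra fx => /eqP e; rewrite gE (inv_space_right _ _ Hf) // (inv_space_left _ Hf) //.
  by rewrite e mulr0.
have v0 : v = 0.
  apply/eqP/negPn/negP => /matrix0Pn [i [j vi]]; rewrite (ord1 j) in vi.
  by case/eqP: fp; apply: (nv_lam_vanish _ Hf aN red_v); exists i.
have nz : exists y, f (lam a) y != 0.
  by exists (x *m redmx k0); move: fp; rewrite v0 /nv mul0mx addr0 mul1mx.
have [s [sN sdec]] := sort_exponents aN (lam_positive Hf aN nz).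
pose P : 'M[F]_n.+1 := perm_mx s.
have PK : inK O P.
  apply: (inK_of_inv HF (h := perm_mx s^-1)).
  - by move=> i j; rewrite !mxE; apply: (O_nat HF).
  - by move=> i j; rewrite !mxE; apply: (O_nat HF).
  by rewrite -perm_mxM mulgV perm_mx1.
have mP : mirabolic P.
  by apply/rowP=> j; rewrite !mxE sN eqxx eq_sym.
have PE : P *m lam a = lam (fun i => a (s i)) *m P.
  apply/matrixP=> i j; rewrite mul_lamE lam_mulE !mxE mulrC.
  by case: eqP => [->|]; rewrite ?mulr0.
have Pu := inK_unitmx PK.
have lE : lam a = invmx P *m lam (fun i => a (s i)) *m P by rewrite -mulmxA -PE mulKmx.
have PiK := inK_inv HF PK.
have nz' : exists y, f (lam (fun i => a (s i))) y != 0.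
  case: nz => y fy; exists (y *m redmx (invmx P)); apply: contra fy => /eqP e.
  rewrite lE (inv_space_right _ _ Hf); last exact: (inKm_mirabolic HF).
  have := inv_space_left y Hf (oner_neq0 F) PiK (lam_unit HF (fun i => a (s i))).
  by rewrite mul_scalar_mx scale1r e mulr0 => ->.
have aN' : a (s N) = 0 by rewrite sN.
have [f1 adec] := lam_strict Hf aN' nz' sdec.
exists z, (k0 *m invmx P), (P *m k1), (fun i => a (s i)); split=> //.
- exact: (inK_mul HF).
- by apply: (inKm_mul HF) => //; exact: (inKm_mirabolic HF).
- split=> //; exact: (lam_bounded Hf aN' nz').
split=> //; rewrite gE v0 /nv mul0mx addr0 mul1mx lE !mulmxA //.
Qed.

End Support.

(** * Haar measure *)

Section HaarMeasure.
Variables (F : fieldType) (O : pred F) (w : F) (k : finFieldType) (red : F -> k).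
Hypothesis HF : is_nonarch_local_field O w red.
Variables (R : fieldType) (n m : nat).
Notation val_ge := (val_ge O w).
Notation Mat := 'M[F]_n.+1.
Implicit Types (g h : Mat) (f : Mat -> R).

(* [digits N] parametrises O / w^N O by [N] digits taken in representatives of the residue field. *)
Definition lift_red (a : k) : F := projT1 (cid (red_surj HF a)).

Lemma lift_redP a : O (lift_red a) /\ red (lift_red a) = a.
Proof. exact: (projT2 (cid (red_surj HF a))). Qed.

Fixpoint digits (N : nat) : finType := if N is N'.+1 then (digits N' * k)%type else unit.

Fixpoint digit_val (N : nat) : digits N -> F :=
  if N is N'.+1 then fun p => digit_val p.1 + w ^ N' * lift_red p.2 else fun _ => 0.

Lemma digit_val_O N (t : digits N) : O (digit_val t).
Proof.
elim: N t => [|N IH] t /=; first exact: (O_0 HF).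
by rewrite (O_add HF) // (O_mul HF) ?(O_wz HF) //; case: (lift_redP t.2).
Qed.

Lemma digit_val_surj N x : O x -> exists t : digits N, val_ge N (x - digit_val t).
Proof.
move=> ox; elim: N => [|N [t tE]].
  by exists tt; rewrite val_geE0 /= subr0.
pose y := w ^ (- N%:Z) * (x - digit_val t); have oy : O y by [].
have xE : x - digit_val t = w ^ N * y.
  by rewrite mulrA -expfzDr ?(w_neq0 HF) // subrr mul1r.
exists (t, red y); rewrite /= opprD addrA xE -mulrBr (val_ge_wz HF).
have [ol rl] := lift_redP (red y).
rewrite (_ : N.+1%:Z - N%:Z = 1); last by lia.
by rewrite -(red_eq HF) // rl.
Qed.

Lemma digit_val_inj N (t t' : digits N) : val_ge N (digit_val t - digit_val t') -> t = t'.
Proof.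
elim: N t t' => [[] []|N IH [t c] [t' c']] //= H.
have [[ol rl] [ol' rl']] := (lift_redP c, lift_redP c').
have E : digit_val t + w ^ N * lift_red c - (digit_val t' + w ^ N * lift_red c') =
    digit_val t - digit_val t' + w ^ N * (lift_red c - lift_red c') by ring.
rewrite E in H; have pN : val_ge N (w ^ N * (lift_red c - lift_red c')).
  by rewrite (val_ge_wz HF) subrr val_geE0 (O_sub HF).
have tt' : t = t'.
  apply: IH; rewrite -[X in val_ge _ X](addrK (w ^ N * (lift_red c - lift_red c'))).
  by apply: (val_geB HF) => //; apply: (val_ge_le HF) H; lia.
move: H; rewrite tt' subrr add0r (val_ge_wz HF) (_ : N.+1%:Z - N%:Z = 1); last by lia.
by rewrite -(red_eq HF) // rl rl' => /eqP ->.
Qed.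

Definition congr_pow N g h := forall i j, val_ge (N : nat) (g i j - h i j).

Lemma congr_refl N g : congr_pow N g g.
Proof. by move=> i j; rewrite subrr (val_ge_0 HF). Qed.

Lemma congr_sym N g h : congr_pow N g h -> congr_pow N h g.
Proof. by move=> H i j; rewrite -opprB (val_geN HF). Qed.

Lemma congr_trans N g h h' : congr_pow N g h -> congr_pow N h h' -> congr_pow N g h'.
Proof.
move=> H H' i j; rewrite (_ : _ - _ = (g i j - h i j) + (h i j - h' i j)); last by ring.
exact: (val_geD HF).
Qed.

Lemma congr_mull N g h h' : Omx O g -> congr_pow N h h' -> congr_pow N (g *m h) (g *m h').
Proof.
move=> og H i j; rewrite !mxE -sumrB; apply: (val_ge_sum HF) => l _.
by rewrite -mulrBr (val_ge_Omul HF).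
Qed.

Lemma congr_mull_iff N g h h' : inK O g ->
  congr_pow N (g *m h) (g *m h') <-> congr_pow N h h'.
Proof.
move=> gK; split=> H; last by apply: congr_mull => //; apply: inK_Omx.
rewrite -[h](mulKmx (inK_unitmx gK)) -[h'](mulKmx (inK_unitmx gK)).
by apply: congr_mull => //; apply: (inK_inv_Omx HF).
Qed.

Lemma congr_inK N g h : (0 < N)%N -> inK O g -> congr_pow N g h -> inK O h.
Proof.
move=> N0 gK H; have og := inK_Omx gK.
have oh : Omx O h.
  move=> i j; rewrite (_ : h i j = g i j - (g i j - h i j)); last by ring.
  by rewrite (O_sub HF) //; apply: (val_ge_O HF) (H i j); lia.
apply: (inK_of_redmx HF) => //; rewrite (_ : redmx red h = redmx red g); first exact: (inK_redmx_unit HF).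
apply/matrixP=> i j; rewrite !mxE; apply/eqP; rewrite (red_eq HF) // -opprB (val_geN HF) //.
by apply: (val_ge_le HF) (H i j); lia.
Qed.

Lemma congr_inKm N g h : (0 < N)%N -> (m <= N)%N -> inKm O w m g -> congr_pow N g h -> inKm O w m h.
Proof.
move=> N0 mN /(inKmP HF) [gK gN] H; apply/(inKmP HF); split; first exact: congr_inK H.
move=> j; rewrite (_ : _ - _ = (g ord_max j - (ord_max == j)%:R) - (g ord_max j - h ord_max j)); last by ring.
by apply: (val_geB HF) => //; apply: (val_ge_le HF) (H _ _); lia.
Qed.

Lemma inKNP N g : inKN O w N g <-> congr_pow N g 1%:M.
Proof. by split=> H i j; have := H i j; rewrite mxE => /(in_powP HF). Qed.

(** The two bounds make membership in K(m) depend only on the class modulo w^N. *)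
Definition level N f := [/\ (0 < N)%N, (m <= N)%N
  & forall k0 k1, inKm O w m k0 -> inKN O w N k1 -> f (k0 *m k1) = f k0].

Lemma level_congr N f g h : level N f -> inKm O w m g -> congr_pow N g h -> f h = f g.
Proof.
move=> [N0 mN H] gm gh; have gK := inKm_inK gm; have gu := inK_unitmx gK.
have -> : h = g *m (invmx g *m h) by rewrite mulKVmx.
apply: H => //; apply/inKNP; apply/(congr_mull_iff _ _ _ gK).
by rewrite mulKVmx // mulmx1; apply: congr_sym.
Qed.

Lemma level_mono N N' f : (N <= N')%N -> level N f -> level N' f.
Proof.
move=> NN' [N0 mN H]; split=> [||k0 k1 k0m /inKNP k1N]; [lia | lia |].
by apply: H => //; apply/inKNP => i j; apply: (val_ge_le HF) (k1N i j); lia.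
Qed.

Lemma level_loc_const N f : level N f -> loc_const O w m f.
Proof. by case=> N0 _ H; exists N. Qed.

Lemma loc_const_level f : loc_const O w m f -> exists N, level N f.
Proof.
case=> N [N0 H]; exists (maxn N m); split=> [||k0 k1 k0m /inKNP k1N]; [lia | lia |].
by apply: H => //; apply/inKNP => i j; apply: (val_ge_le HF) (k1N i j); lia.
Qed.

Definition rep_mx N (M : 'M[digits N]_n.+1) : Mat := map_mx (@digit_val N) M.

Lemma rep_mx_surj N g : Omx O g -> exists M : 'M[digits N]_n.+1, congr_pow N g (rep_mx M).
Proof.
move=> og; have H i : exists t : 'I_n.+1 -> digits N, forall j, val_ge N (g i j - digit_val (t j)).
  by have [t tP] := fin_all_exists (fun j => digit_val_surj N (og i j)); exists t.
have [t tP] := fin_all_exists H.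
by exists (\matrix_(i, j) t i j) => i j; rewrite !mxE.
Qed.

Lemma rep_mx_inj N (M M' : 'M[digits N]_n.+1) : congr_pow N (rep_mx M) (rep_mx M') -> M = M'.
Proof.
by move=> H; apply/matrixP=> i j; apply: digit_val_inj; have := H i j; rewrite !mxE.
Qed.

Hypothesis qR : (#|k|%:R : R) != 0.

(** The first [e] digits are prescribed and the others free: there are q^(N - e) such residues. *)
Lemma card_digits_congr N e c : (e <= N)%N -> O c ->
  (#|[pred t : digits N | val_ge e (digit_val t - c)]|%:R : R) != 0.
Proof.
elim: N => [|N IH]; rewrite leq_eqVlt => /orP [/eqP ->|eN] oc.
- rewrite (@eq_card1 _ tt) ?oner_eq0 // => -[]; rewrite !inE /=.
  by rewrite val_geE0 (O_sub HF) ?(O_0 HF).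
- by [].
- have [t tP] := digit_val_surj N.+1 oc.
  rewrite (@eq_card1 _ t) ?oner_eq0 // => t'; rewrite !inE; apply/idP/eqP => [H|->].
    apply: digit_val_inj; rewrite (_ : _ - _ = (digit_val t' - c) + (c - digit_val t)); last by ring.
    exact: (val_geD HF).
  by rewrite -opprB (val_geN HF).
have -> : #|[pred t : digits N.+1 | val_ge e (digit_val t - c)]| =
    (#|[pred t : digits N | val_ge e (digit_val t - c)]| * #|k|)%N.
  rewrite -(cardX _ (@predT k)); apply: eq_card => -[t d]; rewrite !inE andbT /=.
  have pe : val_ge e (w ^ N * lift_red d).
    apply: (val_ge_le HF (e := N)); first by lia.
    by rewrite (val_ge_wz HF) subrr val_geE0; case: (lift_redP d).
  rewrite addrAC; apply/idP/idP => H; last exact: (val_geD HF).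
  by rewrite -[X in val_ge _ X](addrK (w ^ N * lift_red d)) (val_geB HF).
by rewrite natrM mulf_neq0 // IH.
Qed.

Definition in_rep N (M : 'M[digits N]_n.+1) : bool := `[< inKm O w m (rep_mx M) >].

Definition index_pow N : R := #|k|%:R ^+ (n.+1 * n.+1 * N).

Lemma index_pow_neq0 N : index_pow N != 0. Proof. by rewrite expf_neq0. Qed.

(** The divisor counts all matrices modulo w^N and is a power of q. The number of classes in K(m)
    would not do: its factors q^i - 1 may vanish in [R]. *)
Definition haar_level N f : R := (index_pow N)^-1 * \sum_(M | @in_rep N M) f (rep_mx M).

Lemma haar_level_step N f : level N f -> haar_level N.+1 f = haar_level N f.
Proof.
move=> lf; have [N0 mN _] := lf; rewrite /haar_level.
pose mk (p : 'M[digits N]_n.+1 * 'M[k]_n.+1) : 'M[digits N.+1]_n.+1 := \matrix_(i, j) (p.1 i j, p.2 i j).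
have mk_congr p : congr_pow N (rep_mx p.1) (rep_mx (mk p)).
  move=> i j; rewrite !mxE /= opprD addrA subrr add0r (val_geN HF) // (val_ge_wz HF) subrr val_geE0.
  by case: (lift_redP (p.2 i j)).
have -> : \sum_(M | @in_rep N.+1 M) f (rep_mx M) =
    \sum_(p : 'M[digits N]_n.+1 * 'M[k]_n.+1 | in_rep p.1 && predT p.2) f (rep_mx p.1).
  rewrite (reindex mk) /=; last first.
    exists (fun M : 'M[digits N.+1]_n.+1 => (map_mx fst M, map_mx snd M)) => [[M1 M2]|M] _.
      by congr pair; apply/matrixP=> i j; rewrite !mxE.
    by apply/matrixP=> i j; rewrite !mxE; case: (M i j).
  apply: eq_big => p.
    have c := mk_congr p; have c' := congr_sym c.
    by rewrite andbT; apply/asboolP/asboolP => H; [apply: congr_inKm H c' | apply: congr_inKm H c].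
  move/asboolP => H; apply: (level_congr lf) => //.
  by apply: congr_inKm H (congr_sym (mk_congr p)).
rewrite -(pair_big (fun M1 => @in_rep N M1) predT (fun M1 _ => f (rep_mx M1))) /=.
under eq_bigr do rewrite sumr_const -mulr_natr.
rewrite -mulr_suml card_mx /index_pow mulnSr exprD invfM natrX mulrACA mulVf ?expf_neq0 //.
by rewrite mulr1.
Qed.

Lemma haar_level_mono N N' f : (N <= N')%N -> level N f -> haar_level N' f = haar_level N f.
Proof.
move=> NN' lf; rewrite -(subnKC NN'); elim: (N' - N)%N => [|d IH]; first by rewrite addn0.
by rewrite addnS haar_level_step //; apply: level_mono lf; lia.
Qed.

(** The value is independent of the level chosen, by [haar_level_mono]; a function without level
    gets 0. *)
Definition haar f : R :=
  if pselect (exists N, level N f) is left e then haar_level (projT1 (cid e)) f else 0.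

Lemma haarE N f : level N f -> haar f = haar_level N f.
Proof.
move=> lf; rewrite /haar; case: pselect => [e|ne]; last by case: ne; exists N.
have lf' := projT2 (cid e); set N' := projT1 _ in lf' *.
by have [le|/ltnW le] := leqP N N'; rewrite (haar_level_mono le).
Qed.

Lemma level_lin N a f f' : level N f -> level N f' -> level N (fun x => a * f x + f' x).
Proof.
move=> [N0 mN H] [_ _ H']; split=> // k0 k1 k0m k1N.
by rewrite H ?H'.
Qed.

Lemma level_transl N h f : inKm O w m h -> level N f -> level N (fun x => f (h *m x)).
Proof.
move=> hm [N0 mN H]; split=> // k0 k1 k0m k1N.
by rewrite mulmxA H //; apply: (inKm_mul HF).
Qed.

Lemma common_level f f' : loc_const O w m f -> loc_const O w m f' ->
  exists N, level N f /\ level N f'.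
Proof.
move=> /loc_const_level [N lf] /loc_const_level [N' lf']; exists (maxn N N').
by split; [apply: level_mono lf | apply: level_mono lf']; lia.
Qed.

Lemma haar_ext f f' : loc_const O w m f -> loc_const O w m f' ->
  (forall x, inKm O w m x -> f x = f' x) -> haar f = haar f'.
Proof.
move=> lf lf' E; have [N [lN lN']] := common_level lf lf'.
rewrite (haarE lN) (haarE lN') /haar_level; congr (_ * _).
by apply: eq_bigr => M /asboolP; apply: E.
Qed.

Lemma haar_lin a f f' : loc_const O w m f -> loc_const O w m f' ->
  haar (fun x => a * f x + f' x) = a * haar f + haar f'.
Proof.
move=> lf lf'; have [N [lN lN']] := common_level lf lf'.
rewrite (haarE lN) (haarE lN') (haarE (level_lin a lN lN')) /haar_level.
by rewrite mulrCA -mulrDr; congr (_ * _); rewrite big_split mulr_sumr.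
Qed.

Lemma haar_transl h f : inKm O w m h -> loc_const O w m f ->
  haar (fun x => f (h *m x)) = haar f.
Proof.
move=> hm /loc_const_level [N lf].
have [N0 mN _] := lf.
rewrite (haarE lf) (haarE (level_transl hm lf)) /haar_level; congr (_ * _).
(* Left multiplication acts on the classes of K(m) modulo w^N; the maps on representatives attached
   to [h] and to its inverse are mutually inverse. *)
have tr g : inKm O w m g -> exists s : 'M[digits N]_n.+1 -> 'M[digits N]_n.+1,
    forall M, in_rep M -> congr_pow N (g *m rep_mx M) (rep_mx (s M)) /\ in_rep (s M).
  move=> gm; have : forall M : 'M[digits N]_n.+1, exists M' : 'M[digits N]_n.+1,
      in_rep M -> congr_pow N (g *m rep_mx M) (rep_mx M') /\ in_rep M'.
    move=> M; case: (boolP (in_rep M)) => [/asboolP Mm|_]; last by exists M.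
    have gM := inKm_mul HF gm Mm.
    have [M' E] := rep_mx_surj N (inK_Omx (inKm_inK gM)).
    by exists M' => _; split=> //; apply/asboolP; apply: congr_inKm gM E.
  by case/fin_all_exists => s sP; exists s.
have him := inKm_inv HF hm; have hK := inKm_inK hm; have hu := inK_unitmx hK.
have [s sP] := tr h hm; have [s' sP'] := tr _ him.
have ss' M : in_rep M -> s (s' M) = M.
  move=> Mm; have [c1 m1] := sP' M Mm; have [c2 m2] := sP _ m1.
  apply: rep_mx_inj; apply: congr_trans (congr_sym c2) _.
  apply: congr_trans (congr_mull (inK_Omx hK) (congr_sym c1)) _.
  by rewrite mulKVmx //; apply: congr_refl.
have s's M : in_rep M -> s' (s M) = M.
  move=> Mm; have [c1 m1] := sP M Mm; have [c2 m2] := sP' _ m1.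
  apply: rep_mx_inj; apply: congr_trans (congr_sym c2) _.
  apply: congr_trans (congr_mull (inK_inv_Omx HF hK) (congr_sym c1)) _.
  by rewrite mulKmx //; apply: congr_refl.
rewrite [RHS](reindex_onto s s') //; apply: eq_big => [M|M /asboolP Mm].
  apply/idP/andP => [Mm|[sm /eqP <-]]; last by have [] := sP' _ sm.
  by have [_ sm] := sP M Mm; rewrite s's // eqxx.
have Mr : in_rep M by apply/asboolP.
have [c1 m1] := sP M Mr; apply/esym; apply: (level_congr lf) => //.
exact: (inKm_mul HF).
Qed.

Definition coset_ind N g x : R := `[< congr_pow N x g >]%:R.

Lemma level_coset_ind N g : (0 < N)%N -> (m <= N)%N -> level N (coset_ind N g).
Proof.
move=> N0 mN; split=> // k0 k1 /inKm_inK k0K /inKNP k1N; rewrite /coset_ind; congr (nat_of_bool _)%:R; apply: asbool_equiv_eq.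
have c : congr_pow N (k0 *m k1) k0.
  by have := congr_mull (inK_Omx k0K) k1N; rewrite mulmx1.
by split=> H; [apply: congr_trans (congr_sym c) H | apply: congr_trans c H].
Qed.

Section Uniqueness.
Variable mu : (Mat -> R) -> R.
Hypothesis muH : isHaar O w m mu.

Lemma mu_coset_ind N g : (0 < N)%N -> (m <= N)%N -> inKm O w m g ->
  mu (coset_ind N g) = mu (coset_ind N 1%:M).
Proof.
move=> N0 mN gm; have [_ _ H _] := muH; have gim := inKm_inv HF gm.
rewrite -(H (invmx g) (coset_ind N 1%:M) gim (level_loc_const (level_coset_ind _ N0 mN))).
congr mu; apply/funext => x; rewrite /coset_ind; congr (nat_of_bool _)%:R; apply: asbool_equiv_eq.
rewrite -(congr_mull_iff N x g (inKm_inK gim)) mulVmx //.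
exact: inK_unitmx (inKm_inK gm).
Qed.

Lemma mu_sum N (I : eqType) (r : seq I) (c : I -> R) (G : I -> Mat -> R) :
  (0 < N)%N -> (m <= N)%N -> (forall i, level N (G i)) ->
  level N (fun x => \sum_(i <- r) c i * G i x) /\
  mu (fun x => \sum_(i <- r) c i * G i x) = \sum_(i <- r) c i * mu (G i).
Proof.
move=> N0 mN lG; have [_ lin _ _] := muH; elim: r => [|i r [lv E]].
  have l0 : level N (fun=> 0) by split.
  have -> : (fun x : Mat => \sum_(i <- [::]) c i * G i x) = (fun=> 0).
    by apply/funext => x; rewrite big_nil.
  split=> //; rewrite big_nil; have lc := level_loc_const l0.
  transitivity (-1 * mu (fun=> 0) + mu (fun=> 0)); last by rewrite mulN1r addNr.
  by rewrite -lin //; congr mu; apply/funext=> x; rewrite mulr0 addr0.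
have -> : (fun x : Mat => \sum_(i <- i :: r) c i * G i x) =
    (fun x => c i * G i x + \sum_(i <- r) c i * G i x).
  by apply/funext => x; rewrite big_cons.
split; first exact: level_lin.
by rewrite big_cons -E; apply: lin; [exact: level_loc_const (lG i) | exact: level_loc_const lv].
Qed.

(** A function of level [N] is a combination of indicators of congruence cosets, and by invariance
    [mu] gives them all the same mass. *)
Lemma haar_unique N f : level N f ->
  mu f = mu (coset_ind N 1%:M) * index_pow N * haar f.
Proof.
move=> lf; have [N0 mN _] := lf; have [ext _ _ _] := muH.
pose s := [seq M <- index_enum 'M[digits N]_n.+1 | in_rep M].
have [|lv E] := @mu_sum N _ s (fun M => f (rep_mx M)) (fun M => coset_ind N (rep_mx M)) N0 mN.
  by move=> M; apply: level_coset_ind.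
rewrite (haarE lf) /haar_level -mulrA mulVKf ?index_pow_neq0 // mulr_sumr -big_filter -/s.
transitivity (mu (fun x => \sum_(M <- s) f (rep_mx M) * coset_ind N (rep_mx M) x)).
  apply: ext; [exact: level_loc_const lf | exact: level_loc_const lv |].
  move=> x xm; rewrite big_filter.
  have [M xM] := rep_mx_surj N (inK_Omx (inKm_inK xm)).
  have Mm : in_rep M by apply/asboolP; apply: congr_inKm xm xM.
  rewrite (bigD1 M) //= big1 ?addr0 => [|M' /andP [_ M'M]].
    rewrite /coset_ind; case: asboolP => // _; rewrite mulr1.
    by apply/esym; apply: (level_congr lf).
  rewrite /coset_ind; case: asboolP => [c|]; last by rewrite mulr0.
  case/eqP: M'M; apply: rep_mx_inj; apply: congr_trans (congr_sym c) xM.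
rewrite E !big_filter; apply: eq_bigr => M /asboolP Mm.
by rewrite mu_coset_ind // mulrC.
Qed.

End Uniqueness.

End HaarMeasure.

(** * Oldforms *)

Section CartanInvariants.
Variables (F : fieldType) (O : pred F) (w : F) (k : finFieldType) (red : F -> k).
Hypothesis HF : is_nonarch_local_field O w red.
Variable n : nat.
Notation N := (@ord_max n).
Notation val_ge := (val_ge O w).
Notation lam := (@lam F w n).
Implicit Types (a b : 'I_n.+1 -> int).

Lemma inK_unit_perm (g : 'M[F]_n.+1) : inK O g -> exists s : 'S_n.+1, forall i, unitO O (g i (s i)).
Proof.
move=> gK; have := inK_redmx_unit HF gK; rewrite unitmxE unitfE => d.
suff /existsP [s /forallP sP] : [exists s : 'S_n.+1, [forall i, redmx red g i (s i) != 0]].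
  exists s => i; apply: (unit_of_red HF); first exact: (inK_Omx gK).
  by have := sP i; rewrite mxE.
apply: contraR d; rewrite negb_exists => /forallP h; apply/eqP.
rewrite /determinant big1 // => s _; have := h s; rewrite negb_forall => /existsP [i].
by rewrite negbK => /eqP e; rewrite (bigD1 i) //= e mul0r mulr0.
Qed.

(** Unit entries of [k0] and [h] along permutations bound each [b i] above and below by shifted
    exponents of [a]. The zero last exponents make the shift 0, equality of the sums makes the
    bounds sharp, and monotonicity makes the permutation trivial. *)
Lemma cartan_unique a b z k0 h : z != 0 -> inK O k0 -> inK O h ->
  a N = 0 -> b N = 0 ->
  (forall i j : 'I_n.+1, (i < j)%N -> a j < a i) -> (forall i j : 'I_n.+1, (i < j)%N -> b j < b i) ->
  lam b *m h = z%:M *m k0 *m lam a -> forall i, b i = a i.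
Proof.
move=> z0 k0K hK aN bN adec bdec E.
have nonneg (c : 'I_n.+1 -> int) : c N = 0 -> (forall i j : 'I_n.+1, (i < j)%N -> c j < c i) -> forall i, 0 <= c i.
  move=> cN cdec i; have [->|iN] := eqVneq i N; first by rewrite cN.
  by rewrite -cN ltW // cdec // ltn_neqAle iN -ltnS ltn_ord.
have a0 := nonneg a aN adec; have b0 := nonneg b bN bdec.
have [c [u [uu zE]]] := uniformizer_decomp HF z0.
have Eij i j : w ^ b i * h i j = w ^ (c + a j) * (u * k0 i j).
  have := congr1 (fun M : 'M_n.+1 => M i j) E.
  rewrite /= lam_mulE mul_lamE mul_scalar_mx mxE zE => ->.
  by rewrite expfzDr ?(w_neq0 HF) //; ring.
have [s sP] := inK_unit_perm k0K; have [s' sP'] := inK_unit_perm hK.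
have [_ ou _] := uu.
have le1 i : b i <= c + a (s i).
  rewrite -(val_ge_unit HF _ _ (unitO_mul HF uu (sP i))) -Eij (val_ge_wz HF) subrr val_geE0.
  exact: (inK_Omx hK).
have le2 i : c + a (s' i) <= b i.
  rewrite -(val_ge_unit HF _ _ (sP' i)) Eij (val_ge_wz HF) subrr val_geE0.
  by rewrite (O_mul HF) //; apply: (inK_Omx k0K).
have c0 : c = 0.
  have := le2 N; have := le1 (s^-1%g N); rewrite permKV aN bN.
  have := b0 (s^-1%g N); have := a0 (s' N); clear; lia.
have sumE (t : 'S_n.+1) : \sum_i a (t i) = \sum_i a i by rewrite [RHS](reindex_inj (@perm_inj _ t)).
have eq_all : \sum_i (a (s i) - b i) = 0.
  apply/eqP; rewrite eq_le sumrB sumE subr_ge0 subr_le0 -{1}(sumE s') -(sumE s).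
  by rewrite !ler_sum // => i _; [have := le1 i | have := le2 i]; rewrite c0 add0r.
have bE i : b i = a (s i).
  have /eqP := eq_all; rewrite psumr_eq0 => [/allP/(_ i)|j _]; last first.
    by rewrite subr_ge0; have := le1 j; rewrite c0 add0r.
  by rewrite mem_index_enum => /(_ isT); rewrite subr_eq0 => /eqP.
have sid : forall i, s i = i.
  apply: increasing_perm_id => i j ji; have ij : (i < j)%N by rewrite ji.
  have := bdec i j ij; rewrite !bE => lt; rewrite ltnNge; apply/negP.
  rewrite leq_eqVlt => /orP [/eqP/val_inj e|/adec]; first by rewrite e ltxx in lt.
  by move=> lt'; have := lt_trans lt lt'; rewrite ltxx.
by move=> i; rewrite bE sid.
Qed.

End CartanInvariants.

Section Oldforms.
Variables (F : fieldType) (O : pred F) (w : F) (k : finFieldType) (red : F -> k).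
Hypothesis HF : is_nonarch_local_field O w red.
Variables (R : closedFieldType) (n : nat) (psi : k -> R).
Variable Wsp : ('M[k]_n.+1 -> R) -> Prop.
Hypothesis psiD : forall a b, psi (a + b) = psi a * psi b.
Hypothesis psi0 : psi 0 = 1.
Hypothesis psi_nt : exists a, psi a != 1.
Hypothesis qR : (#|k|%:R : R) != 0.
Hypothesis HW : cusp_whittaker psi Wsp.
Variable omega : F -> R.
Hypothesis HC : central_compat O red Wsp omega.
Variable B : 'M[k]_n.+1 -> R.
Hypothesis HB : isBessel psi Wsp B.
Variable Bt : 'M[F]_n.+1 -> 'M[k]_n.+1 -> R.
Hypothesis HBt : isBesselVec O red Wsp omega B Bt.
Hypothesis n_gt0 : (0 < n)%N.
Notation N := (@ord_max n).
Notation val_ge := (val_ge O w).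
Notation lam := (@lam F w n).
Notation redmx := (redmx red).
Notation inv_space := (inv_space O w red Wsp omega).
Notation good := (@good_exponents n).
Implicit Types (f : 'M[F]_n.+1 -> 'M[k]_n.+1 -> R) (a b : 'I_n.+1 -> int).

Lemma inv_space_lin m c f f' : inv_space m f -> inv_space m f' ->
  inv_space m (fun g x => c * f g x + f' g x).
Proof.
move=> [[Wf uf lf [gs sf]] rf] [[Wf' uf' lf' [gs' sf']] rf']; split; last first.
  by move=> g k0 x k0m; rewrite rf ?rf'.
split.
- by move=> g; apply: (Wsp_lin HW).
- by move=> g x gu; rewrite uf ?uf' // mulr0 addr0.
- by move=> z k0 g x z0 k0K gu; rewrite lf ?lf' // mulrDr mulrCA.
exists (gs ++ gs') => g [x nz].
have [fz|fnz] := eqVneq (f g x) 0.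
  have f'nz : f' g x != 0 by apply: contraNneq nz => ->; rewrite fz mulr0 addr0.
  have [|z [k0 [h [a b c' d]]]] := sf' g; first by exists x.
  by exists z, k0, h; split=> //; rewrite mem_cat c' orbT.
have [|z [k0 [h [a b c' d]]]] := sf g; first by exists x.
by exists z, k0, h; split=> //; rewrite mem_cat c'.
Qed.

Lemma inv_space_zero m : inv_space m (fun _ _ => 0).
Proof.
split=> //; split=> [g|//|z k0 g x _ _ _|]; first exact: (Wsp0 HW); first by rewrite mulr0.
by exists [::] => g [x]; rewrite eqxx.
Qed.

Lemma inv_space_sum m (I : Type) (r : seq I) (c : I -> R) (G : I -> 'M[F]_n.+1 -> 'M[k]_n.+1 -> R) :
  (forall i, inv_space m (G i)) -> inv_space m (fun g x => \sum_(i <- r) c i * G i g x).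
Proof.
move=> H; elim: r => [|i r IH].
  have := inv_space_zero m; congr (inv_space m).
  by apply/funext=> g; apply/funext=> x; rewrite big_nil.
have := inv_space_lin (c i) (H i) IH; congr (inv_space m).
by apply/funext=> g; apply/funext=> x; rewrite big_cons.
Qed.

Lemma inv_space_div m c f : inv_space m f -> inv_space m (fun g x => f g x / c).
Proof.
move=> Hf; have := inv_space_lin c^-1 Hf (inv_space_zero m); congr (inv_space m).
by apply/funext=> g; apply/funext=> x; rewrite addr0 mulrC.
Qed.

Lemma bessel_vec_ZK z k0 x : z != 0 -> inK O k0 ->
  Bt (z%:M *m k0) x = omega z * B (x *m redmx k0).
Proof.
move=> z0 k0K; have [[_ _ H _] _ H1] := HBt.
by rewrite -[_ *m k0]mulmx1 H ?unitmx1 // H1.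
Qed.

Lemma bessel_vec_K k0 x : inK O k0 -> Bt k0 x = B (x *m redmx k0).
Proof.
move=> k0K; have := bessel_vec_ZK x (oner_neq0 F) k0K.
by rewrite mul_scalar_mx scale1r (omega1 HC) mul1r.
Qed.

Lemma bessel_vec_congr g kap x : inK O kap -> redmx kap = 1%:M -> Bt (g *m kap) x = Bt g x.
Proof.
move=> kK k1; have [[_ off _ _] offZ _] := HBt.
have ku := inK_unitmx kK.
have [[z [k0 [z0 k0K ->]]]|ng] := pselect (isZK O g).
  rewrite -mulmxA !bessel_vec_ZK //; last exact: (inK_mul HF).
  by rewrite (redmx_mul HF) ?k1 ?mulmx1 //; apply: inK_Omx.
rewrite !offZ // => -[z [k0 [z0 k0K E]]]; apply: ng.
exists z, (k0 *m invmx kap); split=> //; first by apply: (inK_mul HF) => //; apply: (inK_inv HF).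
by rewrite mulmxA -E mulmxK.
Qed.

Definition integrand a g x (h : 'M[F]_n.+1) : R := Bt (g *m h *m lam (fun i => - a i)) x.

Section Exponents.
Variables (m : nat) (a : 'I_n.+1 -> int).
Hypothesis ga : good m a.

Lemma good_bounds i : 0 <= a i /\ a i < m%:Z.
Proof.
have [aN adec ab] := ga.
have ge0 j : 0 <= a j.
  have [->|jN] := eqVneq j N; first by rewrite aN.
  by rewrite -aN ltW // adec // ltn_neqAle jN -ltnS ltn_ord.
split=> //; have [->|/ab //] := eqVneq i N.
have := ab ord0; rewrite aN; have := ge0 ord0 => h1 h2.
apply: le_lt_trans h1 (h2 _); rewrite -val_eqE /=; clear -n_gt0; lia.
Qed.

(** Conjugation by [lam a] lowers valuations by less than [m], so matrices congruent to 1 modulo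
    w^(m+1) stay in K^1, under which the Bessel vector is invariant. *)
Lemma integrand_level g x : level O w m m.+1 (integrand a g x).
Proof.
split=> // k0 k1 k0m /(inKNP HF) k1N; rewrite /integrand.
pose kap := lam a *m k1 *m lam (fun i => - a i).
have -> : g *m (k0 *m k1) *m lam (fun i => - a i) = g *m k0 *m lam (fun i => - a i) *m kap.
  rewrite /kap -!mulmxA; do 2 congr (_ *m _); rewrite !mulmxA.
  have := mulmx1C (lam_inv HF a) => ->.
  by rewrite mul1mx.
have kapE i j : kap i j - (i == j)%:R = w ^ (a i - a j) * (k1 i j - (i == j)%:R).
  rewrite /kap mul_lamE lam_mulE mulrAC -expfzDr ?(w_neq0 HF) // mulrBr; congr (_ - _).
  by case: eqP => [->|_]; rewrite ?mulr0 // subrr mulr1.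
have kap1 i j : val_ge 1 (kap i j - (i == j)%:R).
  rewrite kapE (val_ge_wz HF); have := k1N i j; rewrite mxE; apply: (val_ge_le HF).
  have [a1 a2] := good_bounds i; have [a3 a4] := good_bounds j; clear -a1 a2 a3 a4; lia.
have kapO : Omx O kap by apply: (Omx_of_congr1 HF).
have kapr : redmx kap = 1%:M.
  by apply/eqP; rewrite (redmx_eq1 HF) //; apply/forallP=> i; apply/forallP=> j.
apply: bessel_vec_congr => //; apply: (inK_of_redmx HF) => //.
by rewrite kapr unitmx1.
Qed.

Notation repmx := (@rep_mx F O w k red HF n m.+1).
Notation inrep := (@in_rep F O w k red HF n m m.+1).

Definition averaged g x : R := haar HF m (integrand a g x).

Lemma averagedE g x : averaged g x =
  (index_pow k R n m.+1)^-1 * \sum_(M | inrep M) integrand a g x (repmx M).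
Proof. by rewrite /averaged (haarE HF qR (integrand_level g x)). Qed.

Lemma averaged_neq0 g x : averaged g x != 0 -> exists z k0 h,
  [/\ z != 0, inK O k0, inKm O w m h & g *m h = z%:M *m k0 *m lam a] /\
  exists M : 'M[digits k m.+1]_n.+1, h = repmx M.
Proof.
rewrite averagedE => nz.
have /existsP [M /andP [Mm nzM]] : [exists M, inrep M &&
    (integrand a g x (repmx M) != 0)].
  apply: contraR nz; rewrite negb_exists => /forallP h.
  rewrite big1 ?mulr0 // => M Mm; apply/eqP; have := h M.
  by rewrite Mm /= negbK.
have [_ offZ _] := HBt.
have [[z [k0 [z0 k0K E]]]|/offZ e] := pselect (isZK O (g *m repmx M *m lam (fun i => - a i))); last first.
  by rewrite /integrand e eqxx in nzM.
exists z, k0, (repmx M); split; last by exists M.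
split=> //; first by apply/asboolP.
by rewrite -E -mulmxA (mulmx1C (lam_inv HF a)) mulmx1.
Qed.

(** Right translation by K(m) is absorbed by the left invariance of the measure. Compact support
    holds because, at a fixed level, the integral is a finite sum. *)
Lemma averaged_inv : inv_space m averaged.
Proof.
have [[WB offB lB _] offZ _] := HBt.
have lamu : lam (fun i => - a i) \in unitmx by apply: (lam_unit HF).
split; last first.
  move=> g h x hm; rewrite /averaged -[RHS](haar_transl HF qR hm); last first.
    exact: level_loc_const (integrand_level g x).
  by congr (haar HF m _); apply/funext => y; rewrite /integrand !mulmxA.
split.
- move=> g; have H : Wsp (fun x => \sum_(M | inrep M)
      1 * Bt (g *m repmx M *m lam (fun i => - a i)) x) by apply: (Wsp_sum HW).
  have := Wsp_scale HW (index_pow k R n m.+1)^-1 H; congr Wsp.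
  apply/funext => x; rewrite averagedE; congr (_ * _); apply: eq_bigr => M _.
  by rewrite mul1r.
- move=> g x gu; rewrite averagedE big1 ?mulr0 // => M _.
  by rewrite /integrand offB // !unitmx_mul (negPf gu).
- move=> z k0 g x z0 k0K gu; rewrite !averagedE mulrCA; congr (_ * _).
  rewrite mulr_sumr; apply: eq_bigr => M /asboolP Mm; rewrite /integrand -!mulmxA.
  rewrite (mulmxA z%:M) lB // !unitmx_mul gu lamu andbT /=.
  exact: inK_unitmx (inKm_inK Mm).
exists [seq lam a *m invmx (repmx M) | M <- enum 'M[digits k m.+1]_n.+1] => g [x].
move=> /averaged_neq0 [z [k0 [h [[z0 k0K hm E] [M hM]]]]].
have hu := inK_unitmx (inKm_inK hm).
exists z, k0, (lam a *m invmx h); split=> //.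
  by apply/mapP; exists M; rewrite ?mem_enum // hM.
by rewrite mulmxA -E mulmxK.
Qed.

Lemma averaged_other b : good m b -> averaged (lam b) 1%:M != 0 -> forall i, b i = a i.
Proof.
move=> [bN bdec _] /averaged_neq0 [z [k0 [h [[z0 k0K hm E] _]]]].
have [aN adec _] := ga.
exact: (cartan_unique HF z0 k0K (inKm_inK hm) aN bN adec bdec E).
Qed.

(** If the conjugate is integral, it reduces into the group of [lowerB], where the Bessel function
    is supported at 1. If not, it lies outside Z K, since its determinant is a unit. The integrand
    is thus the indicator of K^1. *)
Lemma bessel_at_conj (h : 'M[F]_n.+1) : inKm O w m h ->
  Bt (lam a *m h *m lam (fun i => - a i)) 1%:M =
  [forall i, forall j, val_ge 1 ((lam a *m h *m lam (fun i => - a i)) i j - (i == j)%:R)]%:R.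
Proof.
move=> hm; set kap := _ *m _ *m _; have [aN adec ab] := ga.
have hK := inKm_inK hm.
have detE : \det kap = \det h.
  rewrite /kap !det_mulmx mulrAC -det_mulmx (lam_inv HF) det1 mul1r //.
have kapE i j : kap i j = w ^ (a i - a j) * h i j.
  by rewrite /kap mul_lamE lam_mulE mulrAC -expfzDr ?(w_neq0 HF).
clearbody kap.
have kap_upper (i j : 'I_n.+1) : (i < j)%N -> val_ge 1 (kap i j).
  move=> ij; rewrite kapE (val_ge_wz HF); apply: (val_ge_le HF (e := 0)).
    by have := adec i j ij; clear; lia.
  by rewrite val_geE0; apply: (inK_Omx hK).
have kap_last j : val_ge 1 (kap N j - (N == j)%:R).
  have /(inKmP HF) [_ hN] := hm.
  have -> : kap N j - (N == j)%:R = w ^ (- a j) * (h N j - (N == j)%:R).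
    rewrite kapE aN sub0r mulrBr; case: eqP => [<-|_]; rewrite ?mulr0 //.
    by rewrite aN oppr0 expr0z mulr1.
  rewrite (val_ge_wz HF); apply: (val_ge_le HF) (hN j).
  have [_] := good_bounds j; clear; lia.
have [kO|nkO] := pselect (Omx O kap).
  have kK : inK O kap by case: hK => _ d1 d2; split; rewrite ?detE.
  rewrite bessel_vec_K // mul1mx -(redmx_eq1 HF) //; have [_ B1 _] := HB.
  case: eqVneq => [->|ne] //; apply: (bessel_lowerB psiD psi0 psi_nt HW HB) => //.
  apply/lowerBP; split; first exact: (inK_redmx_unit HF).
    by move=> i j ij; rewrite mxE; apply/eqP; rewrite (red_eq0 HF) //; apply: kap_upper.
  apply/rowP=> j; rewrite !mxE eqxx /=; apply/eqP.
  by rewrite [j == N]eq_sym -(red_bool HF) (red_eq HF) ?(O_nat HF).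
have -> : [forall i, forall j, val_ge 1 (kap i j - (i == j)%:R)] = false.
  apply/negP => /forallP H; apply: nkO; apply: (Omx_of_congr1 HF) => i j.
  exact: (forallP (H i)).
have [_ offZ _] := HBt; apply: offZ => -[z [k0 [z0 k0K E]]]; apply: nkO.
(* Comparing determinants, the valuation of [z] times the size of the matrices is 0. *)
suff uz : unitO O z.
  by move=> i j; rewrite E mul_scalar_mx mxE (O_mul HF) //; [case: uz | exact: (inK_Omx k0K)].
have [c [u [uu zE]]] := uniformizer_decomp HF z0.
have : \det h = z ^+ n.+1 * \det k0 by rewrite -detE E det_mulmx det_scalar.
have [_ dh0 odh] := hK; have [_ dk0 odk] := k0K.
have udh : unitO O (\det h) by split=> //; apply: (O_det HF); apply: inK_Omx.
have udk : unitO O (\det k0) by split=> //; apply: (O_det HF); apply: inK_Omx.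
have uun : unitO O (u ^+ n.+1).
  by elim: (n.+1) => [|l IH]; [rewrite expr0; apply: (unitO1 HF) | rewrite exprS; apply: (unitO_mul HF)].
rewrite zE exprMn exprnP exprz_exp -mulrA => Ed.
have P d : (d <= 0) = (d <= c * n.+1%:Z).
  by rewrite -(val_ge_unit HF _ _ udh) expr0z mul1r Ed (val_ge_unit HF) //; apply: (unitO_mul HF).
have cn : c * n.+1%:Z = 0.
  by apply/eqP; rewrite eq_le P lexx -P lexx.
have c0 : c = 0 by move/eqP: cn; rewrite mulf_eq0 => /orP [/eqP|/eqP]; lia.
by rewrite c0 expr0z mul1r.
Qed.

(* Up to a power of q, the value is the number of classes in the intersection of lam^-1 K^1 lam
   and K(m), which is again a power of q. *)
Lemma averaged_self : averaged (lam a) 1%:M != 0.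
Proof.
have [aN adec ab] := ga.
rewrite averagedE mulf_neq0 ?invr_eq0 ?(index_pow_neq0 n qR) //.
(* In the last row K(m) asks for congruence modulo w^m, which implies the condition on the
   conjugate. In the other rows, conjugate in K^1 means congruence modulo w^(1 + a_j - a_i), void
   when this exponent is negative. *)
pose e (i j : 'I_n.+1) : nat := if i == N then m else absz (Num.max 0 (1 + a j - a i)).
have em i j : (e i j <= m.+1)%N.
  rewrite /e; case: ifP => // _.
  have [h1 h2] := good_bounds i; have [h3 h4] := good_bounds j.
  clear -h1 h2 h3 h4; lia.
pose P (i j : 'I_n.+1) : pred (digits k m.+1) :=
  [pred t | val_ge (e i j) (digit_val HF t - (i == j)%:R)].
have cnt : (#|[pred M : 'M[digits k m.+1]_n.+1 | [forall i, forall j, P i j (M i j)]]|%:R : R) != 0.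
  rewrite card_matrix_family natr_prod; apply/prodf_neq0 => -[i j] _ /=.
  exact: (card_digits_congr HF qR (em i j) (O_nat HF _)).
move: cnt; rewrite -sum1_card natr_sum big_mkcond /=.
set S := \sum_M _; set S' := \sum_(M | _) _; suff -> : S = S' by [].
rewrite /S /S' [RHS]big_mkcond; apply: eq_bigr => M _; set r := repmx M.
have rO : Omx O r by move=> i j; rewrite mxE; apply: (digit_val_O HF).
set kap := lam a *m r *m lam (fun i => - a i).
have kapE i j : kap i j - (i == j)%:R = w ^ (a i - a j) * (r i j - (i == j)%:R).
  rewrite /kap mul_lamE lam_mulE mulrAC -expfzDr ?(w_neq0 HF) // mulrBr; congr (_ - _).
  by case: eqP => [->|_]; rewrite ?mulr0 // subrr mulr1.
have PE i j : P i j (M i j) = val_ge (e i j) (r i j - (i == j)%:R) by rewrite /P /= mxE.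
rewrite inE; have [Mm|Mm] := asboolP (inKm O w m r); last first.
  have -> : inrep M = false by apply/asboolP.
  case: ifP => // /forallP H; case: Mm; apply/(inKmP HF).
  have kap1 i j : val_ge 1 (kap i j - (i == j)%:R).
    rewrite kapE (val_ge_wz HF); have := forallP (H i) j; rewrite PE; apply: (val_ge_le HF).
    rewrite /e; case: eqP => [->|_]; last by clear; lia.
    have [_] := good_bounds j; rewrite aN; clear; lia.
  split; last first.
    by move=> j; have := forallP (H N) j; rewrite PE /e eqxx.
  have kO : Omx O kap by apply: (Omx_of_congr1 HF).
  have kK : inK O kap.
    apply: (inK_of_redmx HF) => //; suff /eqP -> : redmx kap == 1%:M by rewrite unitmx1.
    by rewrite (redmx_eq1 HF) //; apply/forallP=> i; apply/forallP=> j.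
  have detE : \det kap = \det r.
    by rewrite /kap !det_mulmx mulrAC -det_mulmx (lam_inv HF) det1 mul1r.
  by case: kK => _ d1 d2; split; rewrite -?detE.
have -> : inrep M = true by apply/asboolP.
rewrite /integrand -/r bessel_at_conj // -/kap.
have -> : [forall i, forall j, P i j (M i j)] = [forall i, forall j, val_ge 1 (kap i j - (i == j)%:R)].
  apply: eq_forallb => i; apply: eq_forallb => j; rewrite PE kapE (val_ge_wz HF).
  have /(inKmP HF) [_ rN] := Mm.
  rewrite /e; case: eqP => [->|_].
    rewrite rN aN; apply/esym; apply: (val_ge_le HF) (rN j).
    have [_] := good_bounds j; clear; lia.
  apply/idP/idP; first by apply: (val_ge_le HF); clear; lia.
  case: (lerP 0 (1 + a j - a i)) => [h|h _].
    by apply: (val_ge_le HF); clear -h; lia.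
  by rewrite /= val_geE0 (O_sub HF) ?(O_nat HF).
by case: ifP.
Qed.

Definition oldform g x : R := averaged g x / averaged (lam a) 1%:M.

Lemma oldform_inv : inv_space m oldform.
Proof. exact: inv_space_div averaged_inv. Qed.

Lemma oldform_self : oldform (lam a) 1%:M = 1.
Proof. by rewrite /oldform mulfV // averaged_self. Qed.

Lemma oldform_other b : good m b -> ~ (forall i, b i = a i) -> oldform (lam b) 1%:M = 0.
Proof.
move=> gb ne; apply/eqP; rewrite /oldform mulf_eq0; apply/orP; left.
by apply/negPn/negP => /(averaged_other gb).
Qed.

End Exponents.
End Oldforms.

(** * Newform and dimensions *)

Section ExponentTuples.
Variables (n m : nat).
Notation N := (@ord_max n).

(* a_0 > ... > a_n = 0 is encoded by the increasing sequence a_(n-1) - 1, ..., a_0 - 1. *)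
Definition tuple_exponents (t : n.-tuple 'I_m.-1) (i : 'I_n.+1) : int :=
  if (i < n)%N then (nth 0%N (map val t) (n.-1 - i)).+1%:Z else 0.

Lemma tuple_exponents_good (t : n.-tuple 'I_m.-1) : sorted ltn (map val t) -> good_exponents m (tuple_exponents t).
Proof.
move=> srt; have sz : size (map val t) = n by rewrite size_map size_tuple.
have bd i : (i < n)%N -> (nth 0%N (map val t) (n.-1 - i) < m.-1)%N.
  move=> i_n; have : nth 0%N (map val t) (n.-1 - i) \in map val t by apply: mem_nth; rewrite sz; lia.
  by case/mapP => x _ ->; apply: ltn_ord.
split.
- by rewrite /tuple_exponents /= ltnn.
- move=> i j ij; rewrite /tuple_exponents; have jn := ltn_ord j.
  have -> : (i < n)%N by lia.
  case: ltnP => // j_n; rewrite ltz_nat ltnS.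
  by apply: (sorted_ltn_nth ltn_trans 0%N srt); rewrite ?inE ?sz; lia.
move=> i; rewrite -val_eqE /= => iN; have i_n : (i < n)%N by have := ltn_ord i; lia.
by rewrite /tuple_exponents i_n; have := bd i i_n; lia.
Qed.

Lemma tuple_exponents_inj (t t' : n.-tuple 'I_m.-1) :
  (forall i, tuple_exponents t i = tuple_exponents t' i) -> t = t'.
Proof.
move=> E; have H (s : n.-tuple 'I_m.-1) : size (map val s) = n by rewrite size_map size_tuple.
apply: val_inj; apply: (inj_map val_inj); apply: (@eq_from_nth _ 0%N); first by rewrite !H.
move=> l; rewrite H => ln; have i_n : (n.-1 - l < n.+1)%N by lia.
have := E (Ordinal i_n); rewrite /tuple_exponents /=.
have -> : (n.-1 - l < n)%N by lia.
have -> : (n.-1 - (n.-1 - l))%N = l by lia.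
by case.
Qed.

Lemma good_exponents_lower a (i : 'I_n.+1) : good_exponents m a -> (n - i)%N%:Z <= a i.
Proof.
move=> [aN adec _]; suff H d : forall j : 'I_n.+1, (n - j)%N = d -> d%:Z <= a j by apply: H.
elim: d => [|d IH] j e.
  have -> : j = N by apply: val_inj => /=; have := ltn_ord j; lia.
  by rewrite aN.
have lt : (j.+1 < n.+1)%N by lia.
have e' : (n - j.+1)%N = d by lia.
by have := IH (Ordinal lt) e'; have := adec j (Ordinal lt) (ltnSn _); lia.
Qed.

Hypothesis n_gt0 : (0 < n)%N.

Lemma tuple_exponents_surj a : good_exponents m a ->
  exists t : n.-tuple 'I_m.-1, sorted ltn (map val t) /\ forall i, a i = tuple_exponents t i.
Proof.
move=> ga; have [aN adec ab] := ga; have bounds := good_bounds n_gt0 ga.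
have pos (i : 'I_n.+1) : (i < n)%N -> 0 < a i by move=> i_n; rewrite -aN adec.
pose ix (l : 'I_n) : 'I_n.+1 := inord (n.-1 - l).
have ixE (l : 'I_n) : ix l = (n.-1 - l)%N :> nat by rewrite inordK //; lia.
have lt (l : 'I_n) : (absz (a (ix l) - 1) < m.-1)%N.
  have := pos (ix l); rewrite ixE => h; have [_ h2] := bounds (ix l).
  have h1 : (n.-1 - l < n)%N by clear -n_gt0; lia.
  by have := h h1; clear -h2; lia.
pose t := [tuple Ordinal (lt l) | l < n].
have sz : size (map val t) = n by rewrite size_map size_tuple.
have tE (l : 'I_n) : nth 0%N (map val t) l = absz (a (ix l) - 1).
  have l_t : (l < size t)%N by rewrite size_tuple.
  by rewrite (nth_map (Ordinal (lt l))) // -tnth_nth tnth_mktuple.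
exists t; split.
  apply/(sortedP 0%N) => l; rewrite sz => ln.
  have l_n : (l < n)%N by lia.
  have e1 := tE (Ordinal l_n); have e2 := tE (Ordinal ln); rewrite /= in e1 e2.
  rewrite e1 e2.
  have h1 : (n.-1 - l < n)%N by clear -n_gt0; lia.
  have h2 : (n.-1 - l.+1 < n)%N by clear -n_gt0; lia.
  have p1 := pos (ix (Ordinal l_n)); have p2 := pos (ix (Ordinal ln)).
  have d := adec (ix (Ordinal ln)) (ix (Ordinal l_n)).
  rewrite !ixE /= in p1 p2 d; have := p1 h1; have := p2 h2.
  have /d : (n.-1 - l.+1 < n.-1 - l)%N by clear -ln; lia.
  by clear; lia.
move=> i; rewrite /tuple_exponents; case: ltnP => [i_n|n_i].
  have l_n : (n.-1 - i < n)%N by clear -n_gt0; lia.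
  have := tE (Ordinal l_n); rewrite /= => ->.
  have -> : ix (Ordinal l_n) = i by apply: val_inj; rewrite /= ixE /=; clear -i_n; lia.
  by have := pos i i_n; clear; lia.
have -> : i = N by apply: val_inj; apply/eqP; rewrite eqn_leq n_i -ltnS ltn_ord.
exact: aN.
Qed.

End ExponentTuples.

Section NewformExponents.
Variable n : nat.
Lemma Sigma_good : good_exponents n.+1 (fun i : 'I_n.+1 => (n - i)%N%:Z).
Proof.
split; first by rewrite /= subnn.
  by move=> i j ij; have := ltn_ord j; lia.
by move=> i _; lia.
Qed.

Hypothesis n_gt0 : (0 < n)%N.

(** Strict decrease through n + 1 integers between 0 and n leaves no freedom. *)
Lemma newform_exponents (a : 'I_n.+1 -> int) : good_exponents n.+1 a -> a = (fun i => (n - i)%N%:Z).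
Proof.
move=> ga; have [aN adec _] := ga.
have up d : forall i : 'I_n.+1, i = d :> nat -> a i <= (n - i)%N%:Z.
  elim: d => [|d IH] i e.
    by have [_] := good_bounds n_gt0 ga i; rewrite e; lia.
  have lt : (d < n.+1)%N by have := ltn_ord i; lia.
  have := IH (Ordinal lt) erefl; have := adec (Ordinal lt) i; rewrite /= e => /(_ (ltnSn _)).
  have := ltn_ord i; lia.
apply/funext => i; apply/eqP; rewrite eq_le (up i) //=.
exact: (good_exponents_lower i ga).
Qed.

End NewformExponents.

Section NewOldforms.
Variables (F : fieldType) (O : pred F) (w : F) (k : finFieldType) (red : F -> k).
Hypothesis HF : is_nonarch_local_field O w red.
Variables (R : closedFieldType) (n : nat) (psi : k -> R).
Variable Wsp : ('M[k]_n.+1 -> R) -> Prop.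
Hypothesis psiD : forall a b, psi (a + b) = psi a * psi b.
Hypothesis psi0 : psi 0 = 1.
Hypothesis psi_nt : exists a, psi a != 1.
Hypothesis qR : (#|k|%:R : R) != 0.
Hypothesis HW : cusp_whittaker psi Wsp.
Variable omega : F -> R.
Hypothesis HC : central_compat O red Wsp omega.
Variable B : 'M[k]_n.+1 -> R.
Hypothesis HB : isBessel psi Wsp B.
Variable Bt : 'M[F]_n.+1 -> 'M[k]_n.+1 -> R.
Hypothesis HBt : isBesselVec O red Wsp omega B Bt.
Hypothesis n_gt0 : (0 < n)%N.
Notation N := (@ord_max n).
Notation lam := (@lam F w n).
Notation inv_space := (inv_space O w red Wsp omega).
Implicit Types (f : 'M[F]_n.+1 -> 'M[k]_n.+1 -> R).

(** The support theorem gives non-vanishing of some [f (lam a)] at the identity itself, so these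
    scalar evaluations separate invariant functions. *)
Lemma inv_space_eq0 m f : inv_space m f ->
  (forall a, good_exponents m a -> f (lam a) 1%:M = 0) -> forall g x, f g x = 0.
Proof.
move=> Hf H g x; apply/eqP/negPn/negP => nz.
have [z [k0 [k1 [a [_ _ _ ga [_ /eqP[]]]]]]] :=
  inv_space_support HF psiD psi0 psi_nt HW HC HB qR Hf (ex_intro _ x nz).
exact: H.
Qed.

(** The oldforms are dual to the evaluations of [f (lam a)] at 1: this gives independence, and the
    difference between [f] and its expansion is killed by every evaluation. *)
Lemma has_dim_inv_space m : has_dim (inv_space m) 'C(m.-1, n).
Proof.
rewrite -card_ltn_sorted_tuples; set T := [set t : n.-tuple 'I_m.-1 | _].
pose ex (i : 'I_#|T|) := @tuple_exponents n m (enum_val i).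
have gex i : good_exponents m (ex i).
  by apply: tuple_exponents_good => //; have := enum_valP i; rewrite inE.
have ex_inj i j : (forall l, ex i l = ex j l) -> i = j.
  by move/(tuple_exponents_inj)/enum_val_inj.
pose b i := oldform HF Bt m (ex i).
have bI i : inv_space m (b i) by apply: (oldform_inv HF qR HW HBt n_gt0 (gex i)).
have bE i j : b i (lam (ex j)) 1%:M = (i == j)%:R.
  case: eqVneq => [->|ij]; first exact: (oldform_self HF psiD psi0 psi_nt qR HW HC HB HBt n_gt0 (gex j)).
  apply: (oldform_other HF qR HBt n_gt0 (gex i) (gex j)) => e.
  by case/eqP: ij; apply: ex_inj => l; rewrite e.
have ev (c : 'I_#|T| -> R) j : \sum_i c i * b i (lam (ex j)) 1%:M = c j.
  rewrite (bigD1 j) //= bE eqxx mulr1 big1 ?addr0 // => i ij.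
  by rewrite bE (negPf ij) mulr0.
exists b; split=> // [c H j|f Hf]; first by rewrite -(ev c j) H.
exists (fun i => f (lam (ex i)) 1%:M) => g x.
have HS := inv_space_sum HW (index_enum _) (fun i => f (lam (ex i)) 1%:M) bI.
have HD := inv_space_lin HW (-1) HS Hf.
apply/eqP; rewrite -subr_eq0 addrC -mulN1r; apply/eqP; apply: (inv_space_eq0 HD) => a ga.
have [t [srt tE]] := tuple_exponents_surj n_gt0 ga.
have tT : t \in T by rewrite inE.
have -> : a = ex (enum_rank_in tT t) by apply/funext => l; rewrite tE /ex enum_rankK_in.
by rewrite ev mulN1r addNr.
Qed.

Lemma no_small_level m f : (m < n.+1)%N -> inv_space m f -> forall g x, f g x = 0.
Proof.
move=> mn Hf; apply: (inv_space_eq0 Hf) => a ga.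
have := good_exponents_lower ord0 ga; have [_ _ /(_ ord0)] := ga.
by rewrite -val_eqE /= => /(_ ltac:(lia)); lia.
Qed.

Lemma Sigma_lam : Sigma w n.+1 = lam (fun i => (n - i)%N%:Z).
Proof. by apply/matrixP=> i j; rewrite !mxE; case: eqP. Qed.

Notation a0 := (fun i : 'I_n.+1 => (n - i)%N%:Z).
Notation c0 := (averaged HF Bt n.+1 a0 (lam a0) 1%:M).

Definition newform := oldform HF Bt n.+1 a0.

Lemma c0_neq0 : c0 != 0.
Proof. exact: (averaged_self HF psiD psi0 psi_nt qR HW HC HB HBt n_gt0 (Sigma_good n)). Qed.

Lemma newform_inv : inv_space n.+1 newform.
Proof. exact: (oldform_inv HF qR HW HBt n_gt0 (Sigma_good n)). Qed.

Lemma newform_Sigma1 : newform (lam a0) 1%:M = 1.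
Proof. exact: (oldform_self HF psiD psi0 psi_nt qR HW HC HB HBt n_gt0 (Sigma_good n)). Qed.

Lemma newform_Sigma x : newform (Sigma w n.+1) x = \sum_(b : 'M[k]_n.+1 | lowerB b) B (x *m b).
Proof.
have [aN adec ab] := (Sigma_good n).
have bi : bop_inv (newform (lam a0)).
  apply: (lam_bop_inv HF HC newform_inv) => // i j; rewrite leq_eqVlt => /orP [/eqP/val_inj ->//|ij].
  by rewrite ltW // adec.
rewrite Sigma_lam (bop_invariants psiD psi0 psi_nt HW HB qR (inv_space_Wsp _ newform_inv) bi).
by rewrite newform_Sigma1 mul1r.
Qed.

Lemma newform_unique f : inv_space n.+1 f -> f (Sigma w n.+1) 1%:M = 1 ->
  forall g x, f g x = newform g x.
Proof.
move=> Hf f1 g x; have HD := inv_space_lin HW (-1) newform_inv Hf.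
apply/eqP; rewrite -subr_eq0 addrC -mulN1r; apply/eqP; apply: (inv_space_eq0 HD) => a ga.
by rewrite (newform_exponents n_gt0 ga) -Sigma_lam f1 Sigma_lam newform_Sigma1 mulr1 addNr.
Qed.

(** The scale is forced by the value at Sigma, evaluated at 1: the sum of the b.B is 1 there, and
    the unnormalised integral is [c0]. *)
Definition newform_measure (G : 'M[F]_n.+1 -> R) : R := haar HF n.+1 G / c0.

Lemma invmx_Sigma : invmx (Sigma w n.+1) = lam (fun i => - a0 i).
Proof. by rewrite Sigma_lam; apply: invmx_uniq; apply: (lam_inv HF). Qed.

Lemma integrand_Sigma g x : integrand w Bt a0 g x = fun k1 => Bt (g *m k1 *m invmx (Sigma w n.+1)) x.
Proof. by apply/funext=> k1; rewrite invmx_Sigma. Qed.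

Lemma newform_integral g x :
  newform g x = newform_measure (fun k1 => Bt (g *m k1 *m invmx (Sigma w n.+1)) x).
Proof. by rewrite -integrand_Sigma. Qed.

Lemma newform_measure_haar : isHaar O w n.+1 newform_measure.
Proof.
have lv g x := integrand_level HF HBt n_gt0 (Sigma_good n) g x.
split.
- by move=> G G' lG lG' E; rewrite /newform_measure (haar_ext HF qR lG lG' E).
- by move=> a G G' lG lG'; rewrite /newform_measure haar_lin // mulrDl mulrA.
- by move=> h G hm lG; rewrite /newform_measure haar_transl.
exists (integrand w Bt a0 (lam a0) 1%:M); split; first exact: level_loc_const (lv _ _).
by rewrite -[X in X != 0]/(newform (lam a0) 1%:M) newform_Sigma1 oner_neq0.
Qed.

Lemma newform_measure_unique mu : isHaar O w n.+1 mu ->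
  (forall g x, newform g x = mu (fun k1 => Bt (g *m k1 *m invmx (Sigma w n.+1)) x)) ->
  forall G, loc_const O w n.+1 G -> mu G = newform_measure G.
Proof.
move=> muH E G lcG; have [N0 lG] := loc_const_level HF lcG.
have l0 := integrand_level HF HBt n_gt0 (Sigma_good n) (lam a0) 1%:M.
(* A level common to [G] and to the integrand: there [mu] and [haar] differ by one scalar, which the
   integral formula at Sigma and 1 determines. *)
pose N1 := maxn N0 n.+2.
have lG1 : level O w n.+1 N1 G by apply: (level_mono HF) lG; rewrite leq_maxl.
have l1 := level_mono HF (leq_maxr N0 n.+2) l0.
have E1 := E (lam a0) 1%:M; rewrite newform_Sigma1 -integrand_Sigma in E1.
rewrite (haar_unique HF qR muH l1) -/c0 in E1.
rewrite (haar_unique HF qR muH lG1) /newform_measure mulrC; congr (_ * _).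
by apply: (mulIf c0_neq0); rewrite mulVf ?c0_neq0.
Qed.

End NewOldforms.

Theorem theorem4p1 (F : fieldType) (O : pred F) (w : F) (k : finFieldType)
    (red : F -> k) (R : closedFieldType) (n : nat) (psi : k -> R)
    (Wsp : ('M[k]_n -> R) -> Prop) (omega : F -> R) (B : 'M[k]_n -> R)
    (Bt : 'M[F]_n -> 'M[k]_n -> R) :
  is_nonarch_local_field O w red ->
  (#|k|%:R : R) != 0 ->
  (2 <= n)%N ->
  nontrivial_char psi ->
  cusp_whittaker psi Wsp ->
  central_compat O red Wsp omega ->
  isBessel psi Wsp B ->
  isBesselVec O red Wsp omega B Bt ->
  [/\ (* (1) conductor, dimension of newforms, support *)
      (forall m, (m < n)%N -> forall f, inv_space O w red Wsp omega m f ->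
         forall g x, f g x = 0),
      has_dim (inv_space O w red Wsp omega n) 1,
      (forall f, inv_space O w red Wsp omega n f -> forall g, (exists x, f g x != 0) ->
         exists z k0 k1, [/\ z != 0, inK O k0, inKm O w n k1 &
                            g = z%:M *m k0 *m Sigma w n *m k1]),
      (* (2) oldforms *)
      (forall m, (n < m)%N -> has_dim (inv_space O w red Wsp omega m) 'C(m.-1, n.-1))
    & (* (3) the normalised newform and its integral formula *)
      exists fnew,
        [/\ inv_space O w red Wsp omega n fnew,
            (forall x, fnew (Sigma w n) x = \sum_(b : 'M[k]_n | lowerB b) B (x *m b)),
            (forall f, inv_space O w red Wsp omega n f ->
               (forall x, f (Sigma w n) x = \sum_(b : 'M[k]_n | lowerB b) B (x *m b)) ->
               forall g x, f g x = fnew g x),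
            (exists g x, fnew g x != 0)
          & exists mu, [/\ isHaar O w n mu,
              (forall g x, fnew g x = mu (fun k1 => Bt (g *m k1 *m invmx (Sigma w n)) x))
            & forall mu', isHaar O w n mu' ->
                (forall g x, fnew g x = mu' (fun k1 => Bt (g *m k1 *m invmx (Sigma w n)) x)) ->
                forall f, loc_const O w n f -> mu' f = mu f]]].
Proof.
case: n Wsp B Bt => [|n] Wsp B Bt HF qR n2 [psiD psi_nt] HW HC HB HBt; first by [].
have n_gt0 : (0 < n)%N by [].
(* Multiplicativity alone would allow psi to be identically zero; the equivariance of [B] and its
   value 1 at the identity exclude this. *)
have psi0 : psi 0 = 1.
  have [_ B1 rB] := HB; have := rB _ 1%:M (@unitri1 k n.+1).
  by rewrite mulmx1 B1 mulr1 psiUE superdiag1 => <-.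
split.
- by move=> m mn f Hf; apply: (no_small_level HF psiD psi0 psi_nt qR HW HC HB n_gt0 mn Hf).
- have := has_dim_inv_space HF psiD psi0 psi_nt qR HW HC HB HBt n_gt0 n.+1.
  by rewrite /= binn.
- move=> f Hf g nz.
  have [z [k0 [k1 [a [z0 k0K k1m ga [gE _]]]]]] :=
    inv_space_support HF psiD psi0 psi_nt HW HC HB qR Hf nz.
  by exists z, k0, k1; split=> //; rewrite Sigma_lam -(newform_exponents n_gt0 ga).
- by move=> m _; apply: (has_dim_inv_space HF psiD psi0 psi_nt qR HW HC HB HBt n_gt0 m).
have nS := newform_Sigma HF psiD psi0 psi_nt qR HW HC HB HBt n_gt0.
exists (newform HF Bt); split.
- exact: (newform_inv HF qR HW HBt n_gt0).
- exact: nS.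
- move=> f Hf fS; apply: (newform_unique HF psiD psi0 psi_nt qR HW HC HB HBt n_gt0 Hf).
  by rewrite fS -nS Sigma_lam; apply: (newform_Sigma1 HF psiD psi0 psi_nt qR HW HC HB HBt n_gt0).
- exists (Sigma w n.+1), 1%:M; rewrite Sigma_lam.
  by rewrite (newform_Sigma1 HF psiD psi0 psi_nt qR HW HC HB HBt n_gt0) oner_neq0.
exists (newform_measure HF Bt); split.
- exact: (newform_measure_haar HF psiD psi0 psi_nt qR HW HC HB HBt n_gt0).
- by move=> g x; apply: newform_integral.
move=> mu muH E f lf.
exact: (newform_measure_unique psiD psi0 psi_nt qR HW HC HB HBt n_gt0 muH E lf).
Qed.
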